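(* Let $d\ge1$, $\tau>0$, let $\rho$ be a Borel probability measure on $[-\tau,0]$, and let $\tilde K:\mathbb{R}^d\times\mathbb{R}^d\to\mathbb{R}^d$ be globally Lipschitz, i.e. there exists $L>0$ such that $|\tilde K(x,y)-\tilde K(\bar x,\bar y)|\le L(|x-\bar x|+|y-\bar y|)$ for all $x,\bar x,y,\bar y\in\mathbb{R}^d$. (i) For any $R_0>0$ and any initial condition $\mu_{in}\in\mathcal{E}=C([-\tau,0],\mathbb{P}_1(\mathbb{R}^d))$ such that $\mu_{in}(t)$ is supported in the ball $B_0(R_0)\subset\mathbb{R}^d$ for every $t\in[-\tau,0]$, there exists a unique solution $\mu\in C([-\tau,\infty),\mathbb{P}_1(\mathbb{R}^d))$ of $$\frac{d}{dt}\mu+\mathrm{div}\left(\tilde{\mathcal{F}}[\mu]\,\mu\right)=0\qquad (t\ge 0)$$ with initial condition $\mu_0=\mu_{in}$ (i.e. $\mu(s)=\mu_{in}(s)$ for $s\in[-\tau,0]$). Moreover, $\mu(t)$ has compact support for any $t\ge0$. (ii) The solution depends continuously on the initial data: there exists a continuous increasing function $r:[0,\infty)\to[1,\infty)$ with $r(0)=1$ such that for any compactly supported initial conditions $\mu_{in},\nu_{in}\in\mathcal{E}$ (i.e. for each of them there is a ball of $\mathbb{R}^d$ containing the supports of its values at all times in $[-\tau,0]$), the corresponding solutions $\mu$ and $\nu$ satisfy $$\mathcal{W}_1(\mu_t,\nu_t)\le r(t)\,\mathcal{W}_1(\mu_{in},\nu_{in})\qquad\text{for all } t\ge0.$$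
   Context: $\mathbb{P}_1(\mathbb{R}^d)$ is the set of Borel probability measures on $\mathbb{R}^d$ with finite first moment, endowed with the Monge-Kantorovich distance $W_1(\mu,\nu)=\sup\{\int_{\mathbb{R}^d}\varphi\,d(\mu-\nu):\varphi:\mathbb{R}^d\to\mathbb{R},\ Lip(\varphi)\le1\}$. The space $\mathcal{E}=C([-\tau,0],\mathbb{P}_1(\mathbb{R}^d))$ is endowed with $\mathcal{W}_1(\mu,\nu)=\max_{s\in[-\tau,0]}W_1(\mu(s),\nu(s))$. For $\mu\in C([-\tau,\infty),\mathbb{P}_1(\mathbb{R}^d))$ and $t\ge0$, $\mu_t\in\mathcal{E}$ is defined by $\mu_t(s)=\mu(t+s)$, $s\in[-\tau,0]$. $B_0(R_0)$ is the ball of radius $R_0$ centered at $0$. The vector field is $$\tilde{\mathcal{F}}[\mu](t,x)=\int_{-\tau}^0\Big(\int_{\mathbb{R}^d}\tilde K(x,y)\,\mu(t+s)(dy)\Big)\,\rho(ds),\qquad t\ge0,\ x\in\mathbb{R}^d.$$ A solution of the equation is understood in the weak sense: for every $\phi\in C^1_c(\mathbb{R}^d)$ and every $t\ge0$, $$\int_{\mathbb{R}^d}\phi\,d\mu(t)=\int_{\mathbb{R}^d}\phi\,d\mu(0)+\int_0^t\int_{\mathbb{R}^d}\tilde{\mathcal{F}}[\mu](s,x)\cdot\nabla\phi(x)\,\mu(s)(dx)\,ds.$$ *)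

(* Defs.v *)
From HB Require Import structures.
From mathcomp Require Import all_boot all_order all_algebra.
From mathcomp Require Import all_classical all_reals all_analysis.
From mathcomp Require Import giry.
Import Order.TTheory GRing.Theory Num.Theory.
Import numFieldNormedType.Exports.

Set Implicit Arguments.
Unset Strict Implicit.
Unset Printing Implicit Defensive.

Local Open Scope classical_set_scope.
Local Open Scope ring_scope.

Section euclidean_space.
Context {R : realType} {d : nat}.
Implicit Types x y : 'rV[R]_d.

Definition dotv x y : R := \sum_(i < d) x 0 i * y 0 i.

(* The library norm on 'rV[R]_d is the sup norm, hence a separate Euclidean
   norm; both induce the same topology. *)
Definition enorm x : R := Num.sqrt (dotv x x).

Definition eball (r : R) : set 'rV[R]_d := [set x | enorm x <= r].

Definition lip1 (phi : 'rV[R]_d -> R) : Prop :=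
  forall x y, `|phi x - phi y| <= enorm (x - y).

Definition gradient (phi : 'rV[R]_d -> R) x : 'rV[R]_d :=
  \row_i 'D_(delta_mx 0 i) phi x.

Definition C1c (phi : 'rV[R]_d -> R) : Prop :=
  [/\ forall x, differentiable phi x,
      continuous (gradient phi)
    & compact (closure [set x | phi x != 0])].

End euclidean_space.

(* R^d equipped with its Borel sigma-algebra *)
Definition borelRV (R : realType) (d : nat) :=
  g_sigma_algebraType (@open 'rV[R]_d).

(* Two elements of P1 are identified when they are related by the library's
   measure_eq, i.e. agree on Borel sets: Leibniz equality would also compare
   the junk values of the underlying functions on non-measurable sets. *)
Record P1 (R : realType) (d : nat) := MkP1 {
  P1_prob :> probability (borelRV R d) R ;
  P1_moment : (\int[P1_prob]_x (enorm (x : 'rV[R]_d))%:E < +oo)%E }.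

Section P1_theory.
Context {R : realType} {d : nat}.
Implicit Types m n : P1 R d.

Definition msupport m : set 'rV[R]_d :=
  [set x | forall U : set 'rV[R]_d, open U -> U x -> (0 < m U)%E].

(* Lipschitz functions are integrable against elements of P1, so that the
   real-valued integrals are the genuine ones and the supremum is finite. *)
Definition W1 m n : \bar R :=
  ereal_sup [set (\int[m]_x phi x - \int[n]_x phi x)%:E
            | phi in [set phi : 'rV[R]_d -> R | lip1 phi]].

(* mu \in C(A, P_1(R^d)): curves are total functions of time, of which only
   the restriction to A is meaningful *)
Definition W1_continuous_on (A : set R) (mu : R -> P1 R d) : Prop :=
  forall t : R, A t -> W1 (mu s) (mu t) @[s --> within A (nbhs t)] --> 0%E.

Definition history (mu : R -> P1 R d) (t : R) : R -> P1 R d :=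
  fun s => mu (t + s).

Definition calW1 (tau : R) (mu nu : R -> P1 R d) : \bar R :=
  ereal_sup [set W1 (mu s) (nu s) | s in `[- tau, 0]].

Definition in_E (tau : R) (mu : R -> P1 R d) : Prop :=
  W1_continuous_on `[- tau, 0] mu.

Definition compactly_supported_in_E (tau : R) (mu : R -> P1 R d) : Prop :=
  in_E tau mu /\
  exists r : R, forall s : R, s \in `[- tau, 0] -> msupport (mu s) `<=` eball r.

End P1_theory.

Section delayed_equation.
Context {R : realType} {d : nat} (tau : R).
Context (rho : probability (measurableTypeR R) R).
Context (K : 'rV[R]_d -> 'rV[R]_d -> 'rV[R]_d).

Definition vfield (mu : R -> P1 R d) (t : R) (x : 'rV[R]_d) : 'rV[R]_d :=
  \row_i \int[rho]_(s in `[- tau, 0]) \int[mu (t + s)]_y K x y 0 i.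

Definition weak_equation (mu : R -> P1 R d) : Prop :=
  forall phi : 'rV[R]_d -> R, C1c phi -> forall t : R, 0 <= t ->
    \int[mu t]_x phi x =
    \int[mu 0]_x phi x +
    \int[lebesgue_measure]_(s in `[0, t])
      \int[mu s]_x dotv (vfield mu s x) (gradient phi x).

Definition is_solution (mu_in mu : R -> P1 R d) : Prop :=
  [/\ W1_continuous_on `[- tau, +oo[ mu,
      forall s : R, s \in `[- tau, 0] -> measure_eq (history mu 0 s) (mu_in s)
    & weak_equation mu].

End delayed_equation.

(* Main.v *)
Require Import Defs.
From HB Require Import structures.
From mathcomp Require Import all_boot all_order all_algebra.
From mathcomp Require Import all_classical all_reals all_analysis.
From mathcomp Require Import giry.
From mathcomp Require Import measurable_realfun.
From mathcomp Require Import lra ring.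
Import Order.TTheory GRing.Theory Num.Theory.
Import numFieldNormedType.Exports.

Set Implicit Arguments.
Unset Strict Implicit.
Unset Printing Implicit Defensive.

Local Open Scope classical_set_scope.
Local Open Scope ring_scope.

(** The theorem rests on a stability estimate between arbitrary weak solutions
    and on a construction of one solution by characteristics.

    Stability ([stability]). Let [mu] and [nu] be two weak solutions. Over a
    short time [h] a weak solution moves like an Euler step: up to an error
    [o(h)], the integral of a test function [f] at time [t + h] is that of
    [f (x + h *: v t x)] at time [t], where [v] is the vector field ([euler_step]).
    Since [v t] is Lipschitz with a constant [Lv] depending on [K] only, the map
    [x + h *: v t x] turns 1-Lipschitz functions into [1 + h * Lv]-Lipschitz ones,
    and the fields of the two solutions differ by at most [Lv] times the largest
    past distance. By duality the distance satisfies a delayed Gronwall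
    inequality, hence grows at most like [expR (C * t)].

    The point that needs care is that the weak formulation only accepts C^1
    compactly supported functions, that the error [o(h)] has to be uniform over
    all 1-Lipschitz functions, and that composition with a Lipschitz field does
    not preserve C^1 functions. So the distance is replaced by its version at a
    fixed scale [e], in which every Lipschitz function is first averaged over a
    cube of side [e] ([smooth]). Averaged functions are C^1 with a gradient whose
    Lipschitz constant depends on [e] only ([smooth_C1c]), which gives uniformity.
    Averaging commutes with the Euler step up to [h * Lv * d * e], because the
    field varies by at most [Lv * d * e] over the cube ([smooth_dist]). The
    Gronwall argument is run at fixed [e] ([smooth_stability]), and then [e] tends
    to 0. It is a first-crossing argument ([forward_induction]): the bound holds
    initially, extends a little beyond any time up to which it holds, and is
    preserved by limits. Uniform integrability of the norm, in the form of
    [mean_excess_small], replaces compactness of supports throughout.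

    Uniqueness is the case of equal initial data, since the distance separates
    Borel measures ([W1le0_measure_eq]).

    Existence ([solution_exists]). A flow [X] defines a curve of measures by
    pushing [mu_in 0] forward, and this curve defines a vector field. With the
    weight [expR (b * t) * (1 + enorm x)] and [b] large, integrating this field
    along [X] is a contraction on flows with exponential bounds, globally in
    time; its fixed point is the limit of the Picard iterates
    ([characteristics]). The chain rule along trajectories and an exchange of
    the integrals in time and space ([mean_tint]) give the weak equation
    ([curve_weak]). Supports stay compact because the flow moves a point by at
    most [expR (b * t) * (1 + enorm x)], and because a measure gives no mass to
    the complement of a ball containing its support ([msupport_null]). *)

(** * Euclidean geometry of row vectors *)

Section euclid.
Context {R : realType} {d : nat}.
Implicit Types x y z : 'rV[R]_d.

Lemma dotvC x y : dotv x y = dotv y x.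
Proof. by apply: eq_bigr => i _; rewrite mulrC. Qed.

Lemma dotvDl x y z : dotv (x + y) z = dotv x z + dotv y z.
Proof. by rewrite -big_split; apply: eq_bigr => i _; rewrite mxE mulrDl. Qed.

Lemma dotvDr x y z : dotv x (y + z) = dotv x y + dotv x z.
Proof. by rewrite dotvC dotvDl !(dotvC x). Qed.

Lemma dotvZl (a : R) x y : dotv (a *: x) y = a * dotv x y.
Proof. by rewrite mulr_sumr; apply: eq_bigr => i _; rewrite mxE mulrA. Qed.

Lemma dotvZr (a : R) x y : dotv x (a *: y) = a * dotv x y.
Proof. by rewrite dotvC dotvZl dotvC. Qed.

Lemma dotvNl x y : dotv (- x) y = - dotv x y.
Proof. by rewrite -scaleN1r dotvZl mulN1r. Qed.

Lemma dotvNr x y : dotv x (- y) = - dotv x y.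
Proof. by rewrite dotvC dotvNl dotvC. Qed.

Lemma dotvv_ge0 x : 0 <= dotv x x.
Proof. by apply: sumr_ge0 => i _; rewrite -expr2 sqr_ge0. Qed.

Lemma enorm_ge0 x : 0 <= enorm x.
Proof. exact: sqrtr_ge0. Qed.
Hint Resolve enorm_ge0 : core.

Lemma sqr_enorm x : enorm x ^+ 2 = dotv x x.
Proof. by rewrite sqr_sqrtr ?dotvv_ge0. Qed.

Lemma cauchy_schwarz x y : `|dotv x y| <= enorm x * enorm y.
Proof.
rewrite -ler_sqr ?nnegrE ?mulr_ge0//.
rewrite -normrX ger0_norm ?sqr_ge0// exprMn !sqr_enorm.
set a := dotv x x; set b := dotv y y; set c := dotv x y.
have b0 : 0 <= b by exact: dotvv_ge0.
have : 0 <= dotv (b *: x - c *: y) (b *: x - c *: y) by exact: dotvv_ge0.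
rewrite dotvDl !dotvDr !dotvNl !dotvNr !dotvZl !dotvZr (dotvC y x) -/a -/b -/c.
rewrite (_ : _ + _ = b * (a * b - c ^+ 2)); last by ring.
move: b0; rewrite le_eqVlt => /orP[/eqP b0 _|b0]; last first.
  by rewrite pmulr_rge0// subr_ge0.
suff -> : c = 0 by rewrite expr0n/= -b0 mulr0.
apply: big1 => i _; have /psumr_eq0P : dotv y y = 0 by [].
move=> /(_ _ i isT) y0; suff -> : y 0 i = 0 by rewrite mulr0.
by apply/eqP; rewrite -sqrf_eq0 expr2 y0// => j _; rewrite -expr2 sqr_ge0.
Qed.

Lemma ler_enormD x y : enorm (x + y) <= enorm x + enorm y.
Proof.
rewrite -ler_sqr ?nnegrE ?addr_ge0// sqrrD !sqr_enorm dotvDl !dotvDr (dotvC y x).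
have := le_trans (ler_norm _) (cauchy_schwarz x y).
rewrite -mulr_natl; lra.
Qed.

Lemma enormZ (a : R) x : enorm (a *: x) = `|a| * enorm x.
Proof.
by rewrite /enorm dotvZl dotvZr mulrA sqrtrM -?expr2 ?sqr_ge0// sqrtr_sqr.
Qed.

Lemma enormN x : enorm (- x) = enorm x.
Proof. by rewrite -scaleN1r enormZ normrN1 mul1r. Qed.

Lemma enorm0 : enorm (0 : 'rV[R]_d) = 0.
Proof. by rewrite -(scale0r 0) enormZ normr0 mul0r. Qed.

Lemma enorm_distC x y : enorm (x - y) = enorm (y - x).
Proof. by rewrite -enormN opprB. Qed.

Lemma ler_enorm_dist x y z : enorm (x - z) <= enorm (x - y) + enorm (y - z).
Proof. by apply: (le_trans _ (ler_enormD _ _)); rewrite addrA subrK. Qed.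

Lemma ler_dist_enorm x y : `|enorm x - enorm y| <= enorm (x - y).
Proof.
have h (a b : 'rV[R]_d) : enorm a - enorm b <= enorm (a - b).
  by rewrite lerBlDr; apply: (le_trans _ (ler_enormD _ _)); rewrite subrK.
by rewrite ler_norml lerNl opprB {1}enorm_distC !h.
Qed.

Lemma coord_le_enorm x i : `|x 0 i| <= enorm x.
Proof.
rewrite -ler_sqr ?nnegrE// sqr_enorm -normrX ger0_norm ?sqr_ge0//.
rewrite /dotv (bigD1 i)//= -expr2 lerDl; apply: sumr_ge0 => j _.
by rewrite -expr2 sqr_ge0.
Qed.

Lemma enorm_le_sum x : enorm x <= \sum_i `|x 0 i|.
Proof.
rewrite -ler_sqr ?nnegrE ?sumr_ge0// sqr_enorm.
rewrite expr2 mulr_suml; apply: ler_sum => i _.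
rewrite -expr2 -real_normK ?num_real// expr2; apply: ler_wpM2l => //.
by rewrite (bigD1 i)//= lerDl sumr_ge0.
Qed.

Lemma enorm_le_coord x (c : R) : (forall i, `|x 0 i| <= c) ->
  enorm x <= d%:R * c.
Proof.
move=> h; apply: (le_trans (enorm_le_sum x)).
apply: (@le_trans _ _ (\sum_(i < d) c)); first by apply: ler_sum => i _.
by rewrite sumr_const card_ord mulr_natl.
Qed.

Lemma mx_norm_le_enorm x : `|x| <= enorm x.
Proof.
rewrite /Num.norm/= mx_normrE; apply/bigmax_leP; split => // -[i j] _ /=.
by rewrite ord1 coord_le_enorm.
Qed.

Lemma coord_le_mx_norm x i : `|x 0 i| <= `|x|.
Proof.
by rewrite [leRHS]/Num.norm/= mx_normrE; apply/bigmax_geP; right; exists (0, i).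
Qed.

Lemma enorm_le_mx_norm x : enorm x <= d%:R * `|x|.
Proof. by apply: enorm_le_coord => i; exact: coord_le_mx_norm. Qed.

Lemma enorm_delta i : enorm (delta_mx 0 i : 'rV[R]_d) = 1.
Proof.
rewrite /enorm /dotv (bigD1 i)//= mxE !eqxx/= mulr1 big1 ?addr0 ?sqrtr1//.
by move=> j /negbTE ji; rewrite mxE eqxx ji/= mulr0.
Qed.

(** Two predicates, since the ambient norm on the codomain of [lipv] is not the
    Euclidean one. *)
Definition lipf (C : R) (f : 'rV[R]_d -> R) :=
  forall x y, `|f x - f y| <= C * enorm (x - y).

Definition lipv (C : R) (f : 'rV[R]_d -> 'rV[R]_d) :=
  forall x y, enorm (f x - f y) <= C * enorm (x - y).

(** The topology comes from the sup norm, which is equivalent to the Euclidean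
    one: Euclidean balls generate the same neighbourhoods. *)
Lemma nbhs_enormP x (P : set 'rV[R]_d) :
  nbhs x P <-> exists2 e : R, 0 < e & forall y, enorm (x - y) < e -> P y.
Proof.
split=> [/nbhs_ballP[e /= e0 xP]|[e e0 xP]].
  exists e => // y xy; apply: xP; rewrite mx_norm_ball /ball_ /=.
  exact: le_lt_trans (mx_norm_le_enorm _) xy.
have d0 : 0 < d.+1%:R :> R by rewrite ltr0n.
apply/nbhs_ballP; exists (e / d.+1%:R); first by rewrite /= divr_gt0.
move=> y; rewrite mx_norm_ball /ball_ /= ltr_pdivlMr// mulrC => xy; apply: xP.
apply: le_lt_trans xy; apply: le_trans (enorm_le_mx_norm _) _.
by apply: ler_wpM2r => //; rewrite ler_nat.
Qed.

Lemma lipv_cvg (C : R) f x : lipv C f -> f y @[y --> x] --> f x.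
Proof.
move=> fC; apply/(@cvgrPdist_lt _ _ _ (nbhs x) _ f (f x)) => e e0.
have C0 : 0 < `|C| + 1 by rewrite ltr_wpDl.
apply/nbhs_enormP; exists (e / (`|C| + 1)); first by rewrite divr_gt0.
move=> y; rewrite ltr_pdivlMr// mulrC => xy.
apply: le_lt_trans xy; apply: le_trans (mx_norm_le_enorm _) _.
apply: le_trans (fC _ _) _; apply: ler_wpM2r => //.
by rewrite (le_trans (ler_norm C))// lerDl.
Qed.

Lemma lipf_cvg (C : R) f x : lipf C f -> f y @[y --> x] --> f x.
Proof.
move=> fC; apply/(@cvgrPdist_lt _ _ _ (nbhs x) _ f (f x)) => e e0.
have C0 : 0 < `|C| + 1 by rewrite ltr_wpDl.
apply/nbhs_enormP; exists (e / (`|C| + 1)); first by rewrite divr_gt0.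
move=> y; rewrite ltr_pdivlMr// mulrC => xy.
apply: le_lt_trans xy; apply: le_trans (fC _ _) _; apply: ler_wpM2r => //.
by rewrite (le_trans (ler_norm C))// lerDl.
Qed.

Lemma lipf_continuous (C : R) f : lipf C f -> continuous f.
Proof. by move=> fC x; exact: lipf_cvg fC. Qed.

Lemma lipv_continuous (C : R) f : lipv C f -> continuous f.
Proof. by move=> fC x; exact: lipv_cvg fC. Qed.

Lemma lipf_enorm : lipf 1 (fun x => enorm x).
Proof. by move=> x y; rewrite mul1r ler_dist_enorm. Qed.

Lemma enorm_continuous : continuous (fun x => enorm x).
Proof. exact: lipf_continuous lipf_enorm. Qed.

Lemma lipf_comp (C D : R) f g : 0 <= C -> lipf C f -> lipv D g ->
  lipf (C * D) (f \o g).
Proof.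
move=> C0 fC gD x y; rewrite /= (le_trans (fC _ _))// -mulrA.
exact: ler_wpM2l.
Qed.

End euclid.
#[global] Hint Extern 0 (is_true (0 <= enorm _)%R) => solve [exact: enorm_ge0] : core.

(** * Integration of functions of linear growth against elements of P1 *)

Section mean.
Context {R : realType} {d : nat}.
Implicit Types (m n : P1 R d) (f g : 'rV[R]_d -> R).

Lemma borel_continuous_measurable f : continuous f ->
  measurable_fun [set: borelRV R d] (f : borelRV R d -> R).
Proof.
move=> /continuousP cf; apply: (measurability _ (RGenOpens.measurableE R)).
move=> _ [_ [a [b ->] <-]]; rewrite setTI.
apply: sub_sigma_algebra; apply: cf; exact: interval_open.
Qed.

Lemma borelv_continuous_measurable (f : 'rV[R]_d -> 'rV[R]_d) : continuous f ->
  measurable_fun [set: borelRV R d] (f : borelRV R d -> borelRV R d).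
Proof.
move=> /continuousP cf.
apply: (@measurability _ _ (borelRV R d) (borelRV R d) setT f (@open 'rV[R]_d)) => //.
move=> _ [A oA <-]; rewrite setTI.
by apply: sub_sigma_algebra; exact: cf.
Qed.

Definition mean m f : R := \int[m]_x f x.

(** Continuous functions of linear growth, the natural test functions for
    measures with finite first moment. *)
Definition lingrowth f :=
  continuous f /\ exists C : R, forall x, `|f x| <= C * (1 + enorm x).

Lemma integrable_enorm m :
  (m : {measure set _ -> \bar R}).-integrable setT
    (EFin \o (fun x : borelRV R d => enorm (x : 'rV[R]_d))).
Proof.
apply/integrableP; split.
  by apply/measurable_EFinP; apply: borel_continuous_measurable; exact: enorm_continuous.
rewrite (_ : (\int[_]_x _)%E = (\int[m]_x (enorm (x : 'rV[R]_d))%:E)%E) ?P1_moment//.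
by apply: eq_integral => x _ /=; rewrite ger0_norm ?enorm_ge0.
Qed.

Lemma integrable_lingrowth m f : lingrowth f ->
  (m : {measure set _ -> \bar R}).-integrable setT (EFin \o (f : borelRV R d -> R)).
Proof.
move=> [cf [C fC]].
apply: (@le_integrable _ _ _ m setT measurableT _
    (EFin \o (fun x : borelRV R d => `|C| * (1 + enorm (x : 'rV[R]_d))))) => //.
- by apply/measurable_EFinP; exact: borel_continuous_measurable.
- move=> x _; rewrite /= lee_fin; apply: le_trans (fC x) _.
  rewrite ger0_norm ?mulr_ge0 ?addr_ge0//.
  by apply: ler_wpM2r; rewrite ?addr_ge0 ?ler_norm.
- rewrite (_ : _ \o _ =
    fun x : borelRV R d => (`|C|%:E * (1%:E + (enorm (x : 'rV[R]_d))%:E))%E)//.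
  apply: integrableZl => //; apply: integrableD => //.
    exact: finite_measure_integrable_cst.
  exact: integrable_enorm.
Qed.

Lemma lingrowth_lip C f : lipf C f -> lingrowth f.
Proof.
move=> fC; split; first exact: lipf_continuous fC.
exists (`|f 0| + `|C|) => x.
have := fC x 0; rewrite subr0 => fx.
have -> : f x = f 0 + (f x - f 0) by rewrite addrC subrK.
apply: le_trans (ler_normD _ _) _.
have h1 : `|f x - f 0| <= `|C| * enorm x.
  by apply: le_trans fx _; apply: ler_wpM2r => //; exact: ler_norm.
have := mulr_ge0 (normr_ge0 (f 0)) (enorm_ge0 x).
have := normr_ge0 C.
lra.
Qed.

Lemma lingrowth_cst (c : R) : lingrowth (fun=> c).
Proof. by apply: (@lingrowth_lip 0) => x y; rewrite subrr normr0 mul0r. Qed.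

Lemma lingrowthD f g : lingrowth f -> lingrowth g -> lingrowth (fun x => f x + g x).
Proof.
move=> [cf [C fC]] [cg [D gD]]; split.
  by move=> x; exact: cvgD (cf x) (cg x).
exists (C + D) => x; rewrite mulrDl (le_trans (ler_normD _ _))//.
exact: lerD.
Qed.

Lemma lingrowthZ (c : R) f : lingrowth f -> lingrowth (fun x => c * f x).
Proof.
move=> [cf [C fC]]; split.
  by move=> x; exact: cvgM (cvg_cst c) (cf x).
exists (`|c| * C) => x; rewrite normrM -mulrA.
exact: ler_wpM2l.
Qed.

Lemma lingrowthB f g : lingrowth f -> lingrowth g -> lingrowth (fun x => f x - g x).
Proof.
move=> lf lg; have := lingrowthD lf (lingrowthZ (-1) lg).
by under [X in lingrowth X -> _]eq_fun do rewrite mulN1r.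
Qed.

Lemma lingrowth_norm f : lingrowth f -> lingrowth (fun x => `|f x|).
Proof.
move=> [cf [C fC]]; split.
  by move=> x; exact: cvg_norm (cf x).
by exists C => x; rewrite normr_id.
Qed.

Lemma meanD m f g : lingrowth f -> lingrowth g ->
  mean m (fun x => f x + g x) = mean m f + mean m g.
Proof. by move=> lf lg; apply: RintegralD => //; exact: integrable_lingrowth. Qed.

Lemma meanB m f g : lingrowth f -> lingrowth g ->
  mean m (fun x => f x - g x) = mean m f - mean m g.
Proof. by move=> lf lg; apply: RintegralB => //; exact: integrable_lingrowth. Qed.

Lemma meanZ m (c : R) f : lingrowth f ->
  mean m (fun x => c * f x) = c * mean m f.
Proof. by move=> lf; apply: RintegralZl => //; exact: integrable_lingrowth. Qed.

Lemma mean_cst m (c : R) : mean m (fun=> c) = c.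
Proof.
rewrite /mean (Rintegral_cst m measurableT).
by have := probability_setT m => /= ->; rewrite mulr1.
Qed.

Lemma le_mean m f g : lingrowth f -> lingrowth g -> (forall x, f x <= g x) ->
  mean m f <= mean m g.
Proof. by move=> lf lg fg; apply: le_Rintegral => //; exact: integrable_lingrowth. Qed.

Lemma le_norm_mean m f : lingrowth f -> `|mean m f| <= mean m (fun x => `|f x|).
Proof. by move=> lf; apply: le_normr_Rintegral => //; exact: integrable_lingrowth. Qed.

Lemma eq_mean m f g : (forall x, f x = g x) -> mean m f = mean m g.
Proof. by move=> fg; congr (mean m _); exact/funext. Qed.

Lemma mean_dist m f g h : lingrowth f -> lingrowth g -> lingrowth h ->
  (forall x, `|f x - g x| <= h x) -> `|mean m f - mean m g| <= mean m h.
Proof.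
move=> lf lg lh fgh; rewrite -meanB//; apply: le_trans (le_norm_mean _ _) _.
  exact: lingrowthB.
by apply: le_mean => //; exact/lingrowth_norm/lingrowthB.
Qed.

Lemma mean_dist_cst m f g (c : R) : lingrowth f -> lingrowth g ->
  (forall x, `|f x - g x| <= c) -> `|mean m f - mean m g| <= c.
Proof.
move=> lf lg fgh; rewrite -[leRHS](mean_cst m); apply: mean_dist => //.
exact: lingrowth_cst.
Qed.

Lemma mean_measure_eq m n f : measure_eq m n -> mean m f = mean n f.
Proof.
move=> mn; rewrite /mean /Rintegral; congr fine.
by apply: eq_measure_integral => A mA _; exact: mn.
Qed.

Definition moment1 m : R := mean m (fun x => enorm x).

Lemma lingrowth_enorm : lingrowth (fun x : 'rV[R]_d => enorm x).
Proof. exact: lingrowth_lip lipf_enorm. Qed.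

Lemma moment1_ge0 m : 0 <= moment1 m.
Proof. by apply: Rintegral_ge0. Qed.

(** It controls functions of linear growth far from the origin, and is itself
    1-Lipschitz, so that its integral is controlled by the distance. *)
Definition excess (A : R) (x : 'rV[R]_d) : R := Num.max (enorm x - A) 0.

Lemma excess_ge0 A x : 0 <= excess A x.
Proof. by rewrite /excess le_max lexx orbT. Qed.

Lemma lipf_excess A : lipf 1 (excess A).
Proof.
move=> x y; rewrite mul1r; have := ler_dist_enorm x y.
rewrite /excess; case: (lerP (enorm x - A) 0); case: (lerP (enorm y - A) 0);
  rewrite ?ler_norml; lra.
Qed.

Lemma growth_le_excess A x : 2 <= A -> A <= enorm x -> 1 + enorm x <= 3 * excess (A / 2) x.
Proof.
move=> A2 Ax; have h : enorm x - A / 2 <= excess (A / 2) x by rewrite /excess le_max lexx.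
lra.
Qed.

(** Dominated convergence, with the norm itself as dominating function; this is
    how the finite first moment is used to neglect what happens far away. *)
Lemma mean_excess_small (m : P1 R d) (e : R) : 0 < e ->
  exists2 A0 : R, 1 <= A0 & forall A, A0 <= A -> mean m (excess A) <= e.
Proof.
move=> e0.
have mexc A : measurable_fun [set: borelRV R d]
    ((fun x => (excess A x)%:E) : borelRV R d -> \bar R).
  by apply/measurable_EFinP; apply: borel_continuous_measurable;
    exact: lipf_continuous (lipf_excess A).
pose F := fun (k : nat) (x : borelRV R d) => (excess k%:R x)%:E.
have F0 : {ae (m : {measure set _ -> \bar R}), forall x, setT x ->
    F ^~ x @ \oo --> (cst 0%E : borelRV R d -> \bar R) x}.
  apply: aeW => /= x _; apply: cvg_near_cst.
  exists (Num.bound (enorm (x : 'rV[R]_d))) => // k /= xk.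
  congr EFin; apply/max_idPr; rewrite subr_le0 ltW//.
  have := archi_boundP (enorm_ge0 (x : 'rV[R]_d)); move=> /lt_le_trans; apply.
  by rewrite ler_nat.
have Fle : {ae (m : {measure set _ -> \bar R}), forall x k, setT x ->
    (`|F k x| <= (enorm (x : 'rV[R]_d))%:E)%E}.
  apply: aeW => /= x k _; rewrite lee_fin ger0_norm ?excess_ge0//.
  by rewrite /excess ge_max enorm_ge0 andbT gerBl.
have [_ _ /=] := dominated_convergence measurableT (fun k : nat => mexc k%:R)
  (measurable_cst _) F0 (integrable_enorm m) Fle.
rewrite integral_cst// mul0e => h.
move/fine_cvg : h => /cvgr_dist_lt/(_ _ e0)[N _ Ne].
exists (N.+1%:R); first by rewrite ler1n.
move=> A NA; have := Ne N.+1 (leqW (leqnn N)).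
rewrite /= sub0r normrN => /(le_lt_trans (ler_norm _)) h.
apply: le_trans (ltW h); apply: le_mean; try exact: lingrowth_lip (lipf_excess _).
move=> x; rewrite /excess ge_max le_max lerD2l lerN2 NA/= le_max lexx orbT.
by [].
Qed.

End mean.

(** * The Monge-Kantorovich distance *)

Section wasserstein.
Context {R : realType} {d : nat}.
Implicit Types (m n p : P1 R d) (f g phi : 'rV[R]_d -> R).

(** The distance enters all estimates through upper bounds; this form of them
    stays within the real numbers. *)
Definition W1le m n (r : R) :=
  forall phi, lip1 phi -> mean m phi - mean n phi <= r.

Lemma lip1_lipf phi : lip1 phi <-> lipf 1 phi.
Proof. by split => h x y; [rewrite mul1r|rewrite -[leRHS]mul1r]. Qed.

Lemma W1leP m n (r : R) : (W1 m n <= r%:E)%E <-> W1le m n r.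
Proof.
split=> [h phi p1|h].
  by rewrite -lee_fin; apply: le_trans h; apply: ereal_sup_ubound; exists phi.
by apply: ge_ereal_sup => _ [phi /= p1 <-]; rewrite lee_fin; exact: h.
Qed.

Lemma W1_ge0 m n : (0 <= W1 m n)%E.
Proof.
have l0 : lip1 (fun _ : 'rV[R]_d => 0 : R) by move=> x y; rewrite subrr normr0.
by apply: ereal_sup_ubound; exists (fun=> 0) => //; rewrite -!/(mean _ _) !mean_cst subrr.
Qed.

Lemma W1le_lip m n (r C : R) f : 0 <= C -> lipf C f -> W1le m n r ->
  mean m f - mean n f <= C * r.
Proof.
move=> C0 fC mnr; have [C00|Cn0] := eqVneq C 0.
  have fE : f = fun=> f 0.
    apply/funext => x; apply/eqP; rewrite -subr_eq0 -normr_le0.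
    by rewrite (le_trans (fC _ _))// C00 mul0r.
  by rewrite fE !mean_cst subrr C00 mul0r.
have Cp : 0 < C by rewrite lt_def Cn0.
have lf := lingrowth_lip fC.
have := mnr (fun x => C^-1 * f x).
rewrite !meanZ// -mulrBr mulrC ler_pdivrMr// [r * C]mulrC; apply.
move=> x y; rewrite -mulrBr normrM ger0_norm ?invr_ge0// mulrC ler_pdivrMr//.
by rewrite mulrC.
Qed.

Lemma W1le_lip_norm m n (r C : R) f : 0 <= C -> lipf C f -> W1le m n r ->
  `|mean m f - mean n f| <= C * r.
Proof.
move=> C0 fC mnr; rewrite ler_norml (W1le_lip C0 fC mnr) andbT.
have fNC : lipf C (fun x => - f x).
  by move=> x y; rewrite -opprD normrN.
have meanN k : mean k (fun x => - f x) = - mean k f.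
  rewrite -mulN1r -(meanZ _ _ (lingrowth_lip fC)).
  by apply: eq_mean => x; rewrite mulN1r.
have := W1le_lip C0 fNC mnr; rewrite !meanN; lra.
Qed.

Lemma W1le_sym m n r : W1le m n r -> W1le n m r.
Proof.
move=> mnr phi /lip1_lipf p1.
have := W1le_lip_norm ler01 p1 mnr; rewrite mul1r distrC.
exact/le_trans/ler_norm.
Qed.

Lemma W1le_trans m n p r s : W1le m n r -> W1le n p s -> W1le m p (r + s).
Proof. by move=> mn np phi p1; have := mn _ p1; have := np _ p1; lra. Qed.

Lemma W1le_le m n r s : r <= s -> W1le m n r -> W1le m n s.
Proof. by move=> rs mn phi p1; exact: le_trans (mn _ p1) rs. Qed.

Lemma W1le_measure_eq m n : measure_eq m n -> W1le m n 0.
Proof. by move=> mn phi p1; rewrite (mean_measure_eq _ mn) subrr. Qed.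

(** Epsilon-delta form of the continuity of a curve, for use with [W1le]. *)
Definition W1cont (A : set R) (mu : R -> P1 R d) := forall t : R, A t ->
  forall e : R, 0 < e -> exists2 h : R, 0 < h &
    forall s, A s -> `|s - t| < h -> W1le (mu s) (mu t) e.

Lemma W1contP (A : set R) (mu : R -> P1 R d) :
  W1_continuous_on A mu <-> W1cont A mu.
Proof.
split=> [h t At e e0|h t At].
  have := h t At => /fine_cvgP[]; rewrite !near_withinE => h1 /cvgrPdist_lt/(_ _ e0).
  rewrite near_withinE => h2.
  have [r /= r0 hr] := filterI h1 h2.
  exists r => // s As str; apply/W1leP.
  have [|/(_ As) fW /(_ As)] := hr s; first by rewrite /ball_/= distrC.
  rewrite /= sub0r normrN => /(le_lt_trans (ler_norm _)) We.
  by rewrite -(fineK fW) lee_fin ltW.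
apply/fine_cvgP; split.
  have [r r0 hr] := h t At 1 ltr01.
  rewrite near_withinE; exists r => // s /= str As.
  rewrite ge0_fin_numE ?W1_ge0//; apply: (@le_lt_trans _ _ 1%:E).
    by apply/W1leP; apply: hr => //; rewrite distrC.
  exact: ltry.
apply/cvgrPdist_lt => e e0; rewrite near_withinE.
have e2 : 0 < e / 2 by rewrite divr_gt0.
have [r r0 hr] := h t At _ e2.
exists r => // s /= str As.
have /W1leP Wle : W1le (mu s) (mu t) (e / 2) by apply: hr => //; rewrite distrC.
have fW : (W1 (mu s) (mu t) \is a fin_num)%E.
  by rewrite ge0_fin_numE ?W1_ge0// (le_lt_trans Wle)// ltry.
rewrite sub0r normrN ger0_norm ?fine_ge0 ?W1_ge0//.
rewrite -lte_fin fineK// (le_lt_trans Wle)// lte_fin; lra.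
Qed.

Lemma W1cont_sub (A B : set R) (mu : R -> P1 R d) : A `<=` B -> W1cont B mu -> W1cont A mu.
Proof.
move=> AB cmu t At e e0; have [h h0 H] := cmu t (AB _ At) e e0.
by exists h => // s As; apply: H; exact: AB.
Qed.

(** Locally Lipschitz functions, with constant growing linearly. The products
    of a Lipschitz vector field by a bounded Lipschitz one are of this kind. *)
Definition loclip (C1 C2 : R) g :=
  (forall x, `|g x| <= C1 * (1 + enorm x)) /\
  (forall x y, `|g x - g y| <= C2 * (1 + enorm x) * enorm (x - y)).

Lemma loclip_lingrowth C1 C2 g : loclip C1 C2 g -> lingrowth g.
Proof.
move=> [g1 g2]; split; last by exists C1.
move=> x; apply/(@cvgrPdist_lt _ _ _ (nbhs x) _ g (g x)) => e e0.
set c := C2 * (1 + enorm x).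
have c0 : 0 < `|c| + 1 by rewrite ltr_wpDl.
apply/nbhs_enormP; exists (e / (`|c| + 1)); first by rewrite divr_gt0.
move=> y; rewrite ltr_pdivlMr// mulrC => xy.
apply: le_lt_trans xy; apply: le_trans (g2 _ _) _; apply: ler_wpM2r => //.
by rewrite (le_trans (ler_norm c))// lerDl.
Qed.

Definition cutoff (A : R) (x : 'rV[R]_d) : R := 1 - Num.min 1 (excess A x).

Lemma cutoff_itv A x : 0 <= cutoff A x <= 1.
Proof.
rewrite /cutoff subr_ge0 ge_min lexx/= lerBlDr lerDl le_min ler01.
exact: excess_ge0.
Qed.

Lemma cutoff_lip A x y : `|cutoff A x - cutoff A y| <= enorm (x - y).
Proof.
have := lipf_excess A x y; rewrite mul1r /cutoff.
case: (lerP 1 (excess A x)); case: (lerP 1 (excess A y)); rewrite !ler_norml; lra.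
Qed.

(** Truncating at a large radius makes a locally Lipschitz function Lipschitz,
    and the error is controlled by the excess of the norm, itself Lipschitz:
    integrals depend continuously on the measure, uniformly in the function. *)
Lemma mean_equicontinuous m (C1 C2 e : R) : 0 <= C1 -> 0 <= C2 -> 0 < e ->
  exists2 h : R, 0 < h & forall g, loclip C1 C2 g -> forall n, W1le n m h ->
    `|mean n g - mean m g| <= e.
Proof.
move=> C10 C20 e0.
have c30 : 0 < 3 * C1 + 1 by lra.
pose e' := e / (6 * (3 * C1 + 1)).
have e'0 : 0 < e' by rewrite divr_gt0// mulr_gt0.
have [A0 A01 hA] := mean_excess_small m e'0.
pose A := 2 * A0.
have mA : mean m (excess (A / 2)) <= e' by apply: hA; rewrite /A; lra.
pose N := (C1 + C2) * (2 + A) + 1.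
have N0 : 0 < N by rewrite /N ltr_wpDl// mulr_ge0 ?addr_ge0// /A; lra.
pose h := Num.min e' (e / (2 * N)).
have h0 : 0 < h by rewrite lt_min e'0/= divr_gt0// mulr_gt0.
exists h => // g [g1 g2] n nm.
have lg : lingrowth g by exact: loclip_lingrowth (conj g1 g2).
pose gA x := g x * cutoff A x.
have gA_half x y : enorm x <= A + 1 -> `|gA x - gA y| <= (C1 + C2) * (2 + A) * enorm (x - y).
  move=> xA.
  have -> : gA x - gA y = (g x - g y) * cutoff A y + g x * (cutoff A x - cutoff A y).
    by rewrite /gA; ring.
  apply: le_trans (ler_normD _ _) _; rewrite !normrM.
  have /andP[c0 c1] := cutoff_itv A y.
  have xy0 := enorm_ge0 (x - y).
  have s1 : C1 * (1 + enorm x) <= C1 * (2 + A) by apply: ler_wpM2l => //; lra.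
  have s2 : C2 * (1 + enorm x) <= C2 * (2 + A) by apply: ler_wpM2l => //; lra.
  rewrite mulrDl mulrDl addrC; apply: lerD.
    apply: ler_pM => //; first exact: le_trans (g1 x) s1.
    exact: cutoff_lip.
  rewrite -[leRHS]mulr1 [`|cutoff A y|]ger0_norm//; apply: ler_pM => //.
  by apply: le_trans (g2 x y) _; exact: ler_wpM2r.
have gA_far x : A + 1 <= enorm x -> gA x = 0.
  move=> xA; rewrite /gA /cutoff.
  have -> : Num.min 1 (excess A x) = 1.
    by apply/min_idPl; rewrite /excess le_max; apply/orP; left; lra.
  by rewrite subrr mulr0.
have gA_lip : lipf N gA.
  have NN z : 0 <= z -> (C1 + C2) * (2 + A) * z <= N * z.
    by move=> z0; apply: ler_wpM2r => //; rewrite /N lerDl.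
  move=> x y; have [xA|xA] := leP (enorm x) (A + 1).
    exact: le_trans (gA_half x y xA) (NN _ (enorm_ge0 _)).
  have [yA|yA] := leP (enorm y) (A + 1).
    rewrite distrC enorm_distC.
    exact: le_trans (gA_half y x yA) (NN _ (enorm_ge0 _)).
  rewrite (gA_far x (ltW xA)) (gA_far y (ltW yA)) subrr normr0.
  by apply: mulr_ge0; [exact: ltW|].
have lgA := lingrowth_lip gA_lip.
have gAg x : `|g x - gA x| <= 3 * C1 * excess (A / 2) x.
  have -> : g x - gA x = g x * Num.min 1 (excess A x) by rewrite /gA /cutoff; ring.
  have m0 : 0 <= Num.min 1 (excess A x) by rewrite le_min ler01 excess_ge0.
  rewrite normrM (ger0_norm m0).
  have [xA|xA] := leP (enorm x) A.
    have -> : Num.min 1 (excess A x) = 0.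
      have -> : excess A x = 0 by apply/max_idPr; lra.
      by apply/min_idPr.
    by rewrite mulr0; apply: mulr_ge0; [lra|exact: excess_ge0].
  apply: (@le_trans _ _ (`|g x|)).
    by rewrite -[leRHS]mulr1; apply: ler_wpM2l => //; rewrite ge_min lexx.
  apply: le_trans (g1 x) _; rewrite [3 * C1]mulrC -mulrA; apply: ler_wpM2l => //.
  apply: growth_le_excess; last exact: ltW.
  by rewrite /A; lra.
have lexc : lingrowth (@excess R d (A / 2)).
  exact: lingrowth_lip (lipf_excess _).
have l3exc : lingrowth (fun x : 'rV[R]_d => 3 * C1 * excess (A / 2) x) by exact: lingrowthZ.
have d1 k : `|mean k g - mean k gA| <= 3 * C1 * mean k (excess (A / 2)).
  by rewrite -meanZ//; exact: mean_dist.
have nA : mean n (excess (A / 2)) <= 2 * e'.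
  have := W1le_lip ler01 (lipf_excess (A / 2)) nm.
  have : h <= e' by rewrite ge_min lexx.
  lra.
have d2 := W1le_lip_norm (ltW N0) gA_lip nm.
have d3 : N * h <= e / 2.
  apply: (@le_trans _ _ (N * (e / (2 * N)))).
    by apply: ler_wpM2l; rewrite ?(ltW N0)// ge_min lexx orbT.
  by rewrite le_eqVlt; apply/orP; left; apply/eqP; field; lra.
have d4 : (3 * C1 + 1) * (3 * e') = e / 2.
  by rewrite /e'; field; lra.
have d5 : 3 * C1 * (mean n (excess (A / 2)) + mean m (excess (A / 2))) <= (3 * C1 + 1) * (3 * e').
  apply: ler_pM; rewrite ?mulr_ge0 ?addr_ge0//; try lra.
  - by apply: Rintegral_ge0 => x _; exact: excess_ge0.
  - by apply: Rintegral_ge0 => x _; exact: excess_ge0.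
have := d1 n; have := d1 m; rewrite distrC.
have -> : mean n g - mean m g = (mean n g - mean n gA) + (mean n gA - mean m gA) + (mean m gA - mean m g).
  by ring.
move=> e1 e2; apply: le_trans (ler_normD _ _) _.
apply: le_trans (lerD (ler_normD _ _) (lexx _)) _.
lra.
Qed.

End wasserstein.

(** * Borel measures: identification, push-forward and support *)

Section measures.
Context {R : realType} {d : nat}.
Implicit Types (m n : P1 R d) (f g : 'rV[R]_d -> R).

Lemma open_borel (U : set 'rV[R]_d) : open U -> measurable (U : set (borelRV R d)).
Proof. exact: sub_sigma_algebra. Qed.

(** Distance to a set; the infimum of the empty set is 0 by convention, whence
    the nonemptiness hypotheses below. *)
Definition edist (C : set 'rV[R]_d) (x : 'rV[R]_d) : R :=
  inf [set enorm (x - y) | y in C].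

Lemma edist_has_lbound (C : set 'rV[R]_d) x : has_lbound [set enorm (x - y) | y in C].
Proof. by exists 0 => _ [y _ <-]. Qed.

Lemma edist_ge0 (C : set 'rV[R]_d) x : C !=set0 -> 0 <= edist C x.
Proof.
move=> [c Cc]; apply: lb_le_inf; first by exists (enorm (x - c)); exists c.
by move=> _ [y _ <-].
Qed.

Lemma edist_lip (C : set 'rV[R]_d) : C !=set0 -> lipf 1 (edist C).
Proof.
move=> C0; have h x y : edist C x - enorm (x - y) <= edist C y.
  apply: lb_le_inf; first by case: C0 => c Cc; exists (enorm (y - c)); exists c.
  move=> _ [z Cz <-]; rewrite lerBlDl.
  apply: le_trans (ler_enorm_dist x y z).
  by apply: ge_inf; [exact: edist_has_lbound|exists z].
move=> x y; rewrite mul1r ler_norml; have := h x y; have := h y x.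
rewrite (enorm_distC y); lra.
Qed.

Lemma edist_eq0 (C : set 'rV[R]_d) x : C x -> edist C x = 0.
Proof.
move=> Cx; apply/eqP; rewrite eq_le edist_ge0; last by exists x.
rewrite andbT; apply: ge_inf; first exact: edist_has_lbound.
by exists x => //; rewrite subrr enorm0.
Qed.

Lemma edist_gt0 (U : set 'rV[R]_d) x : open U -> U x -> ~` U !=set0 ->
  0 < edist (~` U) x.
Proof.
move=> oU Ux U0; have /nbhs_enormP[e e0 eU] : nbhs x U by exact: open_nbhs_nbhs.
apply: lt_le_trans e0 _; apply: lb_le_inf.
  by case: U0 => c Cc; exists (enorm (x - c)); exists c.
move=> _ [y Uy <-]; rewrite leNgt; apply/negP => xy; exact/Uy/eU.
Qed.

Lemma lipf_min_edist (C : set 'rV[R]_d) (c : R) : C !=set0 -> 0 <= c ->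
  lipf c (fun x => Num.min 1 (c * edist C x)).
Proof.
move=> C0 c0 x y; have := edist_lip C0 x y; rewrite mul1r => h.
have : `|c * edist C x - c * edist C y| <= c * enorm (x - y).
  by rewrite -mulrBr normrM (ger0_norm c0); apply: ler_wpM2l.
case: (lerP 1 (c * edist C x)); case: (lerP 1 (c * edist C y));
  rewrite !ler_norml; lra.
Qed.

(** The functions [min 1 (k * edist (~` U))] increase to the indicator of [U]. *)
Lemma mean_urysohn_cvg m (U : set 'rV[R]_d) : open U -> ~` U !=set0 ->
  (mean m (fun x => Num.min 1 (k%:R * edist (~` U) x)))%:E @[k --> \oo] --> m U.
Proof.
move=> oU U0.
pose f (k : nat) x := Num.min 1 (k%:R * edist (~` U) x).
have mU := open_borel oU.
have lf (k : nat) : lipf k%:R (f k).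
  exact: lipf_min_edist.
pose F := fun (k : nat) (x : borelRV R d) => (f k x)%:E.
pose G := fun (x : borelRV R d) => (\1_U x)%:E : \bar R.
have mF k : measurable_fun [set: borelRV R d] (F k).
  by apply/measurable_EFinP; apply: borel_continuous_measurable;
    exact: lipf_continuous (lf k).
have mG : measurable_fun [set: borelRV R d] G.
  by apply/measurable_EFinP; exact: measurable_indic.
have FG : {ae (m : {measure set _ -> \bar R}), forall x, setT x -> F ^~ x @ \oo --> G x}.
  apply: aeW => /= x _; rewrite /G indicE; have [|] := boolP (x \in U).
    rewrite inE => Ux; have e0 := edist_gt0 oU Ux U0.
    apply: cvg_near_cst; exists (Num.bound (edist (~` U) x)^-1) => // k /= xk.
    congr EFin; apply/min_idPl.
    rewrite -ler_pdivrMr// div1r; apply: ltW.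
    have := archi_boundP (ltW (_ : 0 < (edist (~` U) x)^-1)).
    by rewrite invr_gt0 => /(_ e0) /lt_le_trans; apply; rewrite ler_nat.
  rewrite notin_setE => Ux; apply: cvg_near_cst; apply: nearW => k.
  by rewrite /F /f edist_eq0// mulr0; congr EFin; apply/min_idPr.
have Fle : {ae (m : {measure set _ -> \bar R}), forall x k, setT x ->
    (`|F k x| <= (cst 1%E : borelRV R d -> \bar R) x)%E}.
  apply: aeW => /= x k _; rewrite lee_fin ger0_norm; first by rewrite ge_min lexx.
  by rewrite le_min ler01 mulr_ge0// edist_ge0.
have i1 : (m : {measure set _ -> \bar R}).-integrable setT (cst 1%E : borelRV R d -> \bar R).
  exact: finite_measure_integrable_cst.
have [_ _ /=] := dominated_convergence measurableT mF mG FG i1 Fle.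
rewrite (_ : (\int[m]_x G x)%E = m U); last by rewrite integral_indic// setIT.
move=> h; apply: cvg_trans h.
rewrite (_ : (fun k => (mean m _)%:E) = (fun k => \int[m]_x F k x)%E)//.
apply/funext => k; rewrite /mean /Rintegral fineK//.
by apply: integrable_fin_num => //; exact: integrable_lingrowth (lingrowth_lip (lf k)).
Qed.

(** Lipschitz functions approximate indicators of open sets, so that the
    distance separates measures, up to their values off the Borel sets. *)
Lemma W1le0_measure_eq m n : W1le m n 0 -> measure_eq m n.
Proof.
move=> mn.
have meanE (C : R) f : 0 <= C -> lipf C f -> mean m f = mean n f.
  move=> C0 fC; have := W1le_lip_norm C0 fC mn.
  by rewrite mulr0 normr_le0 subr_eq0 => /eqP.
have openE (U : set 'rV[R]_d) : open U -> m U = n U.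
  move=> oU; have [UE|/set0P U0] := eqVneq (~` U) set0; last first.
    have h k : mean m (fun x => Num.min 1 (k%:R * edist (~` U) x)) =
        mean n (fun x => Num.min 1 (k%:R * edist (~` U) x)).
      by apply: (@meanE k%:R) => //; exact: lipf_min_edist.
    have h1 := mean_urysohn_cvg (m := m) oU U0.
    have h2 := mean_urysohn_cvg (m := n) oU U0.
    move: h1; under eq_fun do rewrite h.
    by move=> h1; apply: cvg_unique h1 h2.
  rewrite -(setCK U) UE setC0.
  by have := probability_setT m; have := probability_setT n => /= -> ->.
move=> S; apply: (@g_sigma_algebra_measure_unique _ R (borelRV R d)
  (@open 'rV[R]_d) _ (fun=> setT)).
- by move=> U; exact: open_borel.
- by move=> _; exact: openT.
- by rewrite bigcup_const//; exists 0%N.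
- by move=> A B oA oB; exact: openI.
- by move=> A oA; exact: openE.
- by move=> k; rewrite (le_lt_trans (probability_le1 _ _))// ltry.
Qed.


(** ** Push-forward by a Lipschitz map *)

Section push.
Variables (m : P1 R d) (f : 'rV[R]_d -> 'rV[R]_d) (cf : continuous f).

Definition borel_mfun : {mfun borelRV R d >-> borelRV R d} :=
  mfun_Sub (mem_set (borelv_continuous_measurable cf)).

Definition push_prob : probability (borelRV R d) R := distribution m borel_mfun.

Lemma Rintegral_push_prob g : continuous g -> lingrowth (g \o f) ->
  \int[push_prob]_x g x = mean m (g \o f).
Proof.
move=> cg lgf; rewrite /mean /Rintegral; congr fine.
rewrite integral_distribution//.
  by apply/measurable_EFinP; exact: borel_continuous_measurable.
exact: integrable_lingrowth.
Qed.

Lemma push_prob_moment : lingrowth (fun x => enorm (f x)) ->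
  (\int[push_prob]_x (enorm (x : 'rV[R]_d))%:E < +oo)%E.
Proof.
move=> lf.
have me : measurable_fun [set: borelRV R d]
    ((fun x : 'rV[R]_d => (enorm x)%:E) : borelRV R d -> \bar R).
  by apply/measurable_EFinP; apply: borel_continuous_measurable; exact: enorm_continuous.
have e0 (x : borelRV R d) : (0 <= (enorm (x : 'rV[R]_d))%:E)%E by rewrite lee_fin.
rewrite (ge0_integral_distribution borel_mfun me e0).
have /integrableP[_] := integrable_lingrowth m lf.
apply: le_lt_trans; rewrite le_eqVlt; apply/orP; left; apply/eqP.
by apply: eq_integral => x _ /=; rewrite ger0_norm.
Qed.

End push.

Lemma lingrowth_enorm_lipv (C : R) (f : 'rV[R]_d -> 'rV[R]_d) :
  lipv C f -> lingrowth (fun x => enorm (f x)).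
Proof.
move=> fC; apply: (@lingrowth_lip _ _ (1 * C)).
exact: lipf_comp ler01 lipf_enorm fC.
Qed.

Definition push_lipv (m : P1 R d) (C : R) (f : 'rV[R]_d -> 'rV[R]_d) (fC : lipv C f) : P1 R d :=
  MkP1 (@push_prob_moment m f (lipv_continuous fC) (lingrowth_enorm_lipv fC)).

(** Total in the map, so that curves of push-forwards are written without
    carrying proofs: a map that is not Lipschitz leaves the measure unchanged. *)
Definition push (f : 'rV[R]_d -> 'rV[R]_d) (m : P1 R d) : P1 R d :=
  if pselect (exists C, lipv C f) is left h then push_lipv m (projT2 (cid h)) else m.

Lemma pushE (C : R) (f : 'rV[R]_d -> 'rV[R]_d) m (A : set (borelRV R d)) : lipv C f -> push f m A = m (f @^-1` A).
Proof.
by move=> fC; rewrite /push; case: pselect => [h|[]]; [|exists C].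
Qed.

Lemma mean_push (C : R) (f : 'rV[R]_d -> 'rV[R]_d) m g : lipv C f -> continuous g -> lingrowth (g \o f) ->
  mean (push f m) g = mean m (g \o f).
Proof.
move=> fC cg lgf; rewrite /push; case: pselect => [h|[]]; last by exists C.
exact: Rintegral_push_prob.
Qed.

(** ** Supports *)

Lemma msupport_closed m : closed (msupport m).
Proof.
rewrite -[X in closed X]setCK; apply: open_closedC; rewrite openE => x /=.
move=> /existsNP[U /not_implyP[oU /not_implyP[Ux mU]]].
rewrite /interior; have : nbhs x U by exact: open_nbhs_nbhs.
apply: filterS => y Uy sy; exact/mU/sy.
Qed.

Lemma eball_compl_open (r : R) : open (~` (eball r : set 'rV[R]_d)).
Proof.
apply: closed_openC; rewrite /eball.
apply: (@closed_comp _ _ (@enorm R d) [set x | x <= r]); last exact: closed_le.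
by move=> x _; exact: enorm_continuous.
Qed.

(** The complement of a ball is a countable union of compact annuli, each of
    which is covered by finitely many open null sets. *)
Lemma msupport_null m (r : R) : msupport m `<=` eball r -> m (~` eball r) = 0%E.
Proof.
move=> sr.
pose K (k : nat) : set 'rV[R]_d := [set x | r + k.+1%:R^-1 <= enorm x /\ enorm x <= k%:R].
have cK k : compact (K k).
  apply: bounded_closed_compact.
    exists k%:R; split => // M kM x [_ xk].
    exact: le_trans (mx_norm_le_enorm _) (le_trans xk (ltW kM)).
  apply: closedI.
    apply: (@closed_comp _ _ (@enorm R d) [set x | r + k.+1%:R^-1 <= x]); last exact: closed_ge.
    by move=> x _; exact: enorm_continuous.
  apply: (@closed_comp _ _ (@enorm R d) [set x | x <= k%:R]); last exact: closed_le.
  by move=> x _; exact: enorm_continuous.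
have nK k : (m : {measure set _ -> \bar R}).-negligible (K k : set (borelRV R d)).
  have := cK k; rewrite compact_cover.
  move=> /(_ (set 'rV[R]_d) [set U | open U /\ m U = 0%E] id).
  have h1 : forall U : set 'rV[R]_d, [set U | open U /\ m U = 0%E] U -> open (id U) by move=> U [].
  have h2 : K k `<=` cover [set U | open U /\ m U = 0%E] id.
    move=> x [xr _].
    have : ~ msupport m x.
      by move=> /sr; rewrite /eball /= leNgt (lt_le_trans _ xr)// ltrDl.
    move=> /existsNP[U /not_implyP[oU /not_implyP[Ux mU]]].
    exists U => //; split=> //; apply/eqP; rewrite -measure_le0 leNgt.
    exact/negP.
  move=> /(_ h1 h2)[D' D'D].
  rewrite /cover bigcup_fset => KD.
  apply: (@negligibleS _ (borelRV R d) R m _ _ KD).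
  rewrite big_seq; elim/big_ind : _ => //.
  - exact: negligible_set0.
  - by move=> A B; exact: (@negligibleU _ (borelRV R d) R m).
  - move=> U /D'D; rewrite inE => -[oU mU]; apply/negligibleP => //.
    exact: open_borel.
apply/negligibleP; first exact: open_borel (@eball_compl_open r).
apply: (@negligibleS _ (borelRV R d) R m _ _ _ (negligible_bigcup nK)).
move=> x /= /negP; rewrite -ltNge => rx.
have xr0 : 0 < enorm x - r by rewrite subr_gt0.
pose k := maxn (Num.bound (enorm x)) (Num.bound (enorm x - r)^-1).
exists k => //; split.
  rewrite addrC -lerBrDr invf_ple ?posrE//.
  have := archi_boundP (ltW (_ : 0 < (enorm x - r)^-1)).
  rewrite invr_gt0 => /(_ xr0)/ltW/le_trans; apply; rewrite ler_nat.
  by rewrite (leq_trans (leq_maxr _ _) (leqnSn _)).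
have := archi_boundP (enorm_ge0 x); move=> /ltW/le_trans; apply.
by rewrite ler_nat leq_maxl.
Qed.

(** A point outside the ball has a null neighbourhood, namely the complement of
    the ball; so the support lies in the ball, and it is always closed. *)
Lemma msupport_compact m (r : R) : m (~` eball r) = 0%E -> compact (msupport m).
Proof.
move=> mr; apply: bounded_closed_compact (@msupport_closed m).
exists r; split; [exact: num_real|move=> M rM x xs].
apply: le_trans (mx_norm_le_enorm _) _; apply: le_trans (ltW rM).
rewrite leNgt; apply/negP => rx.
suff Ux : (~` eball r) x by have := xs _ (@eball_compl_open r) Ux; rewrite mr ltxx.
by rewrite /eball/=; apply/negP; rewrite -ltNge.
Qed.

End measures.

(** * Integration in time *)

Section time.
Context {R : realType}.
Implicit Types (g F : R -> R).
Local Notation leb := (@lebesgue_measure R).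

(** Real induction: a closed property that always extends a little further
    to the right holds for all nonnegative times. *)
Lemma forward_induction (P : R -> Prop) : P 0 ->
  (forall t, 0 <= t -> (forall s, 0 <= s <= t -> P s) ->
     exists2 e : R, 0 < e & forall h, 0 < h <= e -> P (t + h)) ->
  (forall t, 0 < t -> (forall s, 0 <= s < t -> P s) -> P t) ->
  forall t, 0 <= t -> P t.
Proof.
move=> P0 Pstep Pclosed T T0.
pose S := [set t | 0 <= t <= T /\ forall s, 0 <= s <= t -> P s].
have S0 : S 0.
  split; first by rewrite lexx.
  by move=> s; rewrite -eq_le => /eqP <-.
have Sub : has_ubound S by exists T => t [/andP[]].
set u := sup S.
have u0 : 0 <= u by exact: ub_le_sup.
have uT : u <= T by apply: ge_sup; [exists 0|move=> t [/andP[]]].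
have Plt s : 0 <= s < u -> P s.
  move=> /andP[s0 su]; have [t St st] := sup_gt (ex_intro _ _ S0) su.
  by case: St => _; apply; rewrite s0 ltW.
have Pu : P u.
  by move: u0; rewrite le_eqVlt => /orP[/eqP <- //|u0]; exact: Pclosed.
have Ple s : 0 <= s <= u -> P s.
  by move=> /andP[s0]; rewrite le_eqVlt => /orP[/eqP -> //|su]; apply: Plt; rewrite s0.
move: uT; rewrite le_eqVlt => /orP[/eqP <- //|uT].
have [e e0 he] := Pstep u u0 Ple.
pose h := Num.min e (T - u).
have h0 : 0 < h by rewrite lt_min e0 subr_gt0.
suff : S (u + h).
  by move=> /(ub_le_sup Sub); rewrite -/u gerDl leNgt h0.
split.
  by rewrite addr_ge0 ?(ltW h0)//= -lerBrDl ge_min lexx orbT.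
move=> s /andP[s0 suh]; have [su|us] := leP s u; first by apply: Ple; rewrite s0.
rewrite -(subrK u s) addrC; apply: he; rewrite subr_gt0 us/=.
by rewrite lerBlDl; apply: le_trans suh _; rewrite lerD2l ge_min lexx.
Qed.

(** Epsilon-delta form of continuity within a set, which is what the explicit
    estimates on time-dependent quantities provide. *)
Definition econt (A : set R) g := forall t, A t -> forall e : R, 0 < e ->
  exists2 h : R, 0 < h & forall s, A s -> `|s - t| < h -> `|g s - g t| <= e.

Lemma econt_within (A : set R) g : econt A g -> {within A, continuous g}.
Proof.
move=> cg; apply/subspace_continuousP => t At.
apply/cvgrPdist_le => e e0; rewrite near_withinE.
have [h h0 H] := cg t At e e0; exists h => // s /= st As.
by rewrite distrC; apply: H => //; rewrite distrC.
Qed.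

Lemma within_econt (A : set R) g : {within A, continuous g} -> econt A g.
Proof.
move=> /subspace_continuousP cg t At e e0.
have := cg t At => /cvgrPdist_le/(_ e e0); rewrite near_withinE => -[h /= h0 H].
by exists h => // s As st; rewrite distrC; apply: H => //=; rewrite distrC.
Qed.

Lemma econt_sub (A B : set R) g : A `<=` B -> econt B g -> econt A g.
Proof.
move=> AB cg t At e e0; have [h h0 H] := cg t (AB _ At) e e0.
by exists h => // s As; apply: H; exact: AB.
Qed.

Notation cont0 := (econt [set t : R | 0 <= t]).

Lemma cont0_segment g (a b : R) : 0 <= a -> cont0 g -> {within `[a, b], continuous g}.
Proof.
move=> a0 cg; apply: econt_within; apply: econt_sub cg => t /=.
by rewrite in_itv/= => /andP[at_ _]; exact: le_trans at_.
Qed.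

Lemma cont0_integrable g (a b : R) : 0 <= a -> cont0 g ->
  leb.-integrable `[a, b] (EFin \o g).
Proof.
move=> a0 cg; apply: continuous_compact_integrable; first exact: segment_compact.
exact: cont0_segment.
Qed.

Definition tint g (t : R) : R := \int[leb]_(s in `[0, t]) g s.

Lemma tint0 g : tint g 0 = 0.
Proof. by rewrite /tint set_itv1 Rintegral_set1. Qed.

Lemma tintB g F t : cont0 g -> cont0 F -> tint (fun s => g s - F s) t = tint g t - tint F t.
Proof. by move=> cg cF; apply: RintegralB => //; exact: cont0_integrable. Qed.

Lemma tintZ (c : R) g t : cont0 g -> tint (fun s => c * g s) t = c * tint g t.
Proof. by move=> cg; apply: RintegralZl => //; exact: cont0_integrable. Qed.

Lemma le_tint g F t : cont0 g -> cont0 F -> (forall s, 0 <= s <= t -> g s <= F s) ->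
  tint g t <= tint F t.
Proof.
move=> cg cF gF; apply: le_Rintegral (cont0_integrable t (lexx 0) cg)
  (cont0_integrable t (lexx 0) cF) _ => //.
Qed.

Lemma econt_norm (A : set R) g : econt A g -> econt A (fun s => `|g s|).
Proof.
move=> cg t At e e0; have [h h0 H] := cg t At e e0.
exists h => // s As st; apply: le_trans (H s As st); exact: ler_dist_dist.
Qed.

Lemma le_norm_tint g F t : cont0 g -> cont0 F -> (forall s, 0 <= s <= t -> `|g s| <= F s) ->
  `|tint g t| <= tint F t.
Proof.
move=> cg cF gF; apply: le_trans (le_normr_Rintegral _ (cont0_integrable _ _ cg)) _ => //.
exact: (le_tint (econt_norm cg) cF gF).
Qed.

(** The source of all derivatives and bounds of integrals in time: near a time
    where the integrand is close to [c], the primitive has slope close to [c]. *)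
Lemma tint_increment g (a b c k : R) : cont0 g -> 0 <= a <= b ->
  (forall s, a <= s <= b -> `|g s - c| <= k) ->
  `|tint g b - tint g a - c * (b - a)| <= k * (b - a).
Proof.
move=> cg /andP[a0 ab] gc.
have ig : leb.-integrable `]a, b] (EFin \o g).
  apply: integrableS (cont0_integrable b a0 cg) => //.
  exact: subset_itv_oc_cc.
have cst_int (r : R) : \int[leb]_(s in `]a, b]) r = r * (b - a).
  rewrite Rintegral_cst//= lebesgue_measure_itv/= lte_fin.
  by move: ab; rewrite le_eqVlt => /orP[/eqP ->|->//]; rewrite ltxx subrr.
have icst (r : R) : leb.-integrable `]a, b] (EFin \o (fun=> r)).
  apply: measurable_bounded_integrable => //.
    by rewrite /= lebesgue_measure_itv/=; case: ifP => _; rewrite -?EFinB ltry.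
  by exists `|r|; split => // M rM s _; exact: ltW.
have mI : measurable (`]a, b]%classic : set (measurableTypeR R)) by exact: measurable_itv.
have iB : leb.-integrable `]a, b] (EFin \o (fun s => g s - c)).
  have := integrableB mI ig (icst c).
  by congr (integrable _ _ _); apply/funext => s /=; rewrite EFinB.
rewrite /tint (Rintegral_itvB (cont0_integrable b (lexx 0) cg)) ?bnd_simp//.
rewrite -(cst_int c) -(cst_int k) -RintegralB//.
apply: le_trans (le_normr_Rintegral _ _) _ => //.
apply: le_Rintegral => //; first exact: (integrable_abse iB).
move=> s /=; rewrite in_itv/= => /andP[as_ sb]; apply: gc.
by rewrite (ltW as_).
Qed.

Lemma cont0_tint g : cont0 g -> cont0 (tint g).
Proof.
move=> cg t t0 e e0.
have [h h0 H] := cg t t0 1 ltr01.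
have c0 : 0 < `|g t| + 1 by rewrite ltr_wpDl.
exists (Num.min h (e / (`|g t| + 1))); first by rewrite lt_min h0 divr_gt0.
move=> s s0; rewrite lt_min => /andP[sh se].
have gb r : 0 <= r -> `|r - t| < h -> `|g r - 0| <= `|g t| + 1.
  move=> r0 rt; rewrite subr0 -(subrK (g t) (g r)) addrC.
  by apply: le_trans (ler_normD _ _) _; rewrite lerD2l; exact: H.
have se' : (`|g t| + 1) * `|s - t| <= e by rewrite mulrC -ler_pdivlMr// ltW.
have [st|ts] := leP s t.
  have := @tint_increment g s t 0 (`|g t| + 1) cg.
  rewrite s0 st => /(_ isT); rewrite mul0r subr0 distrC => /(_ _)/le_trans; apply.
    move=> r /andP[sr rt]; apply: gb; first exact: le_trans sr.
    by apply: le_lt_trans sh; rewrite !ler0_norm ?subr_le0// lerN2 lerD2r.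
  by apply: le_trans se'; rewrite distrC ler_wpM2l ?ler_norm// ltW.
have := @tint_increment g t s 0 (`|g t| + 1) cg.
rewrite t0 (ltW ts) => /(_ isT); rewrite mul0r subr0 => /(_ _)/le_trans; apply.
  move=> r /andP[tr rs]; apply: gb; first exact: le_trans tr.
  apply: le_lt_trans sh; rewrite !ger0_norm ?subr_ge0 ?(ltW ts)//; lra.
by apply: le_trans se'; rewrite ler_wpM2l ?ler_norm// ltW.
Qed.

(** The difference of the two sides has a vanishing right derivative, hence
    grows at most like [k * t] for every positive [k], by real induction.
    One-sided derivatives suffice, and spare any discussion at time 0. *)
Lemma tint_right_derivative F g : cont0 F -> cont0 g ->
  (forall t, 0 <= t -> forall k : R, 0 < k -> exists2 e : R, 0 < e &
     forall h, 0 < h <= e -> `|F (t + h) - F t - h * g t| <= k * h) ->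
  forall t, 0 <= t -> F t = F 0 + tint g t.
Proof.
move=> cF cg dF t t0.
have cI := cont0_tint cg.
suff H (k : R) : 0 < k -> `|F t - F 0 - tint g t| <= k * t.
  apply/eqP; rewrite -subr_eq0 opprD addrA -normr_le0.
  apply/ler_addgt0Pr => e e0; rewrite add0r.
  have t10 : 0 < t + 1 by rewrite ltr_wpDl.
  apply: le_trans (H (e / (t + 1)) (divr_gt0 e0 t10)) _.
  by rewrite mulrAC ler_pdivrMr//; apply: ler_wpM2l; rewrite ?(ltW e0)// lerDl.
move=> k0; move: t t0; apply: forward_induction.
- by rewrite tint0 subrr subr0 normr0 mulr0.
- move=> t t0 /(_ t); rewrite t0 lexx => /(_ isT) Ht.
  have k2 : 0 < k / 2 by rewrite divr_gt0.
  have [e1 e10 H1] := dF t t0 _ k2.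
  have [e2 e20 H2] := cg t t0 _ k2.
  exists (Num.min e1 (e2 / 2)); first by rewrite lt_min e10 divr_gt0.
  move=> h /andP[h0]; rewrite le_min => /andP[he1 he2].
  have := H1 h; rewrite h0 he1 => /(_ isT) E1.
  have := @tint_increment g t (t + h) (g t) (k / 2) cg.
  rewrite t0 lerDl (ltW h0) => /(_ isT).
  have -> : t + h - t = h by rewrite addrC addKr.
  move=> /(_ _)/wrap[].
    move=> s /andP[ts sth]; apply: H2; first exact: le_trans ts.
    by rewrite ger0_norm ?subr_ge0//; lra.
  rewrite (mulrC (g t)) => E2.
  have -> : F (t + h) - F 0 - tint g (t + h) = (F t - F 0 - tint g t) +
    ((F (t + h) - F t - h * g t) - (tint g (t + h) - tint g t - h * g t)) by ring.
  apply: le_trans (ler_normD _ _) _; apply: le_trans (lerD (lexx _) (ler_normB _ _)) _.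
  lra.
- move=> t t0 Hs; apply/ler_addgt0Pr => e e0.
  have e3 : 0 < e / 2 by rewrite divr_gt0.
  have [h1 h10 H1] := cF t (ltW t0) _ e3.
  have [h2 h20 H2] := cI t (ltW t0) _ e3.
  pose h := Num.min t (Num.min (h1 / 2) (h2 / 2)).
  have h0 : 0 < h by rewrite !lt_min t0 !divr_gt0.
  have ht : h <= t by rewrite ge_min lexx.
  have hh1 : h < h1 by apply: (@le_lt_trans _ _ (h1 / 2)); [rewrite !ge_min lexx ?orbT|lra].
  have hh2 : h < h2 by apply: (@le_lt_trans _ _ (h2 / 2)); [rewrite !ge_min lexx ?orbT|lra].
  have s0 : 0 <= t - h by rewrite subr_ge0.
  have sh : `|t - h - t| = h by rewrite addrC addKr normrN gtr0_norm.
  have := Hs (t - h); rewrite s0/= ltrBlDr ltrDl h0 => /(_ isT) E.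
  have := H1 _ s0; rewrite sh => /(_ hh1) E1.
  have := H2 _ s0; rewrite sh => /(_ hh2) E2.
  have -> : F t - F 0 - tint g t = (F (t - h) - F 0 - tint g (t - h)) +
    ((tint g (t - h) - tint g t) - (F (t - h) - F t)) by ring.
  apply: le_trans (ler_normD _ _) _; apply: le_trans (lerD (lexx _) (ler_normB _ _)) _.
  have : k * (t - h) <= k * t by apply: ler_wpM2l; lra.
  lra.
Qed.

Lemma cont0_expR (b : R) : cont0 (fun s => expR (b * s)).
Proof.
apply: within_econt; apply: continuous_subspaceT => t.
apply: (@continuous_comp _ _ _ (fun s => b * s) (@expR R)); last exact: continuous_expR.
exact: mulrl_continuous.
Qed.

(** Convexity of the exponential sandwiches its difference quotients between its
    values at the two ends. *)
Lemma tint_expR (b t : R) : 0 < b -> 0 <= t ->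
  tint (fun s => b * expR (b * s)) t = expR (b * t) - 1.
Proof.
move=> b0 t0; have cE := @cont0_expR b.
have cbE : cont0 (fun s => b * expR (b * s)).
  move=> s s0 e e0; have [h h0 H] := cE s s0 (e / b) (divr_gt0 e0 b0).
  exists h => // r r0 rs; rewrite -mulrBr normrM gtr0_norm// mulrC -ler_pdivlMr//.
  exact: H.
rewrite (tint_right_derivative cE cbE _ t0) ?mulr0 ?expR0 1?addrC ?addKr//.
move=> s s0 k k0; have [e e0 H] := cE s s0 (k / b) (divr_gt0 k0 b0).
exists (e / 2); first by rewrite divr_gt0.
move=> h /andP[h0 he].
have Hsh : `|expR (b * (s + h)) - expR (b * s)| <= k / b.
  apply: H => /=; first by rewrite addr_ge0// ltW.
  by rewrite addrC addKr gtr0_norm//; lra.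
move: Hsh; rewrite ler_norml => /andP[_]; rewrite ler_pdivlMr// mulrDr expRD.
have := expR_ge1Dx (b * h); have := expR_ge1Dx (- (b * h)); rewrite expRN.
have E0 := expR_gt0 (b * s); have G0 := expR_gt0 (b * h).
set E := expR (b * s) in E0 *; set G := expR (b * h) in G0 *.
move=> h1 h2 h3.
have h4 : G - 1 <= b * h * G.
  have : (1 - b * h) * G <= G^-1 * G by apply: ler_wpM2r => //; exact: ltW.
  rewrite mulVf ?gt_eqF//; lra.
have bh0 : 0 <= b * h by rewrite mulr_ge0// ltW.
have h5 : E * (G - 1) <= E * (b * h * G) by apply: ler_wpM2l => //; exact: ltW.
have h6 : E * (b * h) <= E * (G - 1) by apply: ler_wpM2l; [exact: ltW|lra].
have h7 : h * (E * G - E) * b <= h * k by rewrite -mulrA; apply: ler_wpM2l => //; exact: ltW.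
rewrite ler_norml; apply/andP; split; lra.
Qed.

End time.
Notation cont0 := (econt [set t : _ | 0 <= t]).

(** * Smoothing Lipschitz functions *)

Section smoothing.
Context {R : realType} {d : nat}.
Implicit Types (x y z : 'rV[R]_d) (f g phi psi : 'rV[R]_d -> R).
Local Notation leb := (@lebesgue_measure R).
Local Notation u_ := (delta_mx 0 : 'I_d -> 'rV[R]_d).

Lemma tint_bound (g : R -> R) (t r : R) : cont0 g -> 0 <= t ->
  (forall s, 0 <= s <= t -> `|g s| <= r) -> `|tint g t| <= r * t.
Proof.
move=> cg t0 gr; have := @tint_increment R g 0 t 0 r cg.
rewrite lexx t0 tint0 !subr0 mul0r subr0 => /(_ isT); apply.
by move=> s st; rewrite subr0; exact: gr.
Qed.

Lemma cont0_line (C : R) phi x v : lipf C phi -> cont0 (fun s => phi (x + s *: v)).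
Proof.
move=> phiC t t0 e e0; have c0 : 0 < `|C| * enorm v + 1 by rewrite ltr_wpDl ?mulr_ge0.
exists (e / (`|C| * enorm v + 1)); first by rewrite divr_gt0.
move=> s s0; rewrite ltr_pdivlMr// => st.
apply: le_trans (phiC _ _) _; apply: le_trans (ltW st).
rewrite opprD addrACA subrr add0r -scalerBl enormZ.
have : C * (`|s - t| * enorm v) <= `|C| * (`|s - t| * enorm v).
  by apply: ler_wpM2r; rewrite ?mulr_ge0 ?ler_norm.
have := normr_ge0 (s - t); lra.
Qed.

Lemma enorm_line (s : R) i : enorm (s *: u_ i) = `|s|.
Proof. by rewrite enormZ enorm_delta mulr1. Qed.

Definition avg (e : R) (i : 'I_d) phi x : R :=
  e^-1 * tint (fun s => phi (x + s *: u_ i)) e.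

Section avg_theory.
Variables (e : R) (i : 'I_d).
Hypothesis e0 : 0 < e.

Lemma avg_cst (c : R) x : avg e i (fun=> c) x = c.
Proof.
rewrite /avg /tint Rintegral_cst//= lebesgue_measure_itv/= lte_fin e0 oppr0 adde0 /=.
by rewrite mulrC mulfK ?gt_eqF.
Qed.

Lemma avgB (C D : R) phi psi x : lipf C phi -> lipf D psi ->
  avg e i (fun y => phi y - psi y) x = avg e i phi x - avg e i psi x.
Proof.
move=> phiC psiD; rewrite /avg tintB; first by rewrite mulrBr.
- exact: cont0_line phiC.
- exact: cont0_line psiD.
Qed.

Lemma avgZ (C c : R) phi x : lipf C phi ->
  avg e i (fun y => c * phi y) x = c * avg e i phi x.
Proof.
move=> phiC; rewrite /avg tintZ; last exact: cont0_line phiC.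
by rewrite mulrCA.
Qed.

Lemma avg_dist (C D r : R) phi psi x y : lipf C phi -> lipf D psi ->
  (forall s, 0 <= s <= e -> `|phi (x + s *: u_ i) - psi (y + s *: u_ i)| <= r) ->
  `|avg e i phi x - avg e i psi y| <= r.
Proof.
move=> phiC psiD h.
have c1 := cont0_line x (u_ i) phiC; have c2 := cont0_line y (u_ i) psiD.
rewrite /avg -mulrBr -tintB// normrM gtr0_norm ?invr_gt0// ler_pdivrMl// mulrC.
apply: tint_bound => //; last exact: ltW.
move=> t t0 k k0; have k2 : 0 < k / 2 by rewrite divr_gt0.
have [h1 h10 H1] := c1 t t0 _ k2; have [h2 h20 H2] := c2 t t0 _ k2.
exists (Num.min h1 h2); first by rewrite lt_min h10.
move=> s s0; rewrite lt_min => /andP[st1 st2].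
have := H1 s s0 st1; have := H2 s s0 st2; rewrite !ler_norml; lra.
Qed.

Lemma avg_lip (C : R) phi : lipf C phi -> lipf C (avg e i phi).
Proof.
move=> phiC x y; apply: (avg_dist phiC phiC) => s _.
apply: le_trans (phiC _ _) _.
by rewrite opprD addrACA subrr addr0.
Qed.

Lemma avg_translate (C : R) phi x v : lipf C phi ->
  avg e i (fun y => phi (y + v)) x = avg e i phi (x + v).
Proof.
move=> phiC; apply/eqP; rewrite -subr_eq0 -normr_le0.
have phivC : lipf C (fun y => phi (y + v)).
  move=> a b; apply: le_trans (phiC _ _) _.
  by rewrite opprD addrACA subrr addr0.
by apply: (avg_dist phivC phiC) => s _; rewrite addrAC subrr normr0.
Qed.

(** The derivative of a mean is a difference quotient. *)
Definition quot phi x : R := e^-1 * (phi (x + e *: u_ i) - phi x).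

Lemma quot_lip (C : R) phi : lipf C phi -> lipf (2 * C / e) (quot phi).
Proof.
move=> phiC x y; rewrite /quot -mulrBr normrM gtr0_norm ?invr_gt0//.
rewrite ler_pdivrMl// mulrA [e * _]mulrC divfK ?gt_eqF//.
have := phiC x y; have := phiC (x + e *: u_ i) (y + e *: u_ i).
rewrite opprD addrACA subrr addr0 !ler_norml; lra.
Qed.

Lemma quot_bound (C : R) phi x : lipf C phi -> `|quot phi x| <= C.
Proof.
move=> phiC; rewrite /quot normrM gtr0_norm ?invr_gt0// ler_pdivrMl// mulrC.
by have := phiC (x + e *: u_ i) x; rewrite addrAC subrr add0r enorm_line (gtr0_norm e0).
Qed.

(** Moving the window of integration by [h] adds a segment of length [h] at one
    end and removes one at the other, on which the function is almost constant. *)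
Lemma avg_increment_pos (C h : R) phi x : 0 <= C -> lipf C phi -> 0 <= h ->
  `|avg e i phi (x + h *: u_ i) - avg e i phi x - h * quot phi x| <= 2 * C / e * h ^+ 2.
Proof.
move=> C0 phiC h0.
pose g s := phi (x + s *: u_ i).
have cg : cont0 g := cont0_line x (u_ i) phiC.
have gC s t : `|g s - g t| <= C * `|s - t|.
  apply: le_trans (phiC _ _) _.
  by rewrite opprD addrACA subrr add0r -scalerBl enorm_line.
have E1 : tint (fun s => phi (x + h *: u_ i + s *: u_ i)) e = tint g (h + e) - tint g h.
  have cI := cont0_tint cg.
  pose F t := tint g (h + t).
  have cF : cont0 F.
    move=> t t0 k k0; have [r r0 H] := cI (h + t) (addr_ge0 h0 t0) k k0.
    exists r => // s s0 st; apply: H; first exact: addr_ge0.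
    by rewrite opprD addrACA subrr add0r.
  have cG : cont0 (fun s => g (h + s)).
    move=> t t0 k k0; have [r r0 H] := cg (h + t) (addr_ge0 h0 t0) k k0.
    exists r => // s s0 st; apply: H; first exact: addr_ge0.
    by rewrite opprD addrACA subrr add0r.
  have dF t : 0 <= t -> forall k : R, 0 < k -> exists2 r : R, 0 < r &
      forall q, 0 < q <= r -> `|F (t + q) - F t - q * g (h + t)| <= k * q.
    move=> t0 k k0; have [r r0 H] := cg (h + t) (addr_ge0 h0 t0) k k0.
    exists (r / 2); first by rewrite divr_gt0.
    move=> q /andP[q0 qr].
    have := @tint_increment R g (h + t) (h + (t + q)) (g (h + t)) k cg.
    rewrite addr_ge0// lerD2l lerDl (ltW q0) => /(_ isT).
    rewrite (_ : h + (t + q) - (h + t) = q); last by ring.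
    rewrite mulrC; apply => s /andP[s1 s2]; apply: H.
      by apply: le_trans s1; exact: addr_ge0.
    by rewrite ger0_norm ?subr_ge0//; lra.
  have := tint_right_derivative cF cG dF (ltW e0); rewrite /F addr0 => ->.
  rewrite addrAC subrr add0r; congr tint; apply/funext => s.
  by rewrite /g scalerDl addrA.
rewrite /avg /quot E1 -/g.
have -> : g = (fun s => phi (x + s *: u_ i)) by [].
rewrite -/g (_ : phi (x + e *: u_ i) = g e)// (_ : phi x = g 0); last by rewrite /g scale0r addr0.
have := @tint_increment R g e (h + e) (g e) (C * h) cg.
rewrite (ltW e0) lerDr h0 addrK => /(_ isT)/(_ _)/wrap[].
  move=> s /andP[s1 s2]; apply: le_trans (gC _ _) _; apply: ler_wpM2l => //.
  by rewrite ger0_norm; lra.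
move=> H1; have := @tint_increment R g 0 h (g 0) (C * h) cg.
rewrite lexx h0 tint0 !subr0 => /(_ isT)/(_ _)/wrap[].
  move=> s /andP[s1 s2]; apply: le_trans (gC _ _) _; apply: ler_wpM2l => //.
  by rewrite ger0_norm; lra.
move=> H2.
rewrite (_ : _ - _ = e^-1 * ((tint g (h + e) - tint g e - g e * h) - (tint g h - g 0 * h))); last by ring.
rewrite normrM gtr0_norm ?invr_gt0// ler_pdivrMl//.
rewrite (_ : e * _ = C * h * h + C * h * h); last by field; rewrite gt_eqF.
by apply: le_trans (ler_normB _ _) _; rewrite lerD.
Qed.

(** A negative increment is a positive one seen from the other end point. *)
Lemma avg_increment (C h : R) phi x : 0 <= C -> lipf C phi ->
  `|avg e i phi (x + h *: u_ i) - avg e i phi x - h * quot phi x| <= 4 * C / e * h ^+ 2.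
Proof.
move=> C0 phiC; have Ce0 : 0 <= C / e by rewrite divr_ge0// ltW.
have := sqr_ge0 h => h2.
have [h0|h0] := leP 0 h.
  apply: le_trans (avg_increment_pos x C0 phiC h0) _.
  by apply: ler_wpM2r => //; lra.
have Nh0 : 0 <= - h by lra.
have := avg_increment_pos (x + h *: u_ i) C0 phiC Nh0.
rewrite (_ : x + h *: u_ i + _ = x); last by rewrite -addrA -scalerDl subrr scale0r addr0.
rewrite sqrrN => H1.
have := quot_lip phiC (x + h *: u_ i) x.
rewrite addrAC subrr add0r enorm_line (ltr0_norm h0) => H2.
rewrite (_ : _ - _ = - (avg e i phi x - avg e i phi (x + h *: u_ i) - - h * quot phi (x + h *: u_ i))
  + h * (quot phi (x + h *: u_ i) - quot phi x)); last by ring.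
apply: le_trans (ler_normD _ _) _; rewrite normrN normrM (ltr0_norm h0).
have : - h * `|quot phi (x + h *: u_ i) - quot phi x| <= - h * (2 * C / e * - h).
  exact: ler_wpM2l.
move: H1; rewrite expr2; lra.
Qed.

End avg_theory.
End smoothing.

Section smooth.
Context {R : realType} {d : nat}.
Implicit Types (x y z : 'rV[R]_d) (f g phi psi : 'rV[R]_d -> R).
Local Notation u_ := (delta_mx 0 : 'I_d -> 'rV[R]_d).

Variable e : R.
Hypothesis e0 : 0 < e.

Definition smooth_along (l : seq 'I_d) phi : 'rV[R]_d -> R := foldr (avg e) phi l.

(** Convolution with the uniform density on a cube of side [e], written with
    integrals over segments only. *)
Definition smooth phi := smooth_along (enum 'I_d) phi.

Lemma smooth_along_lip (C : R) l phi : lipf C phi -> lipf C (smooth_along l phi).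
Proof. by move=> phiC; elim: l => //= i l IH; exact: avg_lip. Qed.

Lemma smooth_along_cst l (c : R) x : smooth_along l (fun=> c) x = c.
Proof.
elim: l x => //= i l IH x.
have -> : smooth_along l (fun=> c) = fun=> c by apply/funext.
exact: avg_cst.
Qed.

(** Each average moves the point by at most [e], so that only values at distance
    at most [size l * e] matter. This locality is what makes smoothing commute
    approximately with composition by a map close to a translation. *)
Lemma smooth_along_dist l (C D r : R) phi psi x y : lipf C phi -> lipf D psi ->
  (forall z, enorm z <= (size l)%:R * e -> `|phi (x + z) - psi (y + z)| <= r) ->
  `|smooth_along l phi x - smooth_along l psi y| <= r.
Proof.
move=> phiC psiD; elim: l x y => [|i l IH] x y /= H.
  by have := H 0; rewrite !addr0 enorm0 mul0r lexx; apply.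
apply: (avg_dist e0 (smooth_along_lip l phiC) (smooth_along_lip l psiD)) => s /andP[s0 se].
apply: IH => z zl; rewrite -!addrA; apply: H.
apply: le_trans (ler_enormD _ _) _; rewrite enorm_line ger0_norm//.
by rewrite -natr1 mulrDl mul1r addrC lerD.
Qed.

Lemma smooth_alongZ l (C c : R) phi x : lipf C phi ->
  smooth_along l (fun y => c * phi y) x = c * smooth_along l phi x.
Proof.
move=> phiC; elim: l x => //= i l IH x.
have -> : smooth_along l (fun y => c * phi y) = fun y => c * smooth_along l phi y.
  by apply/funext.
by apply: avgZ; exact: smooth_along_lip phiC.
Qed.

Lemma lipf_translate (C : R) phi v : lipf C phi -> lipf C (fun y => phi (y + v)).
Proof.
move=> phiC x y; apply: le_trans (phiC _ _) _.
by rewrite opprD addrACA subrr addr0.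
Qed.

Lemma lipfB (C D : R) phi psi : lipf C phi -> lipf D psi ->
  lipf (C + D) (fun x => phi x - psi x).
Proof.
move=> phiC psiD x y; rewrite mulrDl.
rewrite (_ : _ - _ = (phi x - phi y) - (psi x - psi y)); last by ring.
by apply: le_trans (ler_normB _ _) _; exact: lerD.
Qed.

Lemma lipfZ (C c : R) phi : lipf C phi -> lipf (`|c| * C) (fun x => c * phi x).
Proof.
move=> phiC x y; rewrite -mulrBr normrM -mulrA; exact: ler_wpM2l.
Qed.

(** The smoothed function has Lipschitz partial derivatives, with constants
    that only depend on the Lipschitz constant of the original one: averages
    in the other directions commute with the difference quotient. *)
Lemma smooth_along_partial l (C : R) phi i : 0 <= C -> lipf C phi -> i \in l ->
  exists g, [/\ lipf (2 * C / e) g, forall x, `|g x| <= C &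
    forall x h, `|smooth_along l phi (x + h *: u_ i) - smooth_along l phi x - h * g x|
      <= 4 * C / e * h ^+ 2].
Proof.
move=> C0 phiC; elim: l => //= j l IH; rewrite in_cons.
have psiC := smooth_along_lip l phiC.
have [-> _|ij /= /IH[g [gL gB gE]]] := eqVneq i j.
  exists (quot e j (smooth_along l phi)); split.
  - exact: quot_lip.
  - by move=> x; exact: quot_bound.
  - by move=> x h; exact: avg_increment.
exists (avg e j g); split.
- exact: avg_lip.
- move=> x; rewrite -[_ x]subr0 -(avg_cst j e0 0 x).
  apply: (avg_dist e0 gL (_ : lipf 0 _)); last by move=> s _; rewrite subr0.
  by move=> a b; rewrite subrr normr0 mul0r.
- move=> x h; set psi := smooth_along l phi.
  have L1 := lipf_translate (h *: u_ i) psiC.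
  have L2 := lipfB L1 psiC.
  have L3 := lipfZ h gL.
  have L4 := lipfB L2 L3.
  have <- : avg e j (fun y => psi (y + h *: u_ i) - psi y - h * g y) x =
     avg e j psi (x + h *: u_ i) - avg e j psi x - h * avg e j g x.
    rewrite (avgB e j x L2 L3) (avgB e j x L1 psiC) (avgZ e j h x gL).
    by rewrite (avg_translate j e0 x _ psiC).
  rewrite -[avg _ _ _ _]subr0 -(avg_cst j e0 0 x).
  apply: (avg_dist e0 L4 (_ : lipf 0 _)); last by move=> s _; rewrite subr0.
  by move=> a b; rewrite subrr normr0 mul0r.
Qed.

Lemma smooth_lip (C : R) phi : lipf C phi -> lipf C (smooth phi).
Proof. exact: smooth_along_lip. Qed.

Lemma smoothZ (C c : R) phi x : lipf C phi ->
  smooth (fun y => c * phi y) x = c * smooth phi x.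
Proof. exact: smooth_alongZ. Qed.

Lemma smooth_dist (C D r : R) phi psi x y : lipf C phi -> lipf D psi ->
  (forall z, enorm z <= d%:R * e -> `|phi (x + z) - psi (y + z)| <= r) ->
  `|smooth phi x - smooth psi y| <= r.
Proof.
by move=> phiC psiD H; apply: smooth_along_dist phiC psiD _; rewrite size_enum_ord.
Qed.

Lemma smooth_bound (C r : R) phi x : lipf C phi ->
  (forall z, enorm z <= d%:R * e -> `|phi (x + z)| <= r) -> `|smooth phi x| <= r.
Proof.
move=> phiC H; rewrite -[smooth phi x]subr0 -(smooth_along_cst (enum 'I_d) 0 x).
apply: (smooth_dist phiC (_ : lipf 0 _)); last by move=> z zd; rewrite subr0; exact: H.
by move=> a b; rewrite subrr normr0 mul0r.
Qed.

Lemma smooth_near (C : R) phi x : 0 <= C -> lipf C phi ->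
  `|smooth phi x - phi x| <= C * (d%:R * e).
Proof.
move=> C0 phiC; rewrite -(smooth_along_cst (enum 'I_d) (phi x) x).
apply: (smooth_dist phiC (_ : lipf 0 _)).
  by move=> a b; rewrite subrr normr0 mul0r.
move=> z zd; apply: le_trans (phiC _ _) _.
by rewrite addrAC subrr add0r; exact: ler_wpM2l.
Qed.

Definition smooth_hess (C : R) : R := d%:R * (4 * C / e) + d%:R ^+ 2 * (2 * C / e).

Lemma smooth_hess_ge0 (C : R) : 0 <= C -> 0 <= smooth_hess C.
Proof.
move=> C0; rewrite /smooth_hess.
by rewrite addr_ge0 ?mulr_ge0 ?sqr_ge0 ?invr_ge0 ?(ltW e0) ?ler0n ?C0.
Qed.

(** Adding up the increments in the coordinate directions gives a first-order
    Taylor expansion with a quadratic remainder. *)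
Lemma smooth_taylor (C : R) phi : 0 <= C -> lipf C phi ->
  exists g : 'rV[R]_d -> 'rV[R]_d,
    [/\ lipv (d%:R * (2 * C / e)) g,
        forall x, enorm (g x) <= d%:R * C
      & forall x k, `|smooth phi (x + k) - smooth phi x - dotv k (g x)|
          <= smooth_hess C * enorm k ^+ 2].
Proof.
move=> C0 phiC.
have /choice[G HG] : forall i, exists g, [/\ lipf (2 * C / e) g, forall x, `|g x| <= C &
    forall x h, `|smooth phi (x + h *: u_ i) - smooth phi x - h * g x|
      <= 4 * C / e * h ^+ 2].
  by move=> i; apply: smooth_along_partial => //; rewrite mem_enum.
exists (fun x => \row_i G i x); split.
- move=> x y; rewrite -mulrA; apply: enorm_le_coord => i; rewrite !mxE.
  by have [+ _ _] := HG i; apply.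
- by move=> x; apply: enorm_le_coord => i; rewrite mxE; have [_ + _] := HG i; apply.
move=> x k.
have Ce : 0 <= C / e by rewrite divr_ge0// ltW.
have H (s : seq 'I_d) :
    enorm (\sum_(i <- s) k 0 i *: u_ i) <= (size s)%:R * enorm k /\
    `|smooth phi (x + \sum_(i <- s) k 0 i *: u_ i) - smooth phi x -
      \sum_(i <- s) k 0 i * G i x| <=
    ((size s)%:R * (4 * C / e) + (size s)%:R ^+ 2 * (2 * C / e)) * enorm k ^+ 2.
  elim: s => [|i s [IH1 IH2]].
    by rewrite !big_nil addr0 enorm0 subrr subr0 normr0 expr2 !mul0r addr0 mul0r.
  rewrite !big_cons.
  have ki : `|k 0 i| <= enorm k by exact: coord_le_enorm.
  have k2 := enorm_ge0 k.
  set y := \sum_(j <- s) _ in IH1 IH2 *; set n := (size s)%:R : R in IH1 IH2 *.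
  have n0 : 0 <= n by [].
  have -> : (size (i :: s))%:R = n + 1 by rewrite /= -natr1.
  split.
    apply: le_trans (ler_enormD _ _) _; rewrite enorm_line mulrDl mul1r; lra.
  have [GL GB GE] := HG i.
  have E1 := GE (x + y) (k 0 i).
  have E2 := GL (x + y) x.
  rewrite addrAC subrr add0r in E2.
  rewrite (addrC (_ *: _)) addrA.
  set S := \sum_(j <- s) k 0 j * G j x in IH2 *.
  rewrite (_ : _ - _ = (smooth phi (x + y) - smooth phi x - S) +
    (smooth phi (x + y + k 0 i *: u_ i) - smooth phi (x + y) - k 0 i * G i (x + y)) +
    k 0 i * (G i (x + y) - G i x)); last by ring.
  apply: le_trans (ler_normD _ _) _; rewrite normrM.
  apply: le_trans (lerD (ler_normD _ _) (lexx _)) _.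
  have E3 : `|k 0 i| * `|G i (x + y) - G i x| <= enorm k * (2 * C / e * (n * enorm k)).
    apply: ler_pM => //; apply: le_trans E2 _; apply: ler_wpM2l => //.
    by rewrite -mulrA mulr_ge0.
  have E4 : 4 * C / e * k 0 i ^+ 2 <= 4 * C / e * enorm k ^+ 2.
    apply: ler_wpM2l; first by rewrite -mulrA mulr_ge0.
    by rewrite -[k 0 i ^+ 2]ger0_norm ?sqr_ge0// normrX ler_sqr ?nnegrE.
  have E5 : 0 <= (n + 1) * (2 * C / e) * enorm k ^+ 2.
    by rewrite mulr_ge0 ?sqr_ge0// mulr_ge0 ?addr_ge0// -mulrA mulr_ge0.
  move: E1 E3 E4 E5 IH2; rewrite !expr2; lra.
have [_] := H (enum 'I_d); rewrite size_enum_ord big_enum/= -row_sum_delta big_enum/=.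
congr (`|_ - _| <= _); apply: eq_bigr => i _; by rewrite mxE.
Qed.

End smooth.

Section C1.
Context {R : realType} {d : nat}.
Implicit Types (x y z k v : 'rV[R]_d) (f phi : 'rV[R]_d -> R).

(** The varying vector comes last, to serve as a differential. *)
Definition dotl v k : R := dotv k v.

Lemma dotl_is_linear v : linear_for *%R (dotl v).
Proof. by move=> a x y; rewrite /dotl dotvDl dotvZl. Qed.

HB.instance Definition _ v := GRing.isLinear.Build R 'rV[R]_d R *%R (dotl v)
  (dotl_is_linear v).

Lemma dotl_lip v : lipf (enorm v) (dotl v).
Proof.
move=> x y; rewrite /dotl -dotvNl -dotvDl mulrC; exact: cauchy_schwarz.
Qed.

Lemma taylor_differentiable (M : R) f x v : 0 <= M ->
  (forall k, `|f (x + k) - f x - dotv k v| <= M * enorm k ^+ 2) ->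
  differentiable f x /\ 'd f x = dotl v :> ('rV[R]_d -> R).
Proof.
move=> M0 H.
have cL : continuous (dotl v) := lipf_continuous (dotl_lip v).
have E : f \o shift x = cst (f x) + dotl v +o_ (0 : 'rV[R]_d) id.
  apply/eqaddoP => e e0.
  pose c := M * d%:R ^+ 2 + 1.
  have c0 : 0 < c by rewrite ltr_wpDl// mulr_ge0 ?sqr_ge0.
  apply/nbhs_enormP; exists (e / c); first by rewrite divr_gt0.
  move=> k; rewrite sub0r enormN => kc.
  rewrite /= !fctE /= opprD addrA [k + x]addrC -/(dotv k v).
  apply: le_trans (H k) _.
  have k1 := enorm_le_mx_norm k; have k2 := mx_norm_le_enorm k.
  have k0 := normr_ge0 k.
  apply: (@le_trans _ _ (M * d%:R ^+ 2 * `|k| * `|k|)).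
    rewrite -!mulrA; apply: ler_wpM2l => //.
    have : enorm k ^+ 2 <= (d%:R * `|k|) ^+ 2 by rewrite ler_sqr ?nnegrE ?mulr_ge0.
    rewrite exprMn => h; apply: le_trans h _; by rewrite !expr2 -!mulrA.
  apply: ler_wpM2r => //.
  apply: (@le_trans _ _ (c * enorm k)).
    apply: ler_pM => //; first by rewrite mulr_ge0 ?sqr_ge0.
    by rewrite /c lerDl.
  by rewrite mulrC -ler_pdivlMr// ltW.
have dE := diff_unique cL E.
split=> //; apply/diff_locallyP; split; first by rewrite dE.
by rewrite dE.
Qed.

Lemma taylor_gradient (M : R) f x v : 0 <= M ->
  (forall k, `|f (x + k) - f x - dotv k v| <= M * enorm k ^+ 2) ->
  gradient f x = v.
Proof.
move=> M0 H; have [df dE] := taylor_differentiable M0 H.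
apply/rowP => i; rewrite mxE deriveE// dE /dotl /dotv (bigD1 i)//= mxE !eqxx mul1r.
rewrite big1 ?addr0// => j /negbTE ji; by rewrite mxE eqxx ji mul0r.
Qed.

(** Smoothing a compactly supported Lipschitz function gives an admissible
    test function of the weak formulation. *)
Lemma smooth_C1c (e C r : R) phi : 0 < e -> 0 <= C -> lipf C phi ->
  (forall x, r < enorm x -> phi x = 0) ->
  [/\ C1c (smooth e phi), lipv (d%:R * (2 * C / e)) (gradient (smooth e phi)),
      forall x, enorm (gradient (smooth e phi) x) <= d%:R * C
    & forall x k, `|smooth e phi (x + k) - smooth e phi x - dotv k (gradient (smooth e phi) x)|
          <= @smooth_hess R d e C * enorm k ^+ 2].
Proof.
move=> e0 C0 phiC phi0.
have [g [gL gB gT]] := smooth_taylor e0 C0 phiC.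
have M0 := @smooth_hess_ge0 R d e e0 C C0.
have gE : gradient (smooth e phi) = g.
  by apply/funext => x; exact: (taylor_gradient M0 (gT x)).
rewrite gE; split=> //; split.
- by move=> x; have [] := taylor_differentiable M0 (gT x).
- by rewrite gE; exact: lipv_continuous gL.
apply: bounded_closed_compact; last exact: closed_closure.
have sub : closure [set x | smooth e phi x != 0] `<=` eball (r + d%:R * e).
  rewrite (_ : eball _ = closure (eball (r + d%:R * e))).
    apply: closureS => x /= sx; rewrite /eball /= leNgt; apply/negP => rx.
    move/negP: sx; apply; rewrite -normr_le0.
    apply: (smooth_bound e0 phiC) => z zd; rewrite phi0 ?normr0//.
    have := ler_enormD (x + z) (- z); rewrite addrK enormN; lra.
  apply/closure_id; rewrite -[X in closed X]setCK; apply: open_closedC.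
  exact: eball_compl_open.
exists (r + d%:R * e); split; first exact: num_real.
move=> M rM x /sub; rewrite /eball/= => xr.
by apply: le_trans (mx_norm_le_enorm _) (le_trans xr (ltW rM)).
Qed.

End C1.

(** * The delayed vector field *)

Section vfield.
Context {R : realType} {d : nat}.
Variables (tau L : R) (rho : probability (measurableTypeR R) R).
Variable K : 'rV[R]_d -> 'rV[R]_d -> 'rV[R]_d.
Hypothesis tau0 : 0 < tau.
Hypothesis rho1 : rho `[- tau, 0]%classic = 1%E.
Hypothesis L0 : 0 < L.
Hypothesis KL : forall x x' y y',
  enorm (K x y - K x' y') <= L * (enorm (x - x') + enorm (y - y')).
Implicit Types (mu nu : R -> P1 R d) (x y : 'rV[R]_d).
Local Notation delays := [set s : R | - tau <= s <= 0].
Local Notation times := [set s : R | - tau <= s].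

Lemma delaysE : delays = `[- tau, 0]%classic.
Proof. by apply/seteqP; split => s /=; rewrite in_itv. Qed.

Lemma delay_integrable (g : R -> R) : econt delays g ->
  rho.-integrable `[- tau, 0] (EFin \o g).
Proof.
rewrite delaysE => /econt_within cg.
apply: measurable_bounded_integrable => //.
- by have /= -> := rho1; exact: ltry.
- exact: subspace_continuous_measurable_fun.
have bg : compact (g @` `[- tau, 0]).
  by apply: continuous_compact => //; exact: segment_compact.
have [M [Mreal HM]] := compact_bounded bg.
exists M; split => // N MN s sI; apply: HM => //; exact: imageP.
Qed.

Lemma delay_dist (g f : R -> R) (w : R) : econt delays g -> econt delays f ->
  (forall s, delays s -> `|g s - f s| <= w) ->
  `|\int[rho]_(s in `[- tau, 0]) g s - \int[rho]_(s in `[- tau, 0]) f s| <= w.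
Proof.
move=> cg cf H.
have ig := delay_integrable cg; have jf := delay_integrable cf.
have cst_int (r : R) : \int[rho]_(s in `[- tau, 0]) r = r.
  by rewrite Rintegral_cst//; have /= -> := rho1; rewrite mulr1.
have mI : measurable (`[- tau, 0]%classic : set (measurableTypeR R)) by exact: measurable_itv.
have iB : rho.-integrable `[- tau, 0] (EFin \o (fun s => g s - f s)).
  have := integrableB mI ig jf.
  by congr (integrable _ _ _); apply/funext => s /=; rewrite EFinB.
rewrite -RintegralB// -[leRHS]cst_int.
apply: le_trans (le_normr_Rintegral _ _) _ => //.
have ic : rho.-integrable `[- tau, 0] (EFin \o (fun=> w)).
  apply: delay_integrable => s ss e e0; exists 1 => // r _ _.
  by rewrite subrr normr0 ltW.
apply: le_Rintegral (integrable_abse iB) ic _ => //.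
Qed.

Lemma delay_bound (g : R -> R) (w : R) : econt delays g ->
  (forall s, delays s -> `|g s| <= w) -> `|\int[rho]_(s in `[- tau, 0]) g s| <= w.
Proof.
move=> cg H.
have c0 : econt delays (fun=> 0 : R).
  by move=> s _ e e0; exists 1 => // r _ _; rewrite subrr normr0 ltW.
have := @delay_dist g (fun=> 0) w cg c0.
rewrite (_ : \int[rho]_(s in _) (fun=> 0) s = 0); last first.
  by rewrite Rintegral_cst// mul0r.
by rewrite subr0; apply => s sI; rewrite subr0; exact: H.
Qed.

Lemma K_lip_snd x i : lipf L (fun y => K x y 0 i).
Proof.
move=> y y'; apply: (@le_trans _ _ (enorm (K x y - K x y'))).
  by apply: le_trans (coord_le_enorm _ i); rewrite !mxE.
by apply: le_trans (KL _ _ _ _) _; rewrite subrr enorm0 add0r.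
Qed.

Lemma K_lip_fst x x' y i : `|K x y 0 i - K x' y 0 i| <= L * enorm (x - x').
Proof.
apply: (@le_trans _ _ (enorm (K x y - K x' y))).
  by apply: le_trans (coord_le_enorm _ i); rewrite !mxE.
by apply: le_trans (KL _ _ _ _) _; rewrite subrr enorm0 addr0.
Qed.

Lemma K_growth x y i : `|K x y 0 i| <= enorm (K 0 0) + L * enorm x + L * enorm y.
Proof.
apply: le_trans (coord_le_enorm _ _) _.
have := KL x 0 y 0; rewrite !subr0 => H.
have := ler_enormD (K 0 0) (K x y - K 0 0); rewrite addrC subrK; lra.
Qed.

Definition kmean mu (t : R) x i : R := mean (mu t) (fun y => K x y 0 i).

Lemma vfieldE mu t x i :
  vfield tau rho K mu t x 0 i = \int[rho]_(s in `[- tau, 0]) kmean mu (t + s) x i.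
Proof. by rewrite mxE. Qed.

Lemma kmean_econt mu t x i : W1cont times mu -> 0 <= t ->
  econt delays (fun s => kmean mu (t + s) x i).
Proof.
move=> cmu t0 s /andP[s1 s2] e e0.
have ts : times (t + s) by rewrite /=; lra.
have [h h0 H] := cmu _ ts (e / L) (divr_gt0 e0 L0).
exists h => // r /= /andP[r1 r2] rs.
have := W1le_lip_norm (ltW L0) (K_lip_snd x i) (H (t + r) _ _).
rewrite mulrC divfK ?gt_eqF//; apply; first by rewrite /=; lra.
by rewrite opprD addrACA subrr add0r.
Qed.

Lemma vfield_coord_dist mu nu t t' x x' i (w : R) : W1cont times mu -> W1cont times nu ->
  0 <= t -> 0 <= t' ->
  (forall s, delays s -> `|kmean mu (t + s) x i - kmean nu (t' + s) x' i| <= w) ->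
  `|vfield tau rho K mu t x 0 i - vfield tau rho K nu t' x' 0 i| <= w.
Proof.
move=> cmu cnu t0 t'0 H; rewrite !vfieldE; apply: delay_dist => //; exact: kmean_econt.
Qed.

(** A Lipschitz constant of the field in the space variable and in the measures;
    the factor [d%:R] comes from estimating vectors coordinatewise. *)
Definition Lv : R := d%:R * L.

Lemma Lv_ge0 : 0 <= Lv.
Proof. by apply: mulr_ge0 => //; exact: ltW. Qed.

Lemma vfield_lip mu t : W1cont times mu -> 0 <= t -> lipv Lv (vfield tau rho K mu t).
Proof.
move=> cmu t0 x x'; rewrite /Lv -mulrA; apply: enorm_le_coord => i; rewrite mxE [X in _ + X]mxE.
apply: vfield_coord_dist => // s _; apply: mean_dist_cst.
- exact: lingrowth_lip (K_lip_snd x i).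
- exact: lingrowth_lip (K_lip_snd x' i).
- by move=> y; exact: K_lip_fst.
Qed.

Lemma vfield_dist mu nu t t' x (w : R) : W1cont times mu -> W1cont times nu ->
  0 <= t -> 0 <= t' -> (forall s, delays s -> W1le (mu (t + s)) (nu (t' + s)) w) ->
  enorm (vfield tau rho K mu t x - vfield tau rho K nu t' x) <= Lv * w.
Proof.
move=> cmu cnu t0 t'0 H; rewrite /Lv -mulrA; apply: enorm_le_coord => i; rewrite mxE [X in _ + X]mxE.
apply: vfield_coord_dist => // s sI.
exact: W1le_lip_norm (ltW L0) (K_lip_snd x i) (H s sI).
Qed.

Lemma vfield_bound mu t x (M : R) : W1cont times mu -> 0 <= t ->
  (forall s, delays s -> moment1 (mu (t + s)) <= M) ->
  enorm (vfield tau rho K mu t x) <= d%:R * (enorm (K 0 0) + L * enorm x + L * M).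
Proof.
move=> cmu t0 H; apply: enorm_le_coord => i; rewrite vfieldE.
apply: delay_bound; first exact: kmean_econt.
move=> s sI; have lK := lingrowth_lip (K_lip_snd x i).
apply: le_trans (le_norm_mean _ lK) _.
have lin : lingrowth (fun y : 'rV[R]_d => L * enorm y).
  exact: lingrowthZ (@lingrowth_enorm R d).
apply: (@le_trans _ _ (mean (mu (t + s)) (fun y => (enorm (K 0 0) + L * enorm x) + L * enorm y))).
  apply: le_mean; first exact: lingrowth_norm.
    by apply: lingrowthD => //; exact: lingrowth_cst.
  by move=> y; exact: K_growth.
rewrite meanD//; last exact: lingrowth_cst.
rewrite mean_cst meanZ; last exact: lingrowth_enorm.
by rewrite lerD2l; apply: ler_wpM2l; [exact: ltW|exact: H].
Qed.

(** Heine's theorem, for curves of measures. *)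
Lemma W1cont_uniform mu (T e : R) : W1cont times mu -> 0 < e ->
  exists2 h : R, 0 < h & forall s t, - tau <= s <= T -> - tau <= t <= T ->
    `|s - t| < h -> W1le (mu s) (mu t) e.
Proof.
move=> cmu e0; have e2 : 0 < e / 2 by rewrite divr_gt0.
have /compact_near_coveringP/near_covering_withinP cI := @segment_compact _ (- tau) T.
have near0 : forall t, `[- tau, T]%classic t ->
    \forall t' \near t & h \near 0^'+, `[- tau, T]%classic t' ->
      forall s, - tau <= s <= T -> `|s - t'| < h -> W1le (mu s) (mu t') e.
  move=> t; rewrite /= in_itv/= => /andP[t1 tT].
  have [h h0 H] := cmu t t1 _ e2.
  have h2 : 0 < h / 2 by rewrite divr_gt0.
  exists ([set t' | `|t - t'| < h / 2], [set k | k < h / 2]).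
    split; last exact: nbhs_right_lt.
    by exists (h / 2).
  move=> [t' k] /= [tt' kh]; rewrite in_itv/= => /andP[t'1 t'T] s /andP[s1 sT] st'.
  have Ht' : W1le (mu t') (mu t) (e / 2).
    by apply: H => //; rewrite distrC (lt_trans tt')//; lra.
  have Hs : W1le (mu s) (mu t) (e / 2).
    apply: H => //; rewrite -(subrK t' s) -addrA.
    by apply: le_lt_trans (ler_normD _ _) _; rewrite (distrC t'); lra.
  have := W1le_trans Hs (W1le_sym Ht'); apply: W1le_le; lra.
have cN := cI _ _ _ (at_right_proper_filter 0) near0.
have [h [h0 Hh]] := filter_ex (filterI (nbhs_right_gt (0 : R)) cN).
by exists h => // s t sI tI st; apply: Hh; rewrite //= in_itv.
Qed.

Lemma moment1_econt (A : set R) mu : W1cont A mu -> econt A (fun t => moment1 (mu t)).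
Proof.
move=> cmu t ts e e0; have [h h0 H] := cmu t ts e e0.
exists h => // s ss st.
have := W1le_lip_norm ler01 (@lipf_enorm R d) (H s ss st).
by rewrite mul1r.
Qed.

Lemma moment1_bounded mu (a b : R) : a <= b -> W1cont [set s | a <= s <= b] mu ->
  exists2 M : R, 0 <= M & forall s, a <= s <= b -> moment1 (mu s) <= M.
Proof.
move=> ab cmu.
have : {within `[a, b], continuous (fun t => moment1 (mu t))}.
  by apply: econt_within; apply: econt_sub (moment1_econt cmu) => t /=; rewrite in_itv.
move=> /(EVT_max ab)[c _ H]; exists (moment1 (mu c)); first exact: moment1_ge0.
by move=> s sI; apply: H; rewrite in_itv.
Qed.

(** A shift in time only affects the measures, and the Lipschitz constant of
    [K x] does not depend on [x]: this is why the continuity is uniform. *)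
Lemma vfield_time_cont mu t (e : R) : W1cont times mu -> 0 <= t -> 0 < e ->
  exists2 h : R, 0 < h & forall s, 0 <= s -> `|s - t| < h -> forall x,
    enorm (vfield tau rho K mu s x - vfield tau rho K mu t x) <= e.
Proof.
move=> cmu t0 e0; have c0 : 0 < Lv + 1 by have := Lv_ge0; lra.
have [h h0 H] := W1cont_uniform (t + 1) cmu (divr_gt0 e0 c0).
exists (Num.min h 1); first by rewrite lt_min h0 ltr01.
move=> s s0; rewrite lt_min => /andP[sh s1] x.
apply: (@le_trans _ _ (Lv * (e / (Lv + 1)))).
  apply: vfield_dist => // r /= /andP[r1 r2].
  have := ler_norm (s - t) => st.
  apply: H; [apply/andP; split; lra..|].
  by rewrite opprD addrACA subrr addr0.
rewrite mulrA ler_pdivrMr// mulrDr mulr1 mulrC lerDl; exact: ltW.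
Qed.

Lemma vfield_growth mu (T : R) : W1cont times mu -> 0 <= T ->
  exists2 C : R, 0 <= C & forall t x, 0 <= t <= T ->
    enorm (vfield tau rho K mu t x) <= C * (1 + enorm x).
Proof.
move=> cmu T0; have tauT : - tau <= T by rewrite (le_trans _ T0)// oppr_le0 ltW.
have sub : [set s | - tau <= s <= T] `<=` times by move=> s /andP[].
have [M M0 HM] := moment1_bounded tauT (W1cont_sub sub cmu).
exists (d%:R * (enorm (K 0 0) + L + L * M)).
  by rewrite mulr_ge0// !addr_ge0 ?mulr_ge0 ?(ltW L0).
move=> t x /andP[t0 tT].
apply: (le_trans (vfield_bound x (M := M) cmu t0 _)).
  by move=> s /= /andP[s1 s2]; apply: HM; apply/andP; split; lra.
rewrite -mulrA; apply: ler_wpM2l => //.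
have x0 := enorm_ge0 x; have k0 := enorm_ge0 (K 0 0).
have := mulr_ge0 k0 x0; have := mulr_ge0 (mulr_ge0 (ltW L0) M0) x0.
have := ltW L0; lra.
Qed.

End vfield.

(** * Stability of weak solutions *)

Section stability.
Context {R : realType} {d : nat}.
Variables (tau L : R) (rho : probability (measurableTypeR R) R).
Variable K : 'rV[R]_d -> 'rV[R]_d -> 'rV[R]_d.
Hypothesis tau0 : 0 < tau.
Hypothesis rho1 : rho `[- tau, 0]%classic = 1%E.
Hypothesis L0 : 0 < L.
Hypothesis KL : forall x x' y y',
  enorm (K x y - K x' y') <= L * (enorm (x - x') + enorm (y - y')).
Implicit Types (mu nu : R -> P1 R d) (x y : 'rV[R]_d) (phi : 'rV[R]_d -> R).
Local Notation delays := [set s : R | - tau <= s <= 0].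
Local Notation times := [set s : R | - tau <= s].
Local Notation V mu t := (vfield tau rho K mu t).
Local Notation Lv := (@Lv R d L).

Let Lv0 : 0 <= Lv := @Lv_ge0 R d L L0.

Lemma pairing_loclip (C B MG : R) (v G : 'rV[R]_d -> 'rV[R]_d) :
  0 <= C -> 0 <= B -> 0 <= MG ->
  lipv Lv v -> (forall x, enorm (v x) <= C * (1 + enorm x)) ->
  lipv MG G -> (forall x, enorm (G x) <= B) ->
  loclip (C * B) (C * MG + Lv * B) (fun x => dotv (v x) (G x)).
Proof.
move=> C0 B0 MG0 vL vC GL GB; split=> [x|x y].
  apply: le_trans (cauchy_schwarz _ _) _; rewrite mulrAC.
  exact: ler_pM.
rewrite (_ : _ - _ = dotv (v x) (G x - G y) + dotv (v x - v y) (G y)); last first.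
  by rewrite dotvDl dotvDr dotvNl dotvNr; ring.
apply: le_trans (ler_normD _ _) _.
have xy := enorm_ge0 (x - y); have x0 := enorm_ge0 x.
have h1 : `|dotv (v x) (G x - G y)| <= (C * (1 + enorm x)) * (MG * enorm (x - y)).
  by apply: le_trans (cauchy_schwarz _ _) _; apply: ler_pM.
have h2 : `|dotv (v x - v y) (G y)| <= (Lv * enorm (x - y)) * B.
  by apply: le_trans (cauchy_schwarz _ _) _; apply: ler_pM.
have h3 : 0 <= Lv * B * enorm x * enorm (x - y) by do 3!apply: mulr_ge0 => //.
by lra.
Qed.

(** By [mean_equicontinuous], the right-hand side of the weak equation depends
    continuously on time, uniformly in the gradient of the test function. *)
Lemma pairing_cont mu t (B MG e : R) : W1cont times mu -> 0 <= t -> 0 <= B -> 0 <= MG ->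
  0 < e -> exists2 h : R, 0 < h & forall G, lipv MG G -> (forall x, enorm (G x) <= B) ->
    forall s, 0 <= s -> `|s - t| < h ->
      `|mean (mu s) (fun x => dotv (V mu s x) (G x)) -
        mean (mu t) (fun x => dotv (V mu t x) (G x))| <= e.
Proof.
move=> cmu t0 B0 MG0 e0.
have t10 : 0 <= t + 1 by rewrite addr_ge0.
have [C C0 HC] := vfield_growth tau0 rho1 L0 KL cmu t10.
have e2 : 0 < e / 2 by rewrite divr_gt0.
have CB : 0 <= C * B by rewrite mulr_ge0.
have C2 : 0 <= C * MG + Lv * B by apply: addr_ge0; apply: mulr_ge0.
have [h1 h10 H1] := mean_equicontinuous (mu t) CB C2 e2.
have ts : times t by rewrite /= (le_trans _ t0)// oppr_le0 ltW.
have [h2 h20 H2] := cmu t ts h1 h10.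
have B1 : 0 < B + 1 by rewrite ltr_wpDl.
have [h3 h30 H3] := vfield_time_cont rho1 L0 KL cmu t0 (divr_gt0 e2 B1).
exists (Num.min 1 (Num.min h2 h3)); first by rewrite !lt_min ltr01 h20 h30.
move=> G GL GB s s0; rewrite !lt_min => /and3P[st1 st2 st3].
have sI : 0 <= s <= t + 1 by rewrite s0/=; have := ler_norm (s - t); lra.
have tI : 0 <= t <= t + 1 by rewrite t0 lerDl ler01.
have ss : times s by rewrite /= (le_trans _ s0)// oppr_le0 ltW.
have lp r : 0 <= r <= t + 1 -> loclip (C * B) (C * MG + Lv * B) (fun x => dotv (V mu r x) (G x)).
  move=> /[dup] rI /andP[r0 _]; apply: pairing_loclip => //.
    exact: vfield_lip.
  by move=> x; exact: HC.
rewrite -(subrK (mean (mu s) (fun x => dotv (V mu t x) (G x))) (mean (mu s) _)) -addrA.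
apply: le_trans (ler_normD _ _) _; rewrite (splitr e); apply: lerD; last first.
  by apply: H1; [exact: lp|exact: H2].
apply: mean_dist_cst.
- exact: loclip_lingrowth (lp s sI).
- exact: loclip_lingrowth (lp t tI).
move=> x; rewrite -dotvNl -dotvDl; apply: le_trans (cauchy_schwarz _ _) _.
apply: (@le_trans _ _ (e / 2 / (B + 1) * B)).
  by apply: ler_pM => //; exact: H3.
rewrite -[leRHS](divfK (lt0r_neq0 B1)); apply: ler_wpM2l; last by rewrite lerDl.
by rewrite divr_ge0 ?(ltW e2) ?(ltW B1).
Qed.

(** Uniformly in the Lipschitz function, a short step of a weak solution
    amounts, for smoothed test functions, to an explicit Euler step along the
    field frozen at the initial time of the step. *)
Lemma euler_step mu t (e k : R) : W1cont times mu -> weak_equation tau rho K mu ->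
  0 <= t -> 0 < e -> 0 < k ->
  exists2 h0 : R, 0 < h0 & forall phi r, lip1 phi -> (forall x, r < enorm x -> phi x = 0) ->
    forall h, 0 < h <= h0 ->
      `|mean (mu (t + h)) (smooth e phi) -
        mean (mu t) (fun x => smooth e phi (x + h *: V mu t x))| <= k * h.
Proof.
move=> cmu wmu t0 e0 k0.
pose B : R := d%:R * 1; pose MG : R := d%:R * (2 * 1 / e); pose M := @smooth_hess R d e 1.
have B0 : 0 <= B by rewrite mulr_ge0.
have MG0 : 0 <= MG by rewrite mulr_ge0// divr_ge0 ?(ltW e0)// mulr_ge0.
have M0 : 0 <= M by apply: smooth_hess_ge0.
have k2 : 0 < k / 2 by rewrite divr_gt0.
have k4 : 0 < k / 4 by rewrite divr_gt0.
have [h1 h10 H1] := pairing_cont cmu t0 B0 MG0 k2.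
have [C C0 HC] := vfield_growth tau0 rho1 L0 KL cmu t0.
pose c := 3 * (1 + B) * C + 1.
have c0 : 0 < c by rewrite ltr_wpDl// mulr_ge0// mulr_ge0// addr_ge0.
have [A0 A01 HA] := mean_excess_small (mu t) (divr_gt0 k4 c0).
pose A := 2 * A0.
have A2 : 2 <= A by rewrite /A; lra.
pose q := M * (C * (1 + A)) ^+ 2 + 1.
have q0 : 0 < q by rewrite ltr_wpDl// mulr_ge0 ?sqr_ge0.
exists (Num.min (h1 / 2) (k / 4 / q)).
  by rewrite lt_min !divr_gt0.
move=> phi r phi1 phi0 h /andP[h0]; rewrite le_min => /andP[hh1 hq].
have /lip1_lipf phiL := phi1.
have [fC1 GL GB fT] := smooth_C1c e0 ler01 phiL phi0.
set f := smooth e phi in fC1 GL GB fT *; set G := gradient f in GL GB fT.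
have fL : lipf 1 f := smooth_lip e0 phiL.
pose a s := mean (mu s) (fun x => dotv (V mu s x) (G x)).
have ca : cont0 a.
  move=> s s0 u u0; have [h2 h20 H2] := pairing_cont cmu s0 B0 MG0 u0.
  by exists h2 => // s' s'0 ss'; exact: H2.
have th0 : 0 <= t + h by rewrite addr_ge0// ltW.
have wE s : 0 <= s -> mean (mu s) f = mean (mu 0) f + tint a s.
  by move=> s0; exact: wmu f fC1 s s0.
have tiv := vfield_lip rho1 L0 KL cmu t0.
have E1 : `|mean (mu (t + h)) f - mean (mu t) f - h * a t| <= k / 2 * h.
  rewrite (wE _ th0) (wE _ t0).
  have := @tint_increment R a t (t + h) (a t) (k / 2) ca.
  rewrite t0 lerDl (ltW h0) (_ : t + h - t = h); last by rewrite addrC addKr.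
  move=> /(_ isT)/(_ _)/wrap[].
    move=> s /andP[s1 s2]; apply: H1 => //; first exact: le_trans s1.
    by rewrite ger0_norm ?subr_ge0//; lra.
  rewrite (_ : _ - _ - a t * h = mean (mu 0) f + tint a (t + h) - (mean (mu 0) f + tint a t) - h * a t)//.
  by ring.
have lf : lingrowth f := lingrowth_lip fL.
have lpair : lingrowth (fun x => dotv (V mu t x) (G x)).
  apply: (@loclip_lingrowth R d (C * B) (C * MG + Lv * B)).
  by apply: pairing_loclip => // x; apply: HC; rewrite t0 lexx.
have lmove : lipv (1 + h * Lv) (fun x => x + h *: V mu t x).
  move=> x y; rewrite opprD addrACA -scalerBr mulrDl mul1r -mulrA.
  apply: le_trans (ler_enormD _ _) _; rewrite lerD2l enormZ (gtr0_norm h0).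
  by apply: ler_wpM2l; [exact: ltW|exact: tiv].
have lfm : lingrowth (fun x => f (x + h *: V mu t x)).
  exact: lingrowth_lip (lipf_comp ler01 fL lmove).
have hA : mean (mu t) (excess (A / 2)) <= k / 4 / c by apply: HA; rewrite /A; lra.
have E2 : `|mean (mu t) (fun x => f (x + h *: V mu t x)) - mean (mu t) f - h * a t| <= k / 2 * h.
  rewrite -addrA -opprD /a -meanZ// -meanD//; last exact: lingrowthZ.
  (* on the ball of radius [A] the Taylor remainder is of order [h ^+ 2]; outside,
     each term is at most of the order of [h * enorm v], and has a small integral *)
  pose b x := M * h ^+ 2 * (C * (1 + A)) ^+ 2 + h * (3 * (1 + B) * C) * excess (A / 2) x.
  have hc0 : 0 <= h * (3 * (1 + B) * C).
    apply: mulr_ge0; first exact: ltW.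
    by apply: mulr_ge0 => //; apply: mulr_ge0 => //; exact: addr_ge0.
  have lexc : lingrowth (@excess R d (A / 2)) := lingrowth_lip (lipf_excess _).
  have lexcZ : lingrowth (fun x => h * (3 * (1 + B) * C) * @excess R d (A / 2) x).
    exact: lingrowthZ.
  have lb : lingrowth b by apply: lingrowthD => //; exact: lingrowth_cst.
  apply: (@le_trans _ _ (mean (mu t) b)).
    apply: mean_dist => //; first by apply: lingrowthD => //; exact: lingrowthZ.
    move=> x; set v := V mu t x.
    have vC : enorm v <= C * (1 + enorm x) by apply: HC; rewrite t0 lexx.
    have v0 := enorm_ge0 v.
    rewrite opprD addrA -dotvZl; have [xA|xA] := leP (enorm x) A.
      apply: le_trans (fT x _) _; rewrite enormZ (gtr0_norm h0) exprMn mulrA.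
      apply: ler_wpDr.
        apply: mulr_ge0; last exact: excess_ge0.
        exact: hc0.
      apply: ler_wpM2l; first by rewrite mulr_ge0 ?sqr_ge0.
      rewrite ler_sqr ?nnegrE//; last by rewrite mulr_ge0// addr_ge0//; lra.
      by apply: le_trans vC _; apply: ler_wpM2l => //; rewrite lerD2l.
    have F1 : `|f (x + h *: v) - f x| <= h * enorm v.
      by have := fL (x + h *: v) x; rewrite addrAC subrr add0r mul1r enormZ (gtr0_norm h0).
    have F2 : `|dotv (h *: v) (G x)| <= h * enorm v * B.
      apply: le_trans (cauchy_schwarz _ _) _; rewrite enormZ (gtr0_norm h0).
      by apply: ler_wpM2l => //; rewrite mulr_ge0// ltW.
    apply: le_trans (ler_normB _ _) _; apply: le_trans (lerD F1 F2) _.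
    apply: ler_wpDl; first by rewrite mulr_ge0 ?sqr_ge0// mulr_ge0 ?sqr_ge0.
    have F3 : enorm v <= C * (3 * excess (A / 2) x).
      apply: le_trans vC _; apply: ler_wpM2l => //; apply: growth_le_excess => //.
      exact: ltW.
    have := ler_wpM2l (mulr_ge0 (ltW h0) (addr_ge0 ler01 B0)) F3.
    lra.
  rewrite meanD//; last exact: lingrowth_cst.
  rewrite mean_cst meanZ//.
  have G1 : q * h <= k / 4 by rewrite mulrC -ler_pdivlMr.
  have G2 : M * h ^+ 2 * (C * (1 + A)) ^+ 2 <= k / 4 * h.
    have := ler_wpM2r (ltW h0) G1; rewrite /q expr2.
    have := mulr_ge0 (ltW h0) (ltW h0); set z := (C * (1 + A)) ^+ 2; lra.
  have G3 : h * (3 * (1 + B) * C) * mean (mu t) (excess (A / 2)) <= h * (k / 4).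
    rewrite -mulrA; apply: ler_wpM2l; first exact: ltW.
    apply: (@le_trans _ _ (c * (k / 4 / c))).
      apply: ler_pM => //; first by rewrite mulr_ge0// mulr_ge0// addr_ge0.
        by apply: Rintegral_ge0 => x _; exact: excess_ge0.
      by rewrite /c lerDl.
    by rewrite mulrC divfK// gt_eqF.
  lra.
rewrite (_ : _ - _ = (mean (mu (t + h)) f - mean (mu t) f - h * a t) -
  (mean (mu t) (fun x => f (x + h *: V mu t x)) - mean (mu t) f - h * a t)); last by ring.
by apply: le_trans (ler_normB _ _) _; lra.
Qed.

End stability.

Section clamp.
Context {R : realType}.
Implicit Types w p c : R.

Definition clamp w p : R := Num.max (- w) (Num.min w p).

Lemma clamp_lip w w' p p' c : 0 <= w -> 0 <= w' -> `|w - w'| <= c -> `|p - p'| <= c ->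
  `|clamp w p - clamp w' p'| <= c.
Proof.
rewrite /clamp !ler_norml => w0 w'0 /andP[h1 h2] /andP[h3 h4].
case: (lerP w p) => h; case: (lerP w' p') => h';
  repeat (match goal with |- context [Num.max ?a ?b] => case: (lerP a b) => ? end);
  apply/andP; split; lra.
Qed.

Lemma clamp_near w p c : 0 <= w -> 0 <= c -> `|p| - w <= c -> `|p - clamp w p| <= c.
Proof.
move=> w0 c0; rewrite lerBlDr /clamp !ler_norml => /andP[h1 h2].
case: (lerP w p) => h;
  repeat (match goal with |- context [Num.max ?a ?b] => case: (lerP a b) => ? end);
  apply/andP; split; lra.
Qed.

End clamp.

Lemma addr_cancel (W : zmodType) (a b c z : W) : a + b + z - (a + z + c) = b - c.
Proof. by rewrite (addrAC a b z) opprD addrA [a + z + b]addrC addrK. Qed.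

Section stability_theorem.
Context {R : realType} {d : nat}.
Variables (tau L : R) (rho : probability (measurableTypeR R) R).
Variable K : 'rV[R]_d -> 'rV[R]_d -> 'rV[R]_d.
Hypothesis tau0 : 0 < tau.
Hypothesis rho1 : rho `[- tau, 0]%classic = 1%E.
Hypothesis L0 : 0 < L.
Hypothesis KL : forall x x' y y',
  enorm (K x y - K x' y') <= L * (enorm (x - x') + enorm (y - y')).
Implicit Types (mu nu : R -> P1 R d) (x y : 'rV[R]_d) (phi : 'rV[R]_d -> R).
Local Notation delays := [set s : R | - tau <= s <= 0].
Local Notation times := [set s : R | - tau <= s].
Local Notation V mu t := (vfield tau rho K mu t).
Local Notation Lv := (@Lv R d L).

Let Lv0 : 0 <= Lv := @Lv_ge0 R d L L0.

Lemma smoothBcst (e c C : R) phi x : 0 < e -> lipf C phi ->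
  smooth e (fun y => phi y - c) x = smooth e phi x - c.
Proof.
move=> e0 phiC; rewrite /smooth; elim: (enum 'I_d) x => //= i l IH x.
have -> : smooth_along e l (fun y => phi y - c) = fun y => smooth_along e l phi y - c.
  by apply/funext.
have c0 : lipf 0 (fun _ : 'rV[R]_d => c) by move=> a b; rewrite subrr normr0 mul0r.
by rewrite (avgB e i x (smooth_along_lip e0 l phiC) c0) avg_cst.
Qed.

(** Clamping a Lipschitz function between the graphs of [r - enorm x] and its
    opposite makes it compactly supported, at a cost measured by the excess. *)
Lemma smooth_truncate (m n : P1 R d) (e k : R) phi : 0 < e -> 0 < k -> lip1 phi ->
  exists psi r, [/\ lip1 psi, forall x, r < enorm x -> psi x = 0 &
    mean m (smooth e phi) - mean n (smooth e phi) <=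
    mean m (smooth e psi) - mean n (smooth e psi) + k].
Proof.
move=> e0 k0 phi1; have /lip1_lipf phiL := phi1.
have k4 : 0 < k / 4 by rewrite divr_gt0.
have [A1 A11 HA1] := mean_excess_small m k4.
have [A2 A21 HA2] := mean_excess_small n k4.
pose A := A1 + A2.
have de0 : 0 <= d%:R * e by rewrite mulr_ge0// ltW.
(* with this radius the function is unchanged on the ball of radius
   [A + d%:R * e], hence its smoothing on the ball of radius [A] *)
pose r := 2 * (A + d%:R * e).
pose w x : R := Num.max (r - enorm x) 0.
pose phi0 x := phi x - phi 0.
pose psi x := clamp (w x) (phi0 x).
have w0 x : 0 <= w x by rewrite /w le_max lexx orbT.
have w1 x y : `|w x - w y| <= enorm (x - y).
  have := ler_dist_enorm x y; rewrite /w.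
  case: (lerP (r - enorm x) 0); case: (lerP (r - enorm y) 0); rewrite ?ler_norml; lra.
have phi01 : lipf 1 phi0.
  by move=> x y; rewrite /phi0 opprB addrA subrK; exact: phiL.
have psi1 : lip1 psi.
  by move=> x y; apply: clamp_lip => //; have := phi01 x y; rewrite mul1r.
have psiL : lipf 1 psi by apply/lip1_lipf.
exists psi, r; split=> //.
  move=> x rx; have wx : w x = 0 by apply/max_idPr; lra.
  rewrite /psi /clamp wx oppr0; apply/max_idPl.
  by rewrite ge_min lexx.
have near x : `|phi0 x - psi x| <= 2 * excess (A + d%:R * e) x.
  have p0 : `|phi0 x| <= enorm x by have := phiL x 0; rewrite mul1r subr0.
  have x0 := w0 x; have ex0 := excess_ge0 (A + d%:R * e) x.
  have h3 : 2 * enorm x - r <= 2 * excess (A + d%:R * e) x.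
    have : enorm x - (A + d%:R * e) <= excess (A + d%:R * e) x by rewrite /excess le_max lexx.
    rewrite /r; lra.
  have h4 : r - enorm x <= w x by rewrite /w le_max lexx.
  apply: clamp_near => //; first exact: mulr_ge0.
  by move: p0 h3 h4; clear; lra.
have snear x : `|smooth e phi0 x - smooth e psi x| <= 2 * excess A x.
  apply: (smooth_dist e0 phi01 psiL) => z zd; apply: le_trans (near _) _.
  apply: ler_wpM2l => //; rewrite /excess ge_max !le_max lexx orbT andbT.
  by have := ler_enormD x z => xz; apply/orP; left; lra.
have lS (f : 'rV[R]_d -> R) : lipf 1 f -> lingrowth (smooth e f).
  by move=> f1; exact: lingrowth_lip (smooth_lip e0 f1).
have lexc : lingrowth (@excess R d A) := lingrowth_lip (lipf_excess _).
have d1 p : `|mean p (smooth e phi0) - mean p (smooth e psi)| <= 2 * mean p (excess A).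
  rewrite -meanZ//; apply: mean_dist => //; [exact: lS|exact: lS|exact: lingrowthZ].
have d2 p : mean p (smooth e phi0) = mean p (smooth e phi) - phi 0.
  rewrite -[X in _ - X](mean_cst p) -meanB; [|exact: lS|exact: lingrowth_cst].
  by apply: eq_mean => x; rewrite /phi0 (smoothBcst _ _ e0 phiL).
have e1 : mean m (excess A) <= k / 4 by apply: HA1; rewrite /A; lra.
have e2 : mean n (excess A) <= k / 4 by apply: HA2; rewrite /A; lra.
have := d1 m; have := d1 n; rewrite !d2 !ler_norml => /andP[a1 a2] /andP[b1 b2].
lra.
Qed.

(** One [Lv] accounts for the growth of Lipschitz constants along an Euler step
    and one for the difference of the fields; the other terms absorb the errors
    due to smoothing, which are at most proportional to the bound itself. *)
Definition stab_rate : R := 2 * Lv + 4 * (Lv * d%:R) + 2.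

Lemma stab_rate_gt0 : 0 < stab_rate.
Proof.
have : 0 <= Lv * d%:R by apply: mulr_ge0.
by rewrite /stab_rate; have := Lv0; lra.
Qed.

(** The arithmetic of one Euler step in the Gronwall argument: [m1], [m2], [m3]
    stand for the integrals against one solution after the step, before it, and
    after exchanging smoothing and step; [n1], [n2], [n3] for the other. *)
Lemma step_arith (m1 n1 m2 n2 m3 n3 h l D e B B' : R) :
  m1 - m2 <= e * h -> - (e * h) <= n1 - n2 ->
  m2 - m3 <= h * (l * (D * e)) ->
  - (h * (l * (B + 2 * (D * e)) + l * (D * e))) <= n2 - n3 ->
  m3 - n3 <= (1 + h * l) * B ->
  h * (l * D * e) <= h * (l * D * B) -> h * e <= h * B ->
  B * (1 + h * (2 * l + 4 * (l * D) + 2)) <= B' -> m1 - n1 <= B'.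
Proof. lra. Qed.

(** Mollified distances satisfy a Gronwall inequality: an Euler step increases
    the Lipschitz constant of test functions by a factor [1 + h * Lv], and the
    two fields differ by at most [Lv] times the largest past distance. *)
Lemma smooth_stability mu nu (D0 e : R) : W1cont times mu -> W1cont times nu ->
  weak_equation tau rho K mu -> weak_equation tau rho K nu ->
  0 <= D0 -> (forall s, delays s -> W1le (mu s) (nu s) D0) -> 0 < e ->
  forall t, 0 <= t -> forall phi, lip1 phi ->
    mean (mu t) (smooth e phi) - mean (nu t) (smooth e phi) <=
    (D0 + e) * expR (stab_rate * t).
Proof.
move=> cmu cnu wmu wnu D00 HD e0.
set C := stab_rate; have C0 : 0 < C := stab_rate_gt0.
pose B t := (D0 + e) * expR (C * t).
have De0 : 0 < D0 + e by rewrite ltr_wpDl.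
have Bmono s t : s <= t -> B s <= B t.
  by move=> st; apply: ler_wpM2l; [exact: ltW|rewrite ler_expR ler_pM2l].
have B0 : B 0 = D0 + e by rewrite /B mulr0 expR0 mulr1.
have timesP t : 0 <= t -> times t by move=> t0; rewrite /= (le_trans _ t0)// oppr_le0 ltW.
have Slip phi : lip1 phi -> lip1 (smooth e phi).
  by move=> /lip1_lipf phi1; apply/lip1_lipf; exact: smooth_lip.
have lS (c : R) (f : 'rV[R]_d -> R) : lipf c f -> lingrowth (smooth e f).
  by move=> f1; exact: lingrowth_lip (smooth_lip e0 f1).
apply: forward_induction => [phi phi1|t t0 Ht|t t0 Ht phi phi1].
- rewrite -/(B 0) B0; apply: le_trans (HD 0 _ _ (Slip _ phi1)) _.
    by rewrite /= lexx oppr_le0 ltW.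
  by rewrite lerDl ltW.
- have [h1 h10 H1] := euler_step tau0 rho1 L0 KL cmu wmu t0 e0 e0.
  have [h2 h20 H2] := euler_step tau0 rho1 L0 KL cnu wnu t0 e0 e0.
  exists (Num.min h1 h2); first by rewrite lt_min h10.
  move=> h /andP[h0]; rewrite le_min => /andP[hh1 hh2] phi phi1.
  rewrite -/(B (t + h)); apply/ler_addgt0Pr => k k0.
  have [psi [r [psi1 psi0]]] := smooth_truncate (mu (t + h)) (nu (t + h)) e0 k0 phi1.
  move=> /le_trans; apply; rewrite lerD2r => {phi phi1}.
  have /lip1_lipf psiL := psi1.
  have := H1 psi r psi1 psi0 h; rewrite h0 hh1 => /(_ isT) E1.
  have := H2 psi r psi1 psi0 h; rewrite h0 hh2 => /(_ isT) E2.
  have vL := vfield_lip rho1 L0 KL cmu t0.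
  have wL := vfield_lip rho1 L0 KL cnu t0.
  have Bt0 : 0 <= B t by rewrite /B mulr_ge0 ?expR_ge0// ltW.
  have Bte : e <= B t.
    by apply: le_trans (Bmono _ _ t0); rewrite B0 lerDr.
  have de0 : 0 <= d%:R * e by rewrite mulr_ge0// ltW.
  (* before time 0 use the initial data, afterwards the induction hypothesis;
     undoing the smoothing of the two integrals costs [2 * (d%:R * e)] *)
  have past s : delays s -> W1le (mu (t + s)) (nu (t + s)) (B t + 2 * (d%:R * e)).
    move=> /andP[s1 s2]; have [ts|ts] := leP 0 (t + s); last first.
      have : W1le (mu (t + s)) (nu (t + s)) D0.
        by apply: HD => /=; rewrite (ltW ts) andbT (le_trans s1)// lerDr.
      apply: W1le_le; apply: (@le_trans _ _ (B t)); last by rewrite lerDl mulr_ge0.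
      by apply: le_trans (Bmono _ _ t0); rewrite B0 lerDl ltW.
    move=> xi xi1; have /lip1_lipf xiL := xi1.
    have := Ht (t + s); rewrite ts gerDl s2 => /(_ isT xi xi1); rewrite -/(B (t + s)) => E.
    have n1 p : `|mean p (smooth e xi) - mean p xi| <= d%:R * e.
      apply: mean_dist_cst; [exact: lS xiL|exact: lingrowth_lip xiL|].
      by move=> x; have := smooth_near e0 x ler01 xiL; rewrite mul1r.
    have := n1 (mu (t + s)); have := n1 (nu (t + s)); rewrite !ler_norml => /andP[a1 a2] /andP[b1 b2].
    have : B (t + s) <= B t by apply: Bmono; rewrite gerDl.
    by move: E a1 a2 b1 b2; clear; lra.
  have fields x : enorm (V nu t x - V mu t x) <= Lv * (B t + 2 * (d%:R * e)).
    by apply: (vfield_dist rho1 L0 KL) => // s sI; apply: W1le_sym; exact: past.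
  have lmove (v : 'rV[R]_d -> 'rV[R]_d) : lipv Lv v -> lipv (1 + h * Lv) (fun x => x + h *: v x).
    move=> vLip x y; rewrite opprD addrACA -scalerBr mulrDl mul1r -mulrA.
    apply: le_trans (ler_enormD _ _) _; rewrite lerD2l enormZ (gtr0_norm h0).
    by apply: ler_wpM2l; [exact: ltW|exact: vLip].
  have SL := smooth_lip e0 psiL.
  pose xi x := psi (x + h *: V mu t x).
  have xiL : lipf (1 + h * Lv) xi.
    by have := lipf_comp ler01 psiL (lmove _ vL); rewrite mul1r.
  have lxi : lingrowth (smooth e xi) := lS _ _ xiL.
  have hL0 : 0 <= h * Lv by apply: mulr_ge0 => //; exact: ltW.
  have lSv (v : 'rV[R]_d -> 'rV[R]_d) : lipv Lv v -> lingrowth (fun x => smooth e psi (x + h *: v x)).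
    by move=> vLip; exact: lingrowth_lip (lipf_comp ler01 SL (lmove _ vLip)).
  (* the field oscillates by at most [Lv * (d%:R * e)] over the range of the
     smoothing, so that smoothing and Euler step almost commute *)
  have C1 : `|mean (mu t) (fun x => smooth e psi (x + h *: V mu t x)) - mean (mu t) (smooth e xi)|
      <= h * (Lv * (d%:R * e)).
    apply: mean_dist_cst => //; first exact: lSv.
    move=> x; apply: (smooth_dist e0 psiL xiL) => z zd.
    apply: le_trans (psiL _ _) _; rewrite mul1r.
    rewrite addr_cancel -scalerBr.
    rewrite enormZ (gtr0_norm h0); apply: ler_wpM2l; first exact: ltW.
    apply: le_trans (vL _ _) _; rewrite opprD addrA subrr add0r enormN.
    exact: ler_wpM2l.
  have C2 : `|mean (nu t) (fun x => smooth e psi (x + h *: V nu t x)) - mean (nu t) (smooth e xi)|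
      <= h * (Lv * (B t + 2 * (d%:R * e)) + Lv * (d%:R * e)).
    apply: mean_dist_cst => //; first exact: lSv.
    move=> x; apply: (smooth_dist e0 psiL xiL) => z zd.
    apply: le_trans (psiL _ _) _; rewrite mul1r.
    rewrite addr_cancel -scalerBr.
    rewrite enormZ (gtr0_norm h0); apply: ler_wpM2l; first exact: ltW.
    apply: le_trans (ler_enorm_dist _ (V mu t x) _) _; apply: lerD => //.
    apply: le_trans (vL _ _) _; rewrite opprD addrA subrr add0r enormN.
    exact: ler_wpM2l.
  have C3 : mean (mu t) (smooth e xi) - mean (nu t) (smooth e xi) <= (1 + h * Lv) * B t.
    have c0 : 0 < 1 + h * Lv by rewrite ltr_pwDl.
    have cV0 : 0 < (1 + h * Lv)^-1 by rewrite invr_gt0.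
    have xi1 : lip1 (fun x => (1 + h * Lv)^-1 * xi x).
      apply/lip1_lipf; have := lipfZ (1 + h * Lv)^-1 xiL.
      by rewrite gtr0_norm// mulVf ?gt_eqF.
    have := Ht t; rewrite t0 lexx => /(_ isT _ xi1); rewrite -/(B t).
    have E p : mean p (smooth e (fun x => (1 + h * Lv)^-1 * xi x)) =
        (1 + h * Lv)^-1 * mean p (smooth e xi).
      by rewrite -meanZ//; apply: eq_mean => x; exact: smoothZ xiL.
    by rewrite !E -mulrBr mulrC ler_pdivrMr// mulrC.
  have Bstep : B t * (1 + h * C) <= B (t + h).
    rewrite /B (mulrDr C) expRD mulrA; apply: ler_wpM2l => //.
    by rewrite mulrC; exact: expR_ge1Dx.
  have F1 : h * (Lv * d%:R * e) <= h * (Lv * d%:R * B t).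
    apply: ler_wpM2l; first exact: ltW.
    by apply: ler_wpM2l => //; apply: mulr_ge0.
  have F2 : h * e <= h * B t by apply: ler_wpM2l => //; exact: ltW.
  exact: (step_arith (ler_normlW E1) (lerNnormlW E2) (ler_normlW C1)
    (lerNnormlW C2) C3 F1 F2 Bstep).
apply/ler_addgt0Pr => k k0; rewrite -/(B t).
have k2 : 0 < k / 2 by rewrite divr_gt0.
have [h1 h10 H1] := cmu t (timesP t (ltW t0)) _ k2.
have [h2 h20 H2] := cnu t (timesP t (ltW t0)) _ k2.
pose h := Num.min t (Num.min (h1 / 2) (h2 / 2)).
have h0 : 0 < h by rewrite !lt_min t0 !divr_gt0.
have ht : h <= t by rewrite ge_min lexx.
have hh1 : h < h1 by apply: (@le_lt_trans _ _ (h1 / 2)); [rewrite !ge_min lexx ?orbT|lra].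
have hh2 : h < h2 by apply: (@le_lt_trans _ _ (h2 / 2)); [rewrite !ge_min lexx ?orbT|lra].
have s0 : 0 <= t - h by rewrite subr_ge0.
have sh : `|t - h - t| = h by rewrite addrC addKr normrN gtr0_norm.
have := Ht (t - h); rewrite s0/= ltrBlDr ltrDl h0 => /(_ isT phi phi1); rewrite -/(B (t - h)) => E.
have E1 := W1le_sym (H1 _ (timesP _ s0) (_ : `|t - h - t| < h1)); rewrite sh in E1.
have E2 := H2 _ (timesP _ s0) (_ : `|t - h - t| < h2); rewrite sh in E2.
have := E1 hh1 _ (Slip _ phi1); have := E2 hh2 _ (Slip _ phi1).
have : B (t - h) <= B t by apply: Bmono; rewrite gerBl ltW.
by move: E; clear; lra.
Qed.

(** Let the scale of smoothing tend to 0. *)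
Theorem stability mu nu (D0 : R) : W1cont times mu -> W1cont times nu ->
  weak_equation tau rho K mu -> weak_equation tau rho K nu ->
  0 <= D0 -> (forall s, delays s -> W1le (mu s) (nu s) D0) ->
  forall t, 0 <= t -> W1le (mu t) (nu t) (D0 * expR (stab_rate * t)).
Proof.
move=> cmu cnu wmu wnu D00 HD t t0 phi phi1; have /lip1_lipf phiL := phi1.
apply/ler_addgt0Pr => k k0.
set E := expR (stab_rate * t).
have c0 : 0 < E + 2 * d%:R by rewrite ltr_pwDl ?expR_gt0 ?mulr_ge0.
pose e := k / (E + 2 * d%:R); have e0 : 0 < e by rewrite divr_gt0.
have := smooth_stability cmu cnu wmu wnu D00 HD e0 t0 phi1.
have n1 p : `|mean p (smooth e phi) - mean p phi| <= d%:R * e.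
  apply: mean_dist_cst; [exact: lingrowth_lip (smooth_lip e0 phiL)|exact: lingrowth_lip phiL|].
  by move=> x; have := smooth_near e0 x ler01 phiL; rewrite mul1r.
have ke : e * (E + 2 * d%:R) = k by rewrite divfK ?gt_eqF.
have := n1 (mu t); have := n1 (nu t); rewrite -/E !ler_norml => /andP[a1 a2] /andP[b1 b2].
lra.
Qed.

End stability_theorem.

(** * Test functions, and exchange of integrals in time and space *)

Section test_functions.
Context {R : realType} {d : nat}.
Implicit Types (x y z : 'rV[R]_d) (phi : 'rV[R]_d -> R) (G : 'rV[R]_d -> 'rV[R]_d).

Lemma continuous_enorm G y (k : R) : continuous G -> 0 < k ->
  exists2 e : R, 0 < e & forall z, enorm (y - z) < e -> enorm (G y - G z) <= k.
Proof.
move=> cG k0; have d0 : 0 < d.+1%:R :> R by rewrite ltr0n.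
have /(@cvgrPdist_lt _ _ _ (nbhs y) _ G (G y))/(_ _ (divr_gt0 k0 d0)) := cG y.
move=> /nbhs_enormP[e e0 H]; exists e => // z /H; rewrite ltr_pdivlMr// => h.
apply: le_trans (enorm_le_mx_norm _) _; apply: le_trans (ltW h); rewrite mulrC.
by apply: ler_wpM2l => //; rewrite ler_nat.
Qed.

Lemma eball_compact (r : R) : compact (eball r : set 'rV[R]_d).
Proof.
apply: bounded_closed_compact.
  exists r; split; first exact: num_real.
  by move=> M rM x xr; exact: le_trans (mx_norm_le_enorm _) (le_trans xr (ltW rM)).
rewrite -[X in closed X]setCK; apply: open_closedC; exact: eball_compl_open.
Qed.

Lemma continuous_vanishing_bounded (f : 'rV[R]_d -> R) (r : R) : continuous f ->
  (forall x, r < enorm x -> f x = 0) -> exists2 M : R, 0 <= M & forall x, `|f x| <= M.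
Proof.
move=> cf f0.
have : compact (f @` eball r).
  by apply: continuous_compact; [exact: continuous_subspaceT|exact: eball_compact].
move=> /compact_bounded[M [Mreal HM]].
exists (`|M| + 1); first by rewrite addr_ge0.
move=> x; have [xr|rx] := leP (enorm x) r; last by rewrite f0// normr0 addr_ge0.
apply: (HM (`|M| + 1)); first by rewrite ltr_pwDr// ler_norm.
by exists x.
Qed.

(** Heine's theorem on a ball slightly larger than the support: points closer
    than 1, one of which is outside this ball, are both outside the support. *)
Lemma continuous_vanishing_uniform G (r k : R) : continuous G ->
  (forall x, r < enorm x -> G x = 0) -> 0 < k ->
  exists2 e : R, 0 < e & forall y z, enorm (y - z) < e -> enorm (G y - G z) <= k.
Proof.
move=> cG G0 k0; have k2 : 0 < k / 2 by rewrite divr_gt0.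
have /compact_near_coveringP cI := @eball_compact (r + 1).
have near0 : forall y, eball (r + 1) y -> \forall y' \near y & h \near 0^'+,
      forall z, enorm (y' - z) < h -> enorm (G y' - G z) <= k.
  move=> y _; have [e e0 He] := continuous_enorm y cG k2.
  have e2 : 0 < e / 2 by rewrite divr_gt0.
  exists ([set y' | enorm (y - y') < e / 2], [set h | h < e / 2]).
    split; last exact: nbhs_right_lt.
    by apply/nbhs_enormP; exists (e / 2).
  move=> [y' h] /= [yy' he] z y'z.
  apply: le_trans (ler_enorm_dist _ (G y) _) _; rewrite (splitr k); apply: lerD.
    by rewrite enorm_distC; apply: He; rewrite (lt_trans yy')// ltr_pdivrMr// ltr_pMr// ltr1n.
  apply: He; apply: le_lt_trans (ler_enorm_dist _ y' _) _.
  by rewrite (splitr e); apply: ltrD => //; exact: lt_trans he.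
have cN := cI _ _ _ (at_right_proper_filter 0) near0.
have [h [h0 Hh]] := filter_ex (filterI (nbhs_right_gt (0 : R)) cN).
exists (Num.min h 1); first by rewrite lt_min h0 ltr01.
move=> y z; rewrite lt_min => /andP[yzh yz1].
have [yr|ry] := leP (enorm y) (r + 1); first exact: Hh.
rewrite (G0 y); last by rewrite (le_lt_trans _ ry)// lerDl.
rewrite (G0 z) ?subrr ?enorm0 ?(ltW k0)//.
have := ler_enormD z (y - z); rewrite addrC subrK => yz.
by move: ry yz yz1; lra.
Qed.

Lemma differentiable_expansion phi y (e : R) : differentiable phi y -> 0 < e ->
  exists2 h : R, 0 < h & forall z, enorm z < h ->
    `|phi (y + z) - phi y - dotv z (gradient phi y)| <= e * enorm z.
Proof.
move=> dphi e0; have /diff_locallyP[_ /eqaddoP E] := dphi.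
have /nbhs_enormP[h h0 H] := E e e0.
exists h => // z zh; have := H z; rewrite sub0r enormN => /(_ zh).
rewrite /= !fctE /= opprD addrA [z + y]addrC.
have -> : 'd phi y z = dotv z (gradient phi y).
  rewrite {1}(row_sum_delta z) linear_sum; apply: eq_bigr => i _.
  by rewrite linearZ/= mxE -deriveE.
by move=> /le_trans; apply; apply: ler_wpM2l; [exact: ltW|exact: mx_norm_le_enorm].
Qed.

(** Off the closed support the function vanishes on a neighbourhood, hence so
    does its gradient. *)
Lemma C1c_vanishing phi : C1c phi -> exists r : R,
  (forall x, r < enorm x -> phi x = 0) /\ (forall x, r < enorm x -> gradient phi x = 0).
Proof.
move=> [dphi _ csupp]; set S := closure _ in csupp.
have : exists r : R, forall x, S x -> enorm x <= r.
  have : compact ((@enorm R d) @` S).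
    by apply: continuous_compact => //; apply: continuous_subspaceT; exact: enorm_continuous.
  move=> /compact_bounded[M [Mreal HM]]; exists (`|M| + 1) => x Sx.
  apply: le_trans (ler_norm _) _; apply: (HM (`|M| + 1)); last by exists x.
  by rewrite ltr_pwDr// ler_norm.
move=> [r Hr]; exists r.
have phi0 x : r < enorm x -> phi x = 0.
  move=> rx; apply/eqP; apply: contraT => px.
  have : S x by apply: subset_closure.
  by move=> /Hr; rewrite leNgt rx.
split=> // x rx; apply/rowP => i; rewrite mxE [RHS]mxE.
rewrite (@near_eq_derive _ _ _ phi (cst 0)) ?derive_cst//.
apply/nbhs_enormP; exists (enorm x - r); first by rewrite subr_gt0.
move=> y xy; apply: phi0; have := ler_enormD y (x - y); rewrite addrC subrK.
by move: xy; lra.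
Qed.

End test_functions.

Section exchange.
Context {R : realType} {d : nat}.

Lemma abs_subst (a b b1 b2 w w' : R) : b = b1 + b2 -> w = w' ->
  `|a - b| <= w -> `|a - b1 - b2| <= w'.
Proof. by move=> -> <-; rewrite opprD addrA. Qed.

(** Integrals in time and space commute when the integrand is continuous in
    time in the mean: both sides then have the same right derivative. *)
Lemma mean_tint (m : P1 R d) (g : R -> 'rV[R]_d -> R) :
  (forall x, cont0 (fun t => g t x)) -> (forall t, 0 <= t -> lingrowth (g t)) ->
  (forall t, 0 <= t -> lingrowth (fun x => tint (fun s => g s x) t)) ->
  (forall t, 0 <= t -> forall k : R, 0 < k -> exists h w,
     [/\ 0 < h, lingrowth w, mean m w <= k &
      forall s, 0 <= s -> `|s - t| < h -> forall x, `|g s x - g t x| <= w x]) ->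
  forall t, 0 <= t -> mean m (fun x => tint (fun s => g s x) t) = tint (fun s => mean m (g s)) t.
Proof.
move=> cg lg lI H t t0.
pose F t := mean m (fun x => tint (fun s => g s x) t).
have incr (s r : R) : 0 <= s -> 0 <= r -> forall w, lingrowth w ->
    (forall q, 0 <= q -> `|q - s| <= `|r - s| -> forall x, `|g q x - g s x| <= w x) ->
    `|F r - F s - (r - s) * mean m (g s)| <= `|r - s| * mean m w.
  move=> s0 r0 w lw Hw.
  have lgs := lingrowthZ (r - s) (lg s s0).
  have E1 := etrans (meanD m (lI s s0) lgs)
    (congr1 (fun z => F s + z) (meanZ m (r - s) (lg s s0))).
  apply: (abs_subst E1 (meanZ m `|r - s| lw)).
  apply: (mean_dist m (lI r r0) (lingrowthD (lI s s0) lgs) (lingrowthZ `|r - s| lw)).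
  move=> x; rewrite opprD addrA; have [sr|/ltW rs] := leP s r.
    have := @tint_increment R (fun q => g q x) s r (g s x) (w x) (cg x).
    rewrite s0 sr => /(_ isT); rewrite mulrC (ger0_norm (x := r - s)) ?subr_ge0//.
    rewrite [X in _ -> _ <= X]mulrC; apply => q /andP[sq qr]; apply: Hw.
      exact: le_trans sq.
    by rewrite !ger0_norm ?subr_ge0// lerD2r.
  have := @tint_increment R (fun q => g q x) r s (g s x) (w x) (cg x).
  rewrite r0 rs => /(_ isT) H1.
  rewrite (_ : _ - _ - _ = - (tint (g^~ x) s - tint (g^~ x) r - g s x * (s - r))); last by ring.
  rewrite normrN (distrC r) (ger0_norm (x := s - r)) ?subr_ge0// [leRHS]mulrC.
  apply: H1 => q /andP[rq qs]; apply: Hw; first exact: le_trans rq.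
  by rewrite distrC [leRHS]distrC !ger0_norm ?subr_ge0// lerD2l lerN2.
have cG : cont0 (fun s => mean m (g s)).
  move=> s s0 k k0; have [h [w [h0 lw mw Hw]]] := H s s0 k k0.
  exists h => // r r0 rs; apply: le_trans mw.
  exact: (mean_dist m (lg r r0) (lg s s0) lw (Hw r r0 rs)).
have F0 : F 0 = 0.
  by rewrite /F -[RHS](mean_cst m); apply: eq_mean => x; rewrite tint0.
rewrite -[LHS]/(F t) -[RHS]add0r -F0; move: t t0; apply: tint_right_derivative => //.
- move=> s s0 k k0; have [h [w [h0 lw mw Hw]]] := H s s0 1 ltr01.
  have c0 : 0 < `|mean m (g s)| + 1 by rewrite ltr_wpDl.
  exists (Num.min h (k / (`|mean m (g s)| + 1))); first by rewrite lt_min h0 divr_gt0.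
  move=> r r0; rewrite lt_min ltr_pdivlMr// => /andP[rh rk].
  have := incr s r s0 r0 w lw (fun q q0 qs => Hw q q0 (le_lt_trans qs rh)).
  move=> E; rewrite -(subrK ((r - s) * mean m (g s)) (F r - F s)).
  apply: le_trans (ler_normD _ _) _; rewrite normrM.
  apply: le_trans (ltW rk); rewrite mulrDr mulr1 addrC lerD2l.
  by apply: le_trans E _; rewrite -[leRHS]mulr1; apply: ler_wpM2l.
- move=> s s0 k k0; have [h [w [h0 lw mw Hw]]] := H s s0 k k0.
  exists (h / 2); first by rewrite divr_gt0.
  move=> q /andP[q0 qh]; have sq0 : 0 <= s + q by rewrite addr_ge0// ltW.
  have sq : s + q - s = q by rewrite addrC addKr.
  have := incr s (s + q) s0 sq0 w lw; rewrite sq (gtr0_norm q0) => E.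
  have {}E : `|F (s + q) - F s - q * mean m (g s)| <= q * mean m w.
    apply: E => r r0 rs; apply: Hw => //; apply: le_lt_trans rs _.
    by apply: le_lt_trans qh _; rewrite ltr_pdivrMr// ltr_pMr// ltr1n.
  by apply: le_trans E _; rewrite mulrC; apply: ler_wpM2r => //; exact: ltW.
Qed.

End exchange.

(** * Construction of a solution along characteristics *)

Section geometric.
Context {R : realType}.

Lemma ler_limit_half (a b c : R) : (forall k : nat, a <= b + c * 2^-1 ^+ k) -> a <= b.
Proof.
move=> H; apply/ler_addgt0Pr => e e0.
have c1 : 0 < `|c| + 1 by rewrite ltr_wpDl.
have [k Hk] : exists k : nat, (2^-1 : R) ^+ k < e / (`|c| + 1).
  have := @cvg_expr R 2^-1 _; rewrite ger0_norm ?invr_ge0// invf_lt1 ?ltr1n// => /(_ isT).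
  move=> /cvgrPdist_lt/(_ _ (divr_gt0 e0 c1))[k _ Hk]; exists k.
  by have := Hk k (leqnn _); rewrite /= sub0r normrN ger0_norm ?exprn_ge0 ?invr_ge0.
apply: le_trans (H k) _; rewrite lerD2l.
move: Hk; rewrite ltr_pdivlMr// => Hk.
have h0 : 0 <= (2^-1 : R) ^+ k by rewrite exprn_ge0 ?invr_ge0.
have := ler_wpM2r h0 (ler_norm c); lra.
Qed.

(** A sequence with geometrically decreasing increments converges: it is
    squeezed between two monotone sequences. *)
Lemma geometric_limit (u : nat -> R) (c : R) : 0 <= c ->
  (forall k, `|u k.+1 - u k| <= c * 2^-1 ^+ k) ->
  exists l, forall k, `|l - u k| <= 2 * c * 2^-1 ^+ k.
Proof.
move=> c0 H.
pose lo k := u k - 2 * c * 2^-1 ^+ k; pose hi k := u k + 2 * c * 2^-1 ^+ k.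
have half k : 2 * c * 2^-1 ^+ k.+1 = c * 2^-1 ^+ k :> R by rewrite exprS; field.
have loS k : lo k <= lo k.+1.
  have := H k; rewrite /lo half ler_norml => /andP[h _]; rewrite -mulrA; lra.
have hiS k : hi k.+1 <= hi k.
  have := H k; rewrite /hi half ler_norml => /andP[_ h]; rewrite -mulrA; lra.
have lom k n : lo k <= lo (k + n)%N.
  by elim: n => [|n IH]; rewrite ?addn0// addnS; exact: le_trans (loS _).
have him k n : hi (k + n)%N <= hi k.
  by elim: n => [|n IH]; rewrite ?addn0// addnS; exact: le_trans (hiS _) _.
have lohi k n : lo k <= hi n.
  apply: le_trans (lom k n) _; apply: le_trans (him n k); rewrite addnC.
  have : 0 <= 2 * c * 2^-1 ^+ (n + k) by rewrite !mulr_ge0// exprn_ge0 ?invr_ge0.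
  by rewrite /lo /hi; lra.
have bd n : ubound [set lo k | k in setT] (hi n) by move=> _ [k _ <-].
exists (sup [set lo k | k in setT]) => k.
have h1 : lo k <= sup [set lo k | k in setT].
  by apply: ub_le_sup; [exists (hi 0%N)|exists k].
have h2 : sup [set lo k | k in setT] <= hi k.
  by apply: ge_sup => //; exists (lo 0%N); exists 0%N.
rewrite ler_norml; set S := sup _ in h1 h2 *; move: h1 h2; rewrite /lo /hi.
by move: S => S; lra.
Qed.

(** The next five statements isolate the arithmetic of estimates below. *)
Lemma contraction_arith (A B D l c E x m : R) :
  A <= l * D -> B <= l * (c * E * (1 + m)) -> l * D <= l * (c * E * (1 + x)) ->
  0 <= l * (c * E) * (m * x) -> 0 <= l * (c * E) * x ->
  A + B <= l * (2 + m) * (c * (1 + x)) * E.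
Proof. lra. Qed.

Lemma limit_arith (A B C D h E x : R) : A <= B + C ->
  B <= 2 * D * (2^-1 * h) * E * x -> C <= 2 * D * h / 2 * E * x ->
  A <= 0 + 2 * D * E * x * h.
Proof. lra. Qed.

Lemma weight_arith (k k1 k2 M l N C h m z : R) : 0 <= h -> k1 * M <= k / 4 ->
  k2 * (C * (1 + m)) <= k / 4 -> z <= k / 4 -> h * (l * N * M * (1 + m) + 1) <= k / 4 ->
  k1 * M + (l * N * M * h + C * k2) * (1 + m) + z <= k.
Proof. lra. Qed.

Lemma near_arith (A B k1 k2 l N C M h x z : R) :
  A <= (k1 + l * (N * (1 + x) * h)) * M -> B <= C * (1 + x) * k2 -> 0 <= z ->
  A + B <= k1 * M + (l * N * M * h + C * k2) * (1 + x) + z.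
Proof. lra. Qed.

Lemma far_arith (A B k1 k2 l N C M h x z : R) :
  A <= (k1 + l * (N * (1 + x) * h)) * M -> B <= C * (3 * z) * (2 * M) ->
  0 <= C * k2 * (1 + x) ->
  A + B <= k1 * M + (l * N * M * h + C * k2) * (1 + x) + 6 * C * M * z.
Proof. lra. Qed.

End geometric.

Section picard.
Context {R : realType} {d : nat}.
Variables (tau L : R) (rho : probability (measurableTypeR R) R).
Variable K : 'rV[R]_d -> 'rV[R]_d -> 'rV[R]_d.
Hypothesis tau0 : 0 < tau.
Hypothesis rho1 : rho `[- tau, 0]%classic = 1%E.
Hypothesis L0 : 0 < L.
Hypothesis KL : forall x x' y y',
  enorm (K x y - K x' y') <= L * (enorm (x - x') + enorm (y - y')).
Local Notation delays := [set s : R | - tau <= s <= 0].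
Local Notation times := [set s : R | - tau <= s].
Local Notation V mu t := (vfield tau rho K mu t).
Local Notation Lv := (@Lv R d L).
Implicit Types (X Y : R -> 'rV[R]_d -> 'rV[R]_d) (x y : 'rV[R]_d).

Variable mu_in : R -> P1 R d.
Hypothesis cmu_in : W1cont delays mu_in.
Variable Min : R.
Hypothesis Min_ge0 : 0 <= Min.
Hypothesis HMin : forall s, delays s -> moment1 (mu_in s) <= Min.

Let m0 := mu_in 0.
Let m1 := moment1 m0.
Let m1_ge0 : 0 <= m1 := moment1_ge0 m0.
Let Lv0 : 0 <= Lv := @Lv_ge0 R d L L0.

(** The flows below start from the identity, so that the two prescriptions agree
    at time 0 up to measure equality. *)
Definition curve X (t : R) : P1 R d := if t <= 0 then mu_in t else push (X t) m0.

(** A bound for the field along any admissible flow, relatively to the weight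
    [expR (b * t) * (1 + enorm x)]. *)
Definition speed : R := d%:R * (enorm (K 0 0) + 3 * L + L * Min + 2 * (L * m1)).

(** The first term makes the Picard operator preserve the bounds that define
    [flow], the second makes it halve weighted distances. *)
Definition growth_rate : R := d%:R * speed + 2 * (d%:R * (Lv * (2 + m1))) + 1.

Local Notation b := growth_rate.

Let speed_ge0 : 0 <= speed.
Proof.
apply: mulr_ge0 => //; have := mulr_ge0 (ltW L0) m1_ge0; have := mulr_ge0 (ltW L0) Min_ge0.
have := enorm_ge0 (K 0 0); have := ltW L0; lra.
Qed.

Let dL_ge0 : 0 <= d%:R * (Lv * (2 + m1)).
Proof. by apply: mulr_ge0 => //; apply: mulr_ge0 => //; rewrite addr_ge0. Qed.

Let b_gt0 : 0 < b.
Proof. by have := mulr_ge0 (ler0n R d) speed_ge0; have := dL_ge0; rewrite /b; lra. Qed.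

Lemma exp_ge1 (t : R) : 0 <= t -> 1 <= expR (b * t).
Proof. by move=> t0; rewrite -expR0 ler_expR mulr_ge0// ltW. Qed.

Lemma exp_mono (s t : R) : s <= t -> expR (b * s) <= expR (b * t).
Proof. by move=> st; rewrite ler_expR ler_pM2l. Qed.

(** The exponential weight makes the Picard operator a contraction on such flows
    globally in time: integrating [expR (b * u)] gains a factor [b^-1]. *)
Record flow X : Prop := Flow {
  flow0 : forall x, X 0 x = x ;
  flow_lip : forall t, 0 <= t -> lipv (expR (b * t)) (X t) ;
  flow_disp : forall t x, 0 <= t -> enorm (X t x - x) <= expR (b * t) * (1 + enorm x) ;
  flow_time : forall s t x, 0 <= s <= t ->
    enorm (X t x - X s x) <= d%:R * speed * expR (b * t) * (1 + enorm x) * (t - s) }.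

Lemma affine_lingrowth (c : R) : lingrowth (fun x : 'rV[R]_d => c * (1 + enorm x)).
Proof.
by apply: lingrowthZ; apply: lingrowthD; [exact: lingrowth_cst|exact: lingrowth_enorm].
Qed.

Lemma mean_affine (c : R) : mean m0 (fun x => c * (1 + enorm x)) = c * (1 + m1).
Proof.
have l1 := @lingrowth_enorm R d; have lc := @lingrowth_cst R d 1.
by rewrite meanZ; [rewrite meanD// mean_cst|exact: lingrowthD].
Qed.

Section one_flow.
Variable X : R -> 'rV[R]_d -> 'rV[R]_d.
Hypothesis fX : flow X.

(** At positive times this is the change of variables formula, at time 0 it
    holds because the flow starts from the identity. *)
Lemma mean_curve (t : R) (C : R) (g : 'rV[R]_d -> R) : 0 <= t -> 0 <= C -> lipf C g ->
  mean (curve X t) g = mean m0 (fun x => g (X t x)).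
Proof.
move=> t0 C0 gC; rewrite /curve; move: t0; rewrite le_eqVlt => /orP[/eqP <-|t0].
  by rewrite lexx; apply: eq_mean => x; rewrite (flow0 fX).
rewrite leNgt t0/=; have XL := flow_lip fX (ltW t0).
rewrite (mean_push m0 XL)//; first exact: lipf_continuous gC.
exact: lingrowth_lip (lipf_comp C0 gC XL).
Qed.

Lemma curve_moment (t : R) : 0 <= t -> moment1 (curve X t) <= m1 + expR (b * t) * (1 + m1).
Proof.
move=> t0; rewrite /moment1 (mean_curve t0 ler01 lipf_enorm).
have l1 := @lingrowth_enorm R d; have la := affine_lingrowth (expR (b * t)).
rewrite -mean_affine /m1 /moment1 -meanD//.
apply: le_mean.
- exact: lingrowth_lip (lipf_comp ler01 lipf_enorm (flow_lip fX t0)).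
- exact: lingrowthD.
move=> x; have := flow_disp fX x t0; have := ler_enormD x (X t x - x).
by rewrite addrC subrK; lra.
Qed.

Lemma curve_W1_time (s t : R) : 0 <= s <= t ->
  W1le (curve X t) (curve X s) (d%:R * speed * expR (b * t) * (1 + m1) * (t - s)).
Proof.
move=> /andP[s0 st] phi /lip1_lipf phi1; have t0 := le_trans s0 st.
rewrite (mean_curve s0 ler01 phi1) (mean_curve t0 ler01 phi1).
apply: le_trans (ler_norm _) _; rewrite mulrAC -mean_affine.
apply: mean_dist.
- exact: lingrowth_lip (lipf_comp ler01 phi1 (flow_lip fX t0)).
- exact: lingrowth_lip (lipf_comp ler01 phi1 (flow_lip fX s0)).
- exact: affine_lingrowth.
move=> x; apply: le_trans (phi1 _ _) _; rewrite mul1r mulrAC.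
by apply: (flow_time fX); rewrite s0.
Qed.

Lemma curve_cont : W1cont times (curve X).
Proof.
have nonneg t e : 0 <= t -> 0 < e -> exists2 h : R, 0 < h &
    forall s, 0 <= s -> `|s - t| < h -> W1le (curve X s) (curve X t) e.
  move=> t0 e0; pose c := d%:R * speed * expR (b * (t + 1)) * (1 + m1) + 1.
  have c0 : 0 < c.
    rewrite ltr_wpDl//; apply: mulr_ge0; last by rewrite addr_ge0.
    by apply: mulr_ge0; [apply: mulr_ge0|exact: expR_ge0].
  exists (Num.min 1 (e / c)); first by rewrite lt_min ltr01 divr_gt0.
  move=> s s0; rewrite lt_min ltr_pdivlMr// => /andP[s1 sc].
  have bound u v : 0 <= u <= v -> v <= t + 1 -> `|v - u| * c < e ->
      W1le (curve X v) (curve X u) e.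
    move=> /[dup] uv /andP[u0 uv'] vt uvc; apply: W1le_le (curve_W1_time uv).
    apply: le_trans (ltW uvc); rewrite ger0_norm ?subr_ge0// mulrC.
    apply: ler_wpM2l; rewrite ?subr_ge0// /c; apply: ler_wpDr => //.
    apply: ler_wpM2r; first by rewrite addr_ge0.
    by apply: ler_wpM2l; [exact: mulr_ge0|exact: exp_mono].
  have [st|/ltW ts] := leP s t.
    apply: W1le_sym; apply: bound; rewrite ?s0 ?lerDl//.
    by rewrite distrC.
  apply: bound; rewrite ?t0//.
  by have := ler_norm (s - t); move: s1; lra.
move=> t ts e e0; have [t0|t0|t0] := ltgtP t 0.
- have tD : delays t by apply/andP; split => //; exact: ltW.
  have [h h0 H] := cmu_in tD e0.
  exists (Num.min h (- t)); first by rewrite lt_min h0 oppr_gt0.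
  move=> s ss; rewrite lt_min => /andP[sh st].
  have s0 : s < 0 by have := ler_norm (s - t); lra.
  rewrite /curve (ltW s0) (ltW t0); apply: H => //.
  by apply/andP; split => //; exact: ltW.
- have [h h0 H] := nonneg t e (ltW t0) e0.
  exists (Num.min h t); first by rewrite lt_min h0.
  move=> s ss; rewrite lt_min => /andP[sh st]; apply: H => //.
  by have := ler_norm (t - s); rewrite distrC; lra.
- have tD : delays t by rewrite t0 /= lexx oppr_le0 ltW.
  have [h1 h10 H1] := cmu_in tD e0.
  have [h2 h20 H2] := nonneg t e (eq_ind_r (fun z => 0 <= z) (lexx 0) t0) e0.
  exists (Num.min h1 h2); first by rewrite lt_min h10.
  move=> s ss; rewrite lt_min => /andP[sh1 sh2].
  have [s0|/ltW s0] := leP s 0; last exact: H2.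
  rewrite /curve s0 t0 lexx; rewrite t0 in H1 sh1; apply: H1 => //.
  by apply/andP.
Qed.

Lemma curve_speed (u : R) x : 0 <= u ->
  enorm (V (curve X) u (X u x)) <= speed * expR (b * u) * (1 + enorm x).
Proof.
move=> u0; have E1 := exp_ge1 u0; set E := expR (b * u) in E1 *.
have E0 : 0 <= E by rewrite expR_ge0.
pose M := Min + m1 + E * (1 + m1).
apply: (le_trans (vfield_bound rho1 L0 KL _ (M := M) curve_cont u0 _)).
  move=> s /andP[s1 s2]; have [us|/ltW us] := leP (u + s) 0.
    apply: (@le_trans _ _ Min).
      by rewrite /curve us; apply: HMin; rewrite /= us andbT; lra.
    by rewrite /M -addrA lerDl addr_ge0// mulr_ge0// addr_ge0.
  apply: le_trans (curve_moment us) _; rewrite /M -addrA.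
  apply: (@le_trans _ _ (m1 + E * (1 + m1))); last by rewrite lerDr.
  rewrite lerD2l; apply: ler_wpM2r; first by rewrite addr_ge0.
  by apply: exp_mono; rewrite gerDl.
rewrite /speed -!mulrA; apply: ler_wpM2l => //; rewrite /M.
have z : enorm (X u x) <= enorm x + E * (1 + enorm x).
  have := flow_disp fX x u0; have := ler_enormD x (X u x - x); rewrite addrC subrK -/E.
  by lra.
have x0 := enorm_ge0 x; have k0 := enorm_ge0 (K 0 0).
have Lz := ler_wpM2l (ltW L0) z.
have Ex : 1 + enorm x <= E * (1 + enorm x) by rewrite ler_peMl// addr_ge0.
have EE : E <= E * (1 + enorm x) by rewrite ler_peMr// lerDl.
have Ex1 : 1 <= E * (1 + enorm x) by apply: le_trans EE.
have e1 : enorm (K 0 0) * 1 <= enorm (K 0 0) * (E * (1 + enorm x)) by apply: ler_wpM2l.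
have e2 : L * (1 + enorm x) <= L * (E * (1 + enorm x)) by apply: ler_wpM2l => //; exact: ltW.
have e3 : L * Min * 1 <= L * Min * (E * (1 + enorm x)).
  by apply: ler_wpM2l => //; rewrite mulr_ge0// ltW.
have e4 : L * m1 * 1 <= L * m1 * (E * (1 + enorm x)).
  by apply: ler_wpM2l => //; rewrite mulr_ge0// ltW.
have e5 : L * m1 * E <= L * m1 * (E * (1 + enorm x)).
  by apply: ler_wpM2l => //; rewrite mulr_ge0// ltW.
have e6 : L * E <= L * (E * (1 + enorm x)) by apply: ler_wpM2l => //; exact: ltW.
have LL := ltW L0.
by move: Lz e1 e2 e3 e4 e5 e6 LL; lra.
Qed.

Lemma flow_cont x (t e : R) : 0 <= t -> 0 < e -> exists2 h : R, 0 < h &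
  forall s, 0 <= s -> `|s - t| < h -> enorm (X s x - X t x) <= e.
Proof.
move=> t0 e0; pose c := d%:R * speed * expR (b * (t + 1)) * (1 + enorm x) + 1.
have c0 : 0 < c.
  rewrite ltr_wpDl//; apply: mulr_ge0; last by rewrite addr_ge0.
  by apply: mulr_ge0; [apply: mulr_ge0|exact: expR_ge0].
exists (Num.min 1 (e / c)); first by rewrite lt_min ltr01 divr_gt0.
move=> s s0; rewrite lt_min ltr_pdivlMr// => /andP[s1 sc].
have bound u v : 0 <= u <= v -> v <= t + 1 -> `|v - u| * c < e ->
    enorm (X v x - X u x) <= e.
  move=> /[dup] uv /andP[u0 uv'] vt uvc; apply: le_trans (flow_time fX x uv) _.
  apply: le_trans (ltW uvc); rewrite ger0_norm ?subr_ge0// mulrC.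
  apply: ler_wpM2l; rewrite ?subr_ge0// /c; apply: ler_wpDr => //.
  apply: ler_wpM2r; first by rewrite addr_ge0.
  by apply: ler_wpM2l; [exact: mulr_ge0|exact: exp_mono].
have [st|/ltW ts] := leP s t.
  rewrite enorm_distC; apply: bound; rewrite ?s0 ?lerDl//.
  by rewrite distrC.
apply: bound; rewrite ?t0//.
by have := ler_norm (s - t); move: s1; lra.
Qed.

Lemma drift_cont x (t e : R) : 0 <= t -> 0 < e -> exists2 h : R, 0 < h &
  forall s, 0 <= s -> `|s - t| < h ->
    enorm (V (curve X) s (X s x) - V (curve X) t (X t x)) <= e.
Proof.
move=> t0 e0; have e2 : 0 < e / 2 by rewrite divr_gt0.
have l1 : 0 < Lv + 1 by rewrite ltr_wpDl.
have [h1 h10 H1] := vfield_time_cont rho1 L0 KL curve_cont t0 e2.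
have [h2 h20 H2] := flow_cont x t0 (divr_gt0 e2 l1).
exists (Num.min h1 h2); first by rewrite lt_min h10.
move=> s s0; rewrite lt_min => /andP[st1 st2].
apply: le_trans (ler_enorm_dist _ (V (curve X) t (X s x)) _) _.
rewrite (splitr e); apply: lerD; first exact: H1.
apply: le_trans (vfield_lip rho1 L0 KL curve_cont t0 _ _) _.
apply: (@le_trans _ _ ((Lv + 1) * (e / 2 / (Lv + 1)))).
  by apply: ler_pM => //; [rewrite lerDl|exact: H2].
by rewrite mulrC divfK// gt_eqF.
Qed.

Lemma drift_coord_cont0 x i : cont0 (fun u => V (curve X) u (X u x) 0 i).
Proof.
move=> t t0 e e0; have [h h0 H] := drift_cont x t0 e0.
exists h => // s s0 st; apply: le_trans (H s s0 st).
by apply: le_trans (coord_le_enorm _ i); rewrite [X in _ <= `|X|]mxE [X in _ <= `|_ + X|]mxE.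
Qed.

End one_flow.

Definition picard X (t : R) x : 'rV[R]_d :=
  x + \row_i tint (fun u => V (curve X) u (X u x) 0 i) t.

Lemma tint_weight (q t : R) : 0 <= t ->
  tint (fun u => q * expR (b * u)) t = q / b * (expR (b * t) - 1).
Proof.
move=> t0; have cE := @cont0_expR R b.
have := tint_expR b_gt0 t0; rewrite !tintZ// => <-.
by rewrite mulrA divfK// gt_eqF.
Qed.

Lemma row_tint_dist (f g : 'I_d -> R -> R) (q t : R) : 0 <= t ->
  (forall i, cont0 (f i)) -> (forall i, cont0 (g i)) ->
  (forall i u, 0 <= u <= t -> `|f i u - g i u| <= q * expR (b * u)) ->
  enorm (\row_i tint (f i) t - \row_i tint (g i) t) <= d%:R * (q / b * (expR (b * t) - 1)).
Proof.
move=> t0 cf cg H; apply: enorm_le_coord => i; rewrite !mxE -tintB// -tint_weight//.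
apply: le_norm_tint.
- move=> s s0 e e0; have e2 : 0 < e / 2 by rewrite divr_gt0.
  have [h1 h10 H1] := cf i s s0 _ e2; have [h2 h20 H2] := cg i s s0 _ e2.
  exists (Num.min h1 h2); first by rewrite lt_min h10.
  move=> r r0; rewrite lt_min => /andP[r1 r2].
  by have := H1 r r0 r1; have := H2 r r0 r2; rewrite !ler_norml; lra.
- move=> s s0 e e0; have q1 : 0 < `|q| + 1 by rewrite ltr_wpDl.
  have [h h0 Hh] := @cont0_expR R b s s0 _ (divr_gt0 e0 q1).
  exists h => // r r0 rs; rewrite -mulrBr normrM.
  apply: (@le_trans _ _ ((`|q| + 1) * (e / (`|q| + 1)))).
    by apply: ler_pM => //; [rewrite lerDl|exact: Hh].
  by rewrite mulrC divfK// gt_eqF.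
- by move=> u; exact: H.
Qed.

Lemma picard_dist X Y (q t : R) x y : flow X -> flow Y -> 0 <= t ->
  (forall u, 0 <= u <= t ->
    enorm (V (curve X) u (X u x) - V (curve Y) u (Y u y)) <= q * expR (b * u)) ->
  enorm (picard X t x - picard Y t y) <=
  enorm (x - y) + d%:R * (q / b * (expR (b * t) - 1)).
Proof.
move=> fX fY t0 H; rewrite /picard opprD addrACA.
apply: le_trans (ler_enormD _ _) _; rewrite lerD2l; apply: row_tint_dist => //.
- by move=> i; exact: drift_coord_cont0.
- by move=> i; exact: drift_coord_cont0.
move=> i u ut; apply: le_trans (H u ut); apply: le_trans (coord_le_enorm _ i).
by rewrite [X in _ <= `|X|]mxE [X in _ <= `|_ + X|]mxE.
Qed.

Lemma weight_le (q : R) : d%:R * q <= b -> forall t, 0 <= t ->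
  d%:R * (q / b * (expR (b * t) - 1)) <= expR (b * t) - 1.
Proof.
move=> qb t t0; rewrite mulrA mulrA -[leRHS]mul1r; apply: ler_wpM2r.
  by rewrite subr_ge0 exp_ge1.
by rewrite ler_pdivrMr// mul1r.
Qed.

Lemma picard_flow X : flow X -> flow (picard X).
Proof.
move=> fX; split.
- move=> x; rewrite /picard (_ : \row_i _ = 0) ?addr0//.
  by apply/rowP => i; rewrite !mxE tint0.
- move=> t t0 x x'.
  have step u : 0 <= u <= t ->
      enorm (V (curve X) u (X u x) - V (curve X) u (X u x')) <= (Lv * enorm (x - x')) * expR (b * u).
    move=> /andP[u0 _]; apply: le_trans (vfield_lip rho1 L0 KL (curve_cont fX) u0 _ _) _.
    rewrite -mulrA; apply: ler_wpM2l => //; rewrite mulrC; exact: (flow_lip fX).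
  apply: le_trans (picard_dist fX fX t0 step) _.
  have dLb : d%:R * Lv <= b.
    have := mulr_ge0 (ler0n R d) speed_ge0; have := mulr_ge0 (ler0n R d) Lv0.
    have := mulr_ge0 (mulr_ge0 (ler0n R d) Lv0) m1_ge0; rewrite /b; lra.
  have := ler_wpM2r (enorm_ge0 (x - x')) (weight_le dLb t0); lra.
- move=> t x t0.
  have c0 (i : 'I_d) : cont0 (fun _ : R => 0 : R).
    by move=> s s0 e e0; exists 1 => // r _ _; rewrite subrr normr0 ltW.
  rewrite /picard (addrC x) addrK.
  have -> : \row_i tint (fun u => V (curve X) u (X u x) 0 i) t =
     \row_i tint (fun u => V (curve X) u (X u x) 0 i) t -
     \row_(i < d) tint (fun _ : R => 0 : R) t :> 'rV[R]_d.
    rewrite [X in _ = _ - X](_ : _ = 0) ?subr0//.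
    by apply/rowP => i; rewrite !mxE /tint Rintegral_cst// mul0r.
  have step i u : 0 <= u <= t ->
      `|V (curve X) u (X u x) 0 i - 0| <= (speed * (1 + enorm x)) * expR (b * u).
    move=> /andP[u0 _]; rewrite subr0; apply: le_trans (coord_le_enorm _ _) _.
    by apply: le_trans (curve_speed fX x u0) _; rewrite mulrAC.
  apply: le_trans (row_tint_dist t0 (fun i => drift_coord_cont0 fX x i) c0 step) _.
  have dsb : d%:R * speed <= b by have := dL_ge0; rewrite /b; lra.
  have x0 : 0 <= 1 + enorm x by rewrite addr_ge0.
  have := ler_wpM2r x0 (weight_le dsb t0); lra.
move=> s t x /andP[s0 st]; have t0 := le_trans s0 st.
rewrite /picard opprD addrACA subrr add0r.
have assoc (p q r u v : R) : p * q * r * u * v = p * (q * r * u * v) by ring.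
rewrite assoc; apply: enorm_le_coord => i; rewrite !mxE.
have := @tint_increment R (fun u => V (curve X) u (X u x) 0 i) s t 0
  (speed * expR (b * t) * (1 + enorm x)) (drift_coord_cont0 fX x i).
rewrite s0 st mul0r subr0 => /(_ isT); apply => u /andP[su ut].
rewrite subr0; apply: le_trans (coord_le_enorm _ _) _.
apply: le_trans (curve_speed fX x (le_trans s0 su)) _.
apply: ler_wpM2r; first by rewrite addr_ge0.
by apply: ler_wpM2l => //; exact: exp_mono.
Qed.

Lemma picard_contraction X Y (c : R) : flow X -> flow Y -> 0 <= c ->
  (forall t x, 0 <= t -> enorm (X t x - Y t x) <= c * expR (b * t) * (1 + enorm x)) ->
  forall t x, 0 <= t ->
    enorm (picard X t x - picard Y t x) <= c / 2 * expR (b * t) * (1 + enorm x).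
Proof.
move=> fX fY c0 H t x t0.
have W u : 0 <= u -> W1le (curve X u) (curve Y u) (c * expR (b * u) * (1 + m1)).
  move=> u0 phi /lip1_lipf phi1.
  rewrite (mean_curve fX u0 ler01 phi1) (mean_curve fY u0 ler01 phi1).
  apply: le_trans (ler_norm _) _; rewrite -mean_affine; apply: mean_dist.
  - exact: lingrowth_lip (lipf_comp ler01 phi1 (flow_lip fX u0)).
  - exact: lingrowth_lip (lipf_comp ler01 phi1 (flow_lip fY u0)).
  - exact: affine_lingrowth.
  by move=> y; apply: le_trans (phi1 _ _) _; rewrite mul1r; exact: H.
have x1 : 0 <= 1 + enorm x by rewrite addr_ge0.
have m1' : 0 <= 1 + m1 by rewrite addr_ge0.
have step u : 0 <= u <= t -> enorm (V (curve X) u (X u x) - V (curve Y) u (Y u x)) <=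
    (Lv * (2 + m1) * (c * (1 + enorm x))) * expR (b * u).
  move=> /andP[u0 _].
  apply: le_trans (ler_enorm_dist _ (V (curve X) u (Y u x)) _) _.
  have s1 := vfield_lip rho1 L0 KL (curve_cont fX) u0 (X u x) (Y u x).
  have s2 : enorm (V (curve X) u (Y u x) - V (curve Y) u (Y u x)) <=
      Lv * (c * expR (b * u) * (1 + m1)).
    apply: (vfield_dist rho1 L0 KL _ (curve_cont fX) (curve_cont fY)) => // s /andP[s1' s2].
    have [us|/ltW us] := leP (u + s) 0.
      apply: (@W1le_le _ _ _ _ 0).
        by apply: mulr_ge0 => //; apply: mulr_ge0 => //; exact: expR_ge0.
      by rewrite /curve us; apply: W1le_measure_eq.
    apply: W1le_le (W _ us); apply: ler_wpM2r => //; apply: ler_wpM2l => //.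
    by apply: exp_mono; rewrite gerDl.
  have s3 := ler_wpM2l Lv0 (H u x u0).
  have E0 := expR_ge0 (b * u).
  have s4 : 0 <= Lv * (c * expR (b * u)) * (m1 * enorm x).
    by apply: mulr_ge0; apply: mulr_ge0 => //; exact: mulr_ge0.
  have s5 : 0 <= Lv * (c * expR (b * u)) * enorm x.
    by apply: mulr_ge0 => //; apply: mulr_ge0 => //; exact: mulr_ge0.
  exact: (contraction_arith s1 s2 s3 s4 s5).
apply: le_trans (picard_dist fX fY t0 step) _; rewrite subrr enorm0 add0r.
have q2 : d%:R * (2 * (Lv * (2 + m1))) <= b.
  by have := mulr_ge0 (ler0n R d) speed_ge0; rewrite /b; lra.
have := weight_le q2 t0; have E0 := expR_ge0 (b * t) => w.
have w' : d%:R * (Lv * (2 + m1) / b * (expR (b * t) - 1)) <= 2^-1 * expR (b * t) by lra.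
have := ler_wpM2r (mulr_ge0 c0 x1) w'; lra.
Qed.

Definition approx (k : nat) : R -> 'rV[R]_d -> 'rV[R]_d :=
  iter k picard (fun _ x => x).

Lemma approx_flow k : flow (approx k).
Proof.
elim: k => [|k IH] /=; last exact: picard_flow.
split => //.
- move=> t t0 x y /=; rewrite ler_peMl//; exact: exp_ge1.
- by move=> t x t0; rewrite subrr enorm0 mulr_ge0 ?expR_ge0 ?addr_ge0.
- move=> s t x /andP[s0 st]; rewrite subrr enorm0.
  apply: mulr_ge0; last by rewrite subr_ge0.
  apply: mulr_ge0; last by rewrite addr_ge0.
  by apply: mulr_ge0; [exact: mulr_ge0|exact: expR_ge0].
Qed.

Lemma approx_step k t x : 0 <= t ->
  enorm (approx k.+1 t x - approx k t x) <= 2^-1 ^+ k * expR (b * t) * (1 + enorm x).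
Proof.
elim: k t x => [|k IH] t x t0.
  rewrite expr0 mul1r; exact: (flow_disp (approx_flow 1)).
have h0 : 0 <= (2^-1 : R) ^+ k by rewrite exprn_ge0 ?invr_ge0.
rewrite exprSr.
exact: (picard_contraction (approx_flow k.+1) (approx_flow k) h0 IH).
Qed.

Lemma approx_limit : exists X : R -> 'rV[R]_d -> 'rV[R]_d, forall k t x, 0 <= t ->
  enorm (X t x - approx k t x) <= 2 * d%:R * 2^-1 ^+ k * expR (b * t) * (1 + enorm x).
Proof.
have H t x i : exists l : R, 0 <= t -> forall k,
    `|l - approx k t x 0 i| <= 2 * (expR (b * t) * (1 + enorm x)) * 2^-1 ^+ k.
  have [t0|t0] := leP 0 t; last by exists 0.
  have [||l Hl] := @geometric_limit R (fun k => approx k t x 0 i) (expR (b * t) * (1 + enorm x)).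
  - by rewrite mulr_ge0 ?expR_ge0 ?addr_ge0.
  - move=> k; rewrite mulrC mulrA; apply: le_trans (approx_step k x t0).
    by apply: le_trans (coord_le_enorm _ i); rewrite [X in _ <= `|X|]mxE [X in _ <= `|_ + X|]mxE.
  by exists l.
exists (fun t x => \row_i projT1 (cid (H t x i))) => k t x t0.
rewrite (_ : 2 * _ * _ * _ * _ = d%:R * (2 * (expR (b * t) * (1 + enorm x)) * 2^-1 ^+ k)); last by ring.
apply: enorm_le_coord => i; rewrite !mxE; case: cid => l /= Hl; exact: Hl.
Qed.

(** All the bounds are closed conditions, and hold for every iterate. *)
Lemma limit_flow X : (forall k t x, 0 <= t ->
    enorm (X t x - approx k t x) <= 2 * d%:R * 2^-1 ^+ k * expR (b * t) * (1 + enorm x)) ->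
  flow X.
Proof.
move=> HX; split.
- move=> x; apply/eqP; rewrite -subr_eq0; apply/eqP/rowP => i; rewrite [RHS]mxE; apply/eqP.
  rewrite -normr_le0; apply: le_trans (coord_le_enorm _ _) _.
  apply: (@ler_limit_half _ _ _ (2 * d%:R * expR (b * 0) * (1 + enorm x))) => k.
  have := HX k 0 x (lexx 0); rewrite (flow0 (approx_flow k)) => /le_trans; apply.
  by rewrite le_eqVlt; apply/orP; left; apply/eqP; ring.
- move=> t t0 x y.
  apply: (@ler_limit_half _ _ _ (2 * d%:R * expR (b * t) * (1 + enorm x) +
    2 * d%:R * expR (b * t) * (1 + enorm y))) => k.
  have := ler_enorm_dist (X t x) (approx k t x) (X t y).
  have := ler_enorm_dist (approx k t x) (approx k t y) (X t y).
  rewrite (enorm_distC (approx k t y)).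
  have := HX k t x t0; have := HX k t y t0; have := flow_lip (approx_flow k) t0 x y.
  lra.
- move=> t x t0.
  apply: (@ler_limit_half _ _ _ (2 * d%:R * expR (b * t) * (1 + enorm x))) => k.
  have := ler_enorm_dist (X t x) (approx k t x) x.
  have := HX k t x t0; have := flow_disp (approx_flow k) x t0.
  lra.
move=> s t x st; have /andP[s0 s1] := st; have t0 := le_trans s0 s1.
apply: (@ler_limit_half _ _ _ (2 * d%:R * expR (b * t) * (1 + enorm x) +
  2 * d%:R * expR (b * s) * (1 + enorm x))) => k.
have := ler_enorm_dist (X t x) (approx k t x) (X s x).
have := ler_enorm_dist (approx k t x) (approx k s x) (X s x).
rewrite (enorm_distC (approx k s x)).
have := HX k t x t0; have := HX k s x s0; have := flow_time (approx_flow k) x st.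
lra.
Qed.

(** The limit of the Picard iterates is a fixed point: both iterates and images
    under the operator are within [O(2 ^- k)] of the limit. *)
Lemma characteristics : exists X, flow X /\
  forall t x i, 0 <= t -> X t x 0 i = x 0 i + tint (fun u => V (curve X) u (X u x) 0 i) t.
Proof.
have [X HX] := approx_limit; have fX := limit_flow HX.
exists X; split=> // t x i t0.
suff E : X t x = picard X t x by rewrite [in LHS]E !mxE.
apply/eqP; rewrite -subr_eq0; apply/eqP/rowP => j; rewrite [RHS]mxE; apply/eqP.
rewrite -normr_le0; apply: le_trans (coord_le_enorm _ _) _.
apply: (@ler_limit_half _ _ _ (2 * d%:R * expR (b * t) * (1 + enorm x))) => k.
have c0 : 0 <= 2 * d%:R * (2^-1 : R) ^+ k by rewrite !mulr_ge0// exprn_ge0 ?invr_ge0.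
have H1 := HX k.+1 t x t0; rewrite exprS in H1.
have H2 : enorm (approx k.+1 t x - picard X t x) <=
    2 * d%:R * 2^-1 ^+ k / 2 * expR (b * t) * (1 + enorm x).
  rewrite (enorm_distC (approx k.+1 t x)).
  exact: (picard_contraction fX (approx_flow k) c0 (HX k) x t0).
exact: (limit_arith (ler_enorm_dist (X t x) (approx k.+1 t x) (picard X t x)) H1 H2).
Qed.

Section weak_solution.
Variable X : R -> 'rV[R]_d -> 'rV[R]_d.
Hypothesis fX : flow X.
Hypothesis HX : forall t x i, 0 <= t ->
  X t x 0 i = x 0 i + tint (fun u => V (curve X) u (X u x) 0 i) t.
Local Notation W u x := (V (curve X) u (X u x)).

Lemma flow_near (t s : R) x : 0 <= t -> 0 <= s -> `|s - t| <= 1 ->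
  enorm (X s x - X t x) <= d%:R * speed * expR (b * (t + 1)) * (1 + enorm x) * `|s - t|.
Proof.
move=> t0 s0 st1.
have c0 (u : R) : 0 <= u -> u <= t + 1 -> forall v : R, 0 <= v ->
    d%:R * speed * expR (b * u) * (1 + enorm x) * v <=
    d%:R * speed * expR (b * (t + 1)) * (1 + enorm x) * v.
  move=> u0 ut v v0; apply: ler_wpM2r => //; apply: ler_wpM2r; first by rewrite addr_ge0.
  by apply: ler_wpM2l; [exact: mulr_ge0|exact: exp_mono].
have [st|/ltW ts] := leP s t.
  have sI : 0 <= s <= t by rewrite s0.
  rewrite enorm_distC (distrC s) (ger0_norm (x := t - s)) ?subr_ge0//.
  apply: le_trans (flow_time fX x sI) _; apply: c0 => //; rewrite ?subr_ge0//.
  by rewrite lerDl.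
have sI : 0 <= t <= s by rewrite t0.
have st : s <= t + 1 by have := ler_norm (s - t); lra.
rewrite (ger0_norm (x := s - t)) ?subr_ge0//.
by apply: le_trans (flow_time fX x sI) _; apply: c0 => //; rewrite ?subr_ge0.
Qed.

Lemma flow_increment (t h k : R) x : 0 <= t -> 0 < h ->
  (forall u, t <= u <= t + h -> enorm (W u x - W t x) <= k) ->
  enorm (X (t + h) x - X t x - h *: W t x) <= d%:R * (k * h).
Proof.
move=> t0 h0 H; have th0 : 0 <= t + h by rewrite addr_ge0// ltW.
apply: enorm_le_coord => i.
have -> : (X (t + h) x - X t x - h *: W t x) 0 i =
    X (t + h) x 0 i - X t x 0 i - h * W t x 0 i.
  rewrite [LHS]mxE [X in X + _]mxE; congr (_ + _ + _); rewrite [LHS]mxE//.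
  by rewrite [X in - X]mxE.
rewrite !HX//.
have := @tint_increment R (fun u => W u x 0 i) t (t + h) (W t x 0 i) k (drift_coord_cont0 fX x i).
have th : t + h - t = h by rewrite addrC addKr.
rewrite t0 lerDl (ltW h0) th => /(_ isT) E.
rewrite (_ : _ - _ - _ = tint (fun u => W u x 0 i) (t + h) - tint (fun u => W u x 0 i) t - W t x 0 i * h).
  apply: E => u ut; apply: le_trans (H u ut); apply: le_trans (coord_le_enorm _ i).
  by rewrite [X in _ <= `|X|]mxE [X in _ <= `|_ + X|]mxE.
by ring.
Qed.

Section test_function.
Variable phi : 'rV[R]_d -> R.
Hypothesis phiC1 : C1c phi.
Local Notation G := (gradient phi).
Local Notation g := (fun u x => dotv (W u x) (G (X u x))).

Let cphi : continuous phi.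
Proof. by move=> x; apply: differentiable_continuous; case: phiC1. Qed.

Let cG : continuous G.
Proof. by case: phiC1. Qed.

Lemma gradient_bounded : exists2 M : R, 0 <= M & forall x, enorm (G x) <= M.
Proof.
have [r [_ G0]] := C1c_vanishing phiC1.
have [||M M0 HM] := @continuous_vanishing_bounded R d (fun x => enorm (G x)) r.
- move=> x; apply: (@continuous_comp _ _ _ G (@enorm R d)); first exact: cG.
  exact: enorm_continuous.
- by move=> x /G0 ->; rewrite enorm0.
by exists M => // x; have := HM x; rewrite ger0_norm.
Qed.

Lemma phi_bounded : exists2 M : R, 0 <= M & forall x, `|phi x| <= M.
Proof.
have [r [phi0 _]] := C1c_vanishing phiC1.
exact: continuous_vanishing_bounded cphi phi0.
Qed.

Lemma pairing_dist (M : R) (v w y z : 'rV[R]_d) : (forall x, enorm (G x) <= M) ->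
  `|dotv v (G y) - dotv w (G z)| <= enorm (v - w) * M + enorm w * enorm (G y - G z).
Proof.
move=> HM; rewrite (_ : _ - _ = dotv (v - w) (G y) + dotv w (G y - G z)); last first.
  by rewrite dotvDl dotvDr dotvNl dotvNr; ring.
apply: le_trans (ler_normD _ _) _; apply: lerD.
  by apply: le_trans (cauchy_schwarz _ _) _; apply: ler_wpM2l.
exact: cauchy_schwarz.
Qed.

Lemma pairing_cont0 x : cont0 (fun u => dotv (W u x) (G (X u x))).
Proof.
have [M M0 HM] := gradient_bounded.
move=> t t0 e e0; have e2 : 0 < e / 2 by rewrite divr_gt0.
have M1 : 0 < M + 1 by rewrite ltr_wpDl.
have w1 : 0 < enorm (W t x) + 1 by rewrite ltr_wpDl.
have [h1 h10 H1] := drift_cont fX x t0 (divr_gt0 e2 M1).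
have [h2 h20 H2] := continuous_enorm (X t x) cG (divr_gt0 e2 w1).
have [h3 h30 H3] := flow_cont fX x t0 (divr_gt0 h20 (ltr0Sn R 1)).
exists (Num.min h1 h3); first by rewrite lt_min h10.
move=> s s0; rewrite lt_min => /andP[s1 s3].
apply: le_trans (pairing_dist _ _ _ _ HM) _; rewrite (splitr e); apply: lerD.
  apply: (@le_trans _ _ (e / 2 / (M + 1) * (M + 1))); last by rewrite divfK// gt_eqF.
  by apply: ler_pM => //; [exact: H1|rewrite lerDl].
apply: (@le_trans _ _ ((enorm (W t x) + 1) * (e / 2 / (enorm (W t x) + 1)))).
  apply: ler_pM => //; first by rewrite lerDl.
  rewrite enorm_distC; apply: H2; rewrite enorm_distC.
  apply: le_lt_trans (H3 s s0 s3) _.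
  by rewrite ltr_pdivrMr// ltr_pMr// ltr1n.
by rewrite mulrC divfK// gt_eqF.
Qed.

(** Chain rule along a trajectory, whose right derivative is the field. *)
Lemma phi_along_flow (t : R) x : 0 <= t ->
  phi (X t x) = phi x + tint (fun u => dotv (W u x) (G (X u x))) t.
Proof.
move=> t0; have [M M0 HM] := gradient_bounded.
have -> : phi x = phi (X 0 x) by rewrite (flow0 fX).
move: t t0.
apply: (@tint_right_derivative R (fun t => phi (X t x))); last first.
- move=> t t0 k k0; have k2 : 0 < k / 2 by rewrite divr_gt0.
  pose N := d%:R * speed * expR (b * (t + 1)) * (1 + enorm x).
  have N0 : 0 <= N.
    apply: mulr_ge0; last by rewrite addr_ge0.
    by apply: mulr_ge0; [exact: mulr_ge0|exact: expR_ge0].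
  have N1 : 0 < N + 1 by rewrite ltr_wpDl.
  have dM1 : 0 < d%:R * M + 1 by rewrite ltr_wpDl// mulr_ge0.
  have dphi : differentiable phi (X t x) by case: phiC1.
  have [h1 h10 H1] := differentiable_expansion dphi (divr_gt0 k2 N1).
  have [h2 h20 H2] := drift_cont fX x t0 (divr_gt0 k2 dM1).
  exists (Num.min 1 (Num.min (h1 / 2 / (N + 1)) (h2 / 2))).
    by rewrite !lt_min ltr01 !divr_gt0.
  move=> h /andP[h0]; rewrite !le_min ler_pdivlMr// => /and3P[hl1 hh1 hh2].
  have th0 : 0 <= t + h by rewrite addr_ge0// ltW.
  have thE : t + h - t = h by rewrite addrC addKr.
  pose z := X (t + h) x - X t x.
  have zN : enorm z <= N * h.
    have := flow_near x t0 th0; rewrite thE (gtr0_norm h0) => /(_ hl1).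
    by rewrite -/N.
  have zh : enorm z < h1.
    apply: le_lt_trans zN _; apply: (@le_lt_trans _ _ (h * (N + 1))).
      by rewrite mulrC; apply: ler_wpM2l; [exact: ltW|rewrite lerDl].
    by apply: le_lt_trans hh1 _; rewrite ltr_pdivrMr// ltr_pMr// ltr1n.
  have E1 := H1 z zh; have zE : X t x + z = X (t + h) x by rewrite /z addrC subrK.
  rewrite zE in E1.
  have E2 : enorm (z - h *: W t x) <= d%:R * (k / 2 / (d%:R * M + 1) * h).
    apply: flow_increment => // u /andP[tu uth]; apply: H2; first exact: le_trans tu.
    rewrite ger0_norm ?subr_ge0//; apply: (@le_lt_trans _ _ h); first by rewrite lerBlDl.
    by apply: le_lt_trans hh2 _; rewrite ltr_pdivrMr// ltr_pMr// ltr1n.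
  rewrite -dotvZl (_ : _ - _ - _ = (phi (X (t + h) x) - phi (X t x) - dotv z (G (X t x))) +
    dotv (z - h *: W t x) (G (X t x))); last by rewrite (dotvDl z) dotvNl; ring.
  apply: le_trans (ler_normD _ _) _.
  rewrite (_ : k * h = k / 2 * h + k / 2 * h); last by rewrite -mulrDl -splitr.
  apply: lerD.
    apply: le_trans E1 _; apply: (@le_trans _ _ (k / 2 / (N + 1) * (N * h))).
      by apply: ler_wpM2l => //; exact: divr_ge0 (ltW k2) (ltW N1).
    rewrite mulrA; apply: ler_wpM2r; first exact: ltW.
    rewrite -[leRHS](divfK (lt0r_neq0 N1)); apply: ler_wpM2l; last by rewrite lerDl.
    exact: divr_ge0 (ltW k2) (ltW N1).
  apply: le_trans (cauchy_schwarz _ _) _.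
  apply: (@le_trans _ _ (d%:R * (k / 2 / (d%:R * M + 1) * h) * M)); first by apply: ler_pM.
  rewrite (_ : d%:R * _ * M = (k / 2 / (d%:R * M + 1)) * (d%:R * M) * h); last by ring.
  apply: ler_wpM2r; first exact: ltW.
  rewrite -[leRHS](divfK (lt0r_neq0 dM1)); apply: ler_wpM2l; last by rewrite lerDl.
  exact: divr_ge0 (ltW k2) (ltW dM1).
- exact: pairing_cont0.
move=> t t0 e e0.
have /(@cvgrPdist_lt _ _ _ (nbhs (X t x)) _ phi (phi (X t x)))/(_ e e0) := @cphi (X t x).
move=> /nbhs_enormP[h h0 H].
have [h1 h10 H1] := flow_cont fX x t0 (divr_gt0 h0 (ltr0Sn R 1)).
exists h1 => // s s0 st; rewrite distrC; apply: ltW; apply: H.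
rewrite enorm_distC; apply: le_lt_trans (H1 s s0 st) _.
by rewrite ltr_pdivrMr// ltr_pMr// ltr1n.
Qed.

Lemma dotv_continuous (f1 f2 : 'rV[R]_d -> 'rV[R]_d) : continuous f1 -> continuous f2 ->
  continuous (fun x => dotv (f1 x) (f2 x)).
Proof.
move=> c1 c2; rewrite /dotv; elim: (index_enum 'I_d) => [|i l IH].
  under eq_fun do rewrite big_nil; exact: cst_continuous.
under eq_fun do rewrite big_cons.
have cc (f : 'rV[R]_d -> 'rV[R]_d) : continuous f -> continuous (fun y => f y 0 i).
  move=> cf x; apply: (@continuous_comp _ _ _ f (fun M : 'rV[R]_d => M 0 i)).
    exact: cf.
  exact: coord_continuous.
by move=> x; exact: cvgD (cvgM (cc _ c1 x) (cc _ c2 x)) (IH x).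
Qed.

Lemma pairing_lingrowth (u : R) : 0 <= u -> lingrowth (fun x => dotv (W u x) (G (X u x))).
Proof.
move=> u0; have [M M0 HM] := gradient_bounded.
have cX := lipv_continuous (flow_lip fX u0).
split.
  have cV := lipv_continuous (vfield_lip rho1 L0 KL (curve_cont fX) u0).
  move=> x; apply: (@continuous_comp _ _ _ (X u) (fun y => dotv (V (curve X) u y) (G y))).
    exact: cX.
  exact: dotv_continuous.
exists (speed * expR (b * u) * M) => x; apply: le_trans (cauchy_schwarz _ _) _.
rewrite mulrAC; apply: ler_pM => //; exact: curve_speed.
Qed.

Lemma phi_flow_lingrowth (u : R) : 0 <= u -> lingrowth (fun x => phi (X u x)).
Proof.
move=> u0; have [M M0 HM] := phi_bounded; split.
  move=> x; apply: (@continuous_comp _ _ _ (X u) phi); last exact: cphi.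
  exact: lipv_continuous (flow_lip fX u0) x.
by exists M => x; apply: le_trans (HM _) _; rewrite ler_peMr// lerDl.
Qed.

Lemma mean_curve_cont (t : R) (f : 'rV[R]_d -> R) : 0 <= t -> continuous f ->
  lingrowth (fun x => f (X t x)) -> mean (curve X t) f = mean m0 (fun x => f (X t x)).
Proof.
move=> t0 cf lf; rewrite /curve; move: t0 lf; rewrite le_eqVlt => /orP[/eqP <-|t0] lf.
  by rewrite lexx; apply: eq_mean => x; rewrite (flow0 fX).
by rewrite leNgt t0/= (mean_push m0 (flow_lip fX (ltW t0))).
Qed.

(** Equicontinuity in time of the integrand, in the mean: on bounded sets by
    uniform continuity of the gradient, far away by the small excess. *)
Lemma pairing_mean_cont (t k : R) : 0 <= t -> 0 < k -> exists h w,
  [/\ 0 < h, lingrowth w, mean m0 w <= k &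
    forall s, 0 <= s -> `|s - t| < h -> forall x,
      `|dotv (W s x) (G (X s x)) - dotv (W t x) (G (X t x))| <= w x].
Proof.
move=> t0 k0; have [M M0 HM] := gradient_bounded.
have [r [_ G0]] := C1c_vanishing phiC1.
pose C := speed * expR (b * t); pose N := d%:R * speed * expR (b * (t + 1)).
have C0 : 0 <= C by apply: mulr_ge0 => //; exact: expR_ge0.
have N0 : 0 <= N by apply: mulr_ge0; [exact: mulr_ge0|exact: expR_ge0].
have m1' : 0 <= 1 + m1 by rewrite addr_ge0.
have k4 : 0 < k / 4 by rewrite divr_gt0.
have M1 : 0 < M + 1 by rewrite ltr_wpDl.
have Cm1 : 0 < C * (1 + m1) + 1 by rewrite ltr_wpDl// mulr_ge0.
have CM1 : 0 < 6 * C * M + 1 by rewrite ltr_wpDl//; apply: mulr_ge0 => //; exact: mulr_ge0.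
pose k1 := k / 4 / (M + 1); pose k2 := k / 4 / (C * (1 + m1) + 1).
have k10 : 0 < k1 by exact: divr_gt0.
have k20 : 0 < k2 by exact: divr_gt0.
have [e e0 He] := continuous_vanishing_uniform cG G0 k20.
have [A0 A01 HA] := mean_excess_small m0 (divr_gt0 k4 CM1).
pose A := 2 * A0.
have A2 : 2 <= A by rewrite /A; lra.
have hA : mean m0 (excess (A / 2)) <= k / 4 / (6 * C * M + 1).
  by apply: HA; rewrite /A; lra.
have NA1 : 0 < N * (1 + A) + 1 by rewrite ltr_wpDl// mulr_ge0//; lra.
have LM0 : 0 <= Lv * N * M * (1 + m1).
  by apply: mulr_ge0 => //; apply: mulr_ge0 => //; exact: mulr_ge0.
have LM1 : 0 < Lv * N * M * (1 + m1) + 1 by rewrite ltr_wpDl.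
have [h1 h10 H1] := vfield_time_cont rho1 L0 KL (curve_cont fX) t0 k10.
pose h := Num.min 1 (Num.min h1 (Num.min (e / (N * (1 + A) + 1)) (k / 4 / (Lv * N * M * (1 + m1) + 1)))).
have h0 : 0 < h by rewrite !lt_min ltr01 h10 !divr_gt0.
have hl1 : h <= 1 by rewrite /h ge_min lexx.
have hl2 : h <= h1 by rewrite /h !ge_min lexx !orbT.
have hl3 : h * (N * (1 + A) + 1) <= e by rewrite -ler_pdivlMr// /h !ge_min lexx !orbT.
have hl4 : h * (Lv * N * M * (1 + m1) + 1) <= k / 4.
  by rewrite -ler_pdivlMr// /h !ge_min lexx !orbT.
pose w x := (k1 * M + (Lv * N * M * h + C * k2) * (1 + enorm x)) + 6 * C * M * excess (A / 2) x.
have lexc : lingrowth (@excess R d (A / 2)) := lingrowth_lip (lipf_excess _).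
have l1 : lingrowth (fun x : 'rV[R]_d => k1 * M + (Lv * N * M * h + C * k2) * (1 + enorm x)).
  by apply: lingrowthD; [exact: lingrowth_cst|exact: affine_lingrowth].
have l2 : lingrowth (fun x : 'rV[R]_d => 6 * C * M * excess (A / 2) x) by exact: lingrowthZ.
exists h, w; split => //; first exact: lingrowthD.
  have E : mean m0 w = k1 * M + (Lv * N * M * h + C * k2) * (1 + m1) +
      6 * C * M * mean m0 (excess (A / 2)).
    rewrite (meanD m0 l1 l2) (meanZ m0 _ lexc); congr (_ + _).
    by rewrite (meanD m0 (lingrowth_cst _) (affine_lingrowth _)) mean_cst mean_affine.
  rewrite E.
  have a1 : k1 * M <= k / 4.
    rewrite -[leRHS](divfK (lt0r_neq0 M1)); apply: ler_wpM2l; last by rewrite lerDl.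
    exact: ltW.
  have a2 : k2 * (C * (1 + m1)) <= k / 4.
    rewrite -[leRHS](divfK (lt0r_neq0 Cm1)); apply: ler_wpM2l; last by rewrite lerDl.
    exact: ltW.
  have a3 : 6 * C * M * mean m0 (excess (A / 2)) <= k / 4.
    apply: (@le_trans _ _ ((6 * C * M + 1) * (k / 4 / (6 * C * M + 1)))).
      apply: ler_pM => //; last by rewrite lerDl.
        by apply: mulr_ge0 => //; exact: mulr_ge0.
      by apply: Rintegral_ge0 => x _; exact: excess_ge0.
    by rewrite mulrC divfK// gt_eqF.
  exact: (weight_arith (ltW h0) a1 a2 a3 hl4).
move=> s s0 st x; have st1 : `|s - t| <= 1 := le_trans (ltW st) hl1.
have x1 : 0 <= 1 + enorm x by rewrite addr_ge0.
have Xst : enorm (X s x - X t x) <= N * (1 + enorm x) * h.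
  apply: le_trans (flow_near x t0 s0 st1) _; apply: ler_wpM2l; last exact: ltW.
  exact: mulr_ge0.
have Wst : enorm (W s x - W t x) <= k1 + Lv * (N * (1 + enorm x) * h).
  apply: le_trans (ler_enorm_dist _ (V (curve X) t (X s x)) _) _; apply: lerD.
    by apply: H1 => //; exact: lt_le_trans hl2.
  apply: le_trans (vfield_lip rho1 L0 KL (curve_cont fX) t0 _ _) _.
  exact: ler_wpM2l.
have Wt : enorm (W t x) <= C * (1 + enorm x) := curve_speed fX x t0.
have ex0 := excess_ge0 (A / 2) x.
apply: le_trans (pairing_dist _ _ _ _ HM) _.
have F1 : enorm (W s x - W t x) * M <= (k1 + Lv * (N * (1 + enorm x) * h)) * M.
  exact: ler_wpM2r.
have [xA|xA] := leP (enorm x) A.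
  have F2 : enorm (W t x) * enorm (G (X s x) - G (X t x)) <= C * (1 + enorm x) * k2.
    apply: ler_pM => //; apply: He; apply: le_lt_trans Xst _; apply: lt_le_trans hl3.
    rewrite mulrC ltr_pM2l// ltr_pwDr//; apply: ler_wpM2l => //.
    by rewrite lerD2l.
  have F3 : 0 <= 6 * C * M * excess (A / 2) x.
    by apply: mulr_ge0 => //; apply: mulr_ge0 => //; exact: mulr_ge0.
  exact: (near_arith F1 F2 F3).
have F2 : enorm (W t x) * enorm (G (X s x) - G (X t x)) <= C * (3 * excess (A / 2) x) * (2 * M).
  apply: ler_pM => //.
    apply: le_trans Wt _; apply: ler_wpM2l => //; apply: growth_le_excess => //.
    exact: ltW.
  apply: le_trans (ler_enormD _ _) _; rewrite enormN mulr_natl mulr2n.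
  exact: lerD.
have F3 : 0 <= C * k2 * (1 + enorm x) by apply: mulr_ge0 => //; apply: mulr_ge0 => //; exact: ltW.
exact: (far_arith F1 F2 F3).
Qed.

(** Integrate [phi_along_flow] against the initial measure, exchange the two
    integrals and change variables back. *)
Lemma curve_weak (t : R) : 0 <= t ->
  mean (curve X t) phi = mean (curve X 0) phi +
    tint (fun s => mean (curve X s) (fun x => dotv (V (curve X) s x) (G x))) t.
Proof.
move=> t0.
have lphi0 : lingrowth phi.
  have [M M0 HM] := phi_bounded; split; first exact: cphi.
  by exists M => x; apply: le_trans (HM _) _; rewrite ler_peMr// lerDl.
have tE s : 0 <= s -> (fun x => tint (fun u => dotv (W u x) (G (X u x))) s) =
    (fun x => phi (X s x) - phi x).
  by move=> s0; apply/funext => x; rewrite (phi_along_flow x s0) addrC addKr.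
have lI s : 0 <= s -> lingrowth (fun x => tint (fun u => dotv (W u x) (G (X u x))) s).
  by move=> s0; rewrite tE//; apply: lingrowthB => //; exact: phi_flow_lingrowth.
have E := @mean_tint R d m0 (fun s x => dotv (W s x) (G (X s x))) pairing_cont0
  pairing_lingrowth lI (fun s s0 k k0 => pairing_mean_cont s0 k0) t t0.
rewrite (mean_curve_cont t0 cphi (phi_flow_lingrowth t0)).
have -> : mean (curve X 0) phi = mean m0 phi by rewrite /curve lexx.
have -> : mean m0 (fun x => phi (X t x)) =
    mean m0 phi + mean m0 (fun x => tint (fun u => dotv (W u x) (G (X u x))) t).
  rewrite -(meanD m0 lphi0 (lI t t0)); apply: eq_mean => x.
  exact: phi_along_flow.
apply: (congr1 (fun z => mean m0 phi + z)); apply: (etrans E).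
apply: eq_Rintegral => s; rewrite inE/= in_itv/= => /andP[s0 _].
apply: esym; apply: (mean_curve_cont s0); last exact: pairing_lingrowth.
exact: (dotv_continuous (lipv_continuous (vfield_lip rho1 L0 KL (curve_cont fX) s0)) cG).
Qed.

End test_function.
End weak_solution.
End picard.

(** * Well-posedness *)

Section solutions.
Context {R : realType} {d : nat}.
Variables (tau L : R) (rho : probability (measurableTypeR R) R).
Variable K : 'rV[R]_d -> 'rV[R]_d -> 'rV[R]_d.
Hypothesis tau0 : 0 < tau.
Hypothesis rho1 : rho `[- tau, 0]%classic = 1%E.
Hypothesis L0 : 0 < L.
Hypothesis KL : forall x x' y y',
  enorm (K x y - K x' y') <= L * (enorm (x - x') + enorm (y - y')).
Local Notation delays := [set s : R | - tau <= s <= 0].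
Local Notation times := [set s : R | - tau <= s].
Implicit Types mu nu : R -> P1 R d.

Lemma solution_cont mu_in mu : is_solution tau rho K mu_in mu -> W1cont times mu.
Proof.
move=> [/W1contP cmu _ _]; apply: W1cont_sub cmu => t /= ts.
by rewrite in_itv/= andbT.
Qed.

Lemma solution_init mu_in mu : is_solution tau rho K mu_in mu ->
  forall s, delays s -> measure_eq (mu s) (mu_in s).
Proof.
move=> [_ H _] s sI; have sI' : s \in `[- tau, 0] by rewrite in_itv.
by have := H s sI'; rewrite /history add0r.
Qed.

Lemma solution_stability mu_in nu_in mu nu (D0 : R) : 0 <= D0 ->
  is_solution tau rho K mu_in mu -> is_solution tau rho K nu_in nu ->
  (forall s, delays s -> W1le (mu_in s) (nu_in s) D0) ->
  (forall s, delays s -> W1le (mu s) (nu s) D0) /\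
  (forall t, 0 <= t -> W1le (mu t) (nu t) (D0 * expR (@stab_rate R d L * t))).
Proof.
move=> D00 smu snu HD.
have HD' s : delays s -> W1le (mu s) (nu s) D0.
  move=> sI; have h1 := W1le_measure_eq (solution_init smu sI).
  have h2 := W1le_sym (W1le_measure_eq (solution_init snu sI)).
  by have := W1le_trans (W1le_trans h1 (HD s sI)) h2; rewrite add0r addr0.
split=> // t t0; apply: (stability tau0 rho1 L0 KL) => //.
- exact: solution_cont smu.
- exact: solution_cont snu.
- by case: smu.
- by case: snu.
Qed.

Lemma solution_unique mu_in mu nu : is_solution tau rho K mu_in mu ->
  is_solution tau rho K mu_in nu ->
  forall t, - tau <= t -> measure_eq (nu t) (mu t).
Proof.
move=> smu snu t tt.
have [h1 h2] := solution_stability (lexx 0) snu smu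
  (fun s _ => W1le_measure_eq (fun A _ => erefl (mu_in s A))).
apply: W1le0_measure_eq; have [t0|t0] := leP 0 t.
  by have := h2 t t0; rewrite mul0r.
by apply: h1; rewrite /= tt ltW.
Qed.

Lemma calW1_ge0 mu nu : (0 <= calW1 tau mu nu)%E.
Proof.
apply: le_trans (W1_ge0 (mu 0) (nu 0)) _.
by apply: ereal_sup_ubound; exists 0 => //=; rewrite in_itv/= lexx oppr_le0 ltW.
Qed.

(** At times before 0 the initial data are compared directly, with a factor at
    least 1; an infinite initial distance leaves nothing to prove. *)
Lemma calW1_stability mu_in nu_in mu nu t : is_solution tau rho K mu_in mu ->
  is_solution tau rho K nu_in nu -> 0 <= t ->
  (calW1 tau (history mu t) (history nu t) <=
    (expR (@stab_rate R d L * t))%:E * calW1 tau mu_in nu_in)%E.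
Proof.
move=> smu snu t0; set C := @stab_rate R d L.
have C0 : 0 < C := stab_rate_gt0 L0.
have E1 : 1 <= expR (C * t) by rewrite -expR0 ler_expR mulr_ge0// ltW.
have := calW1_ge0 mu_in nu_in; case ED : (calW1 tau mu_in nu_in) => [D| |] // D0; last first.
  by rewrite gt0_muley ?leey// lte_fin expR_gt0.
rewrite lee_fin in D0.
have HD s : delays s -> W1le (mu_in s) (nu_in s) D.
  move=> sI; apply/W1leP; rewrite -ED; apply: ereal_sup_ubound; exists s => //.
have [h1 h2] := solution_stability D0 smu snu HD.
rewrite -EFinM; apply: ge_ereal_sup => _ [s /= sI <-].
rewrite in_itv/= in sI; have /andP[s1 s2] := sI.
apply/W1leP; rewrite /history mulrC; have [ts|ts] := leP 0 (t + s).
  apply: W1le_le (h2 _ ts); apply: ler_wpM2l => //.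
  by rewrite ler_expR ler_pM2l// gerDl.
apply: (@W1le_le _ _ _ _ D); first by rewrite ler_peMr.
by apply: h1; rewrite /= (ltW ts) andbT (le_trans s1)// lerDr.
Qed.

(** A point of the initial ball of radius [R0] is displaced by at most
    [E * (1 + R0)], which gives the radius of a ball of full measure. *)
Lemma solution_exists mu_in (R0 : R) : in_E tau mu_in ->
  (forall s, s \in `[- tau, 0] -> msupport (mu_in s) `<=` eball R0) ->
  exists2 mu, is_solution tau rho K mu_in mu &
    forall t, 0 <= t -> compact (msupport (mu t)).
Proof.
move=> /W1contP cin supp.
have tD : - tau <= 0 by rewrite oppr_le0 ltW.
have cmu_in : W1cont delays mu_in by apply: W1cont_sub cin => s /= sI; rewrite in_itv.
have [Min Min0 HMin] := moment1_bounded tD cmu_in.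
have [X [fX HX]] := characteristics tau0 rho1 L0 KL cmu_in Min0 HMin.
exists (curve mu_in X).
  split.
  - apply/W1contP; have := curve_cont tau0 L0 cmu_in Min0 fX; apply: W1cont_sub => t /=.
    by rewrite in_itv/= andbT.
  - move=> s; rewrite in_itv/= => /andP[_ s0] A mA.
    by rewrite /history add0r /curve s0.
  - move=> phi phiC1 t t0.
    exact: (curve_weak tau0 rho1 L0 KL cmu_in Min0 HMin fX HX phiC1 t0).
move=> t; rewrite le_eqVlt => /orP[/eqP <-|t0].
  rewrite /curve lexx; apply: (@msupport_compact _ _ _ R0); apply: msupport_null.
  by apply: supp; rewrite in_itv/= lexx tD.
pose E := expR (growth_rate L K mu_in Min * t).
apply: (@msupport_compact _ _ _ (R0 + E * (1 + R0))).
rewrite /curve leNgt t0/= (pushE _ _ (flow_lip fX (ltW t0))).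
apply/eqP; rewrite -measure_le0.
have null : mu_in 0 (~` eball R0) = 0%E.
  by apply: msupport_null; apply: supp; rewrite in_itv/= lexx tD.
rewrite -[leRHS]null; apply: le_measure; rewrite ?inE.
- rewrite -[X in measurable X]setTI.
  apply: (borelv_continuous_measurable (lipv_continuous (flow_lip fX (ltW t0)))) => //.
  exact: open_borel (@eball_compl_open _ _ _).
- exact: open_borel (@eball_compl_open _ _ _).
move=> x /= xE xR; apply: xE; rewrite /eball /= in xR *.
have := flow_disp fX x (ltW t0); have := ler_enormD x (X t x - x).
rewrite addrC subrK -/E => h1 h2.
have E0 : 0 <= E := expR_ge0 _.
have : E * (1 + enorm x) <= E * (1 + R0) by apply: ler_wpM2l => //; rewrite lerD2l.
by move: h1 h2 xR; lra.
Qed.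

End solutions.

Theorem theorem4p1 (R : realType) (d : nat) (tau : R)
    (rho : probability (measurableTypeR R) R)
    (K : 'rV[R]_d -> 'rV[R]_d -> 'rV[R]_d)
    (d_gt0 : (0 < d)%N) (tau_gt0 : 0 < tau)
    (rho_supp : rho `[- tau, 0]%classic = 1%E)
    (K_lip : exists2 L : R, 0 < L & forall x x' y y' : 'rV[R]_d,
       enorm (K x y - K x' y') <= L * (enorm (x - x') + enorm (y - y'))) :
  (forall (R0 : R) (mu_in : R -> P1 R d),
     0 < R0 -> in_E tau mu_in ->
     (forall s : R, s \in `[- tau, 0] -> msupport (mu_in s) `<=` eball R0) ->
     exists mu : R -> P1 R d,
       [/\ is_solution tau rho K mu_in mu,
           forall nu : R -> P1 R d, is_solution tau rho K mu_in nu ->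
             forall t : R, - tau <= t -> measure_eq (nu t) (mu t)
         & forall t : R, 0 <= t -> compact (msupport (mu t))]) /\
  (exists r : R -> R,
     [/\ {within `[0, +oo[, continuous r},
         {in `[0, +oo[ &, {homo r : s t / s < t}},
         forall t : R, 0 <= t -> 1 <= r t,
         r 0 = 1
       & forall mu_in nu_in : R -> P1 R d,
           compactly_supported_in_E tau mu_in ->
           compactly_supported_in_E tau nu_in ->
           forall mu nu : R -> P1 R d,
             is_solution tau rho K mu_in mu ->
             is_solution tau rho K nu_in nu ->
             forall t : R, 0 <= t ->
               (calW1 tau (history mu t) (history nu t) <=
                (r t)%:E * calW1 tau mu_in nu_in)%E]).
Proof.
have [L L0 KL] := K_lip; split.
  move=> R0 mu_in R00 mu_inE supp.
  have [mu smu cmu] := solution_exists tau_gt0 rho_supp L0 KL mu_inE supp.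
  exists mu; split=> // nu snu.
  exact: (solution_unique tau_gt0 rho_supp L0 KL smu snu).
have C0 := @stab_rate_gt0 R d L L0.
exists (fun t => expR (@stab_rate R d L * t)); split.
- apply: continuous_subspaceT => t.
  apply: (@continuous_comp _ _ _ (fun s => stab_rate L * s) (@expR R)); last exact: continuous_expR.
  exact: mulrl_continuous.
- by move=> s t _ _ st; rewrite ltr_expR ltr_pM2l.
- by move=> t t0; rewrite -expR0 ler_expR mulr_ge0// ltW.
- by rewrite mulr0 expR0.
move=> mu_in nu_in _ _ mu nu smu snu t t0.
exact: (calW1_stability tau_gt0 rho_supp L0 KL smu snu t0).
Qed.
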